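(* Assume: (i) $n,d\to\infty$ with $n/d\to r\in(0,\infty)$; (ii) the data distribution $\pi_0$ on $\mathbb{R}^d$ has mean $0$ and covariance $\Sigma$ with $\liminf_{d\to\infty}\mathrm{Tr}(\Sigma)/d\ge c_0>0$, and satisfies a log-Sobolev inequality with a constant $C_{\mathrm{LSI}}\ge 1$ independent of $d$; (iii) the kernel $K(x,x')=h(\langle x,x'\rangle/d)$ is positive definite, $h:\mathbb{R}\to\mathbb{R}$ is three times continuously differentiable with $h(0)=h''(0)=0$, $h'(0)=1$, and $|h'''(x)|\le Ce^{C|x|}$ for all $x\in\mathbb{R}$, for some constant $C\ge1$. Then the kernel operators $\widehat{\mathcal K},\mathcal K$ and their effective counterparts $\widehat{\mathcal K}_{\mathrm{eff}},\mathcal K_{\mathrm{eff}}$ satisfy $$\|\widehat{\mathcal K}-\widehat{\mathcal K}_{\mathrm{eff}}\|_{\mathrm{op}}\vee\|\mathcal K-\mathcal K_{\mathrm{eff}}\|_{\mathrm{op}}\prec d^{-3/2}.$$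
   Context: **Data and noise.** All objects are indexed by $d$, with $n=n_d$, $\pi_0=\pi_{0,d}$; $h$ and the diffusion time $t>0$ are fixed independently of $d$, $\rho=e^{-t}$, $\sigma=\sqrt{1-e^{-2t}}$. Training data $x_{0,1},\dots,x_{0,n}$ are i.i.d. from $\pi_0$. The log-Sobolev inequality with constant $C_{\mathrm{LSI}}$ is $\mathbb E_{\pi_0}[f^2\log f^2]-\mathbb E_{\pi_0}[f^2]\log\mathbb E_{\pi_0}[f^2]\le 2C_{\mathrm{LSI}}\mathbb E_{\pi_0}\|\nabla f\|_2^2$ for all $f\in W^{1,2}(\pi_0)$. Put $\tau_\Sigma=\mathrm{Tr}(\Sigma)/d$, $\pi_d=\pi_0\otimes\mathcal N(0,I_d)$, $\widehat\pi_{d,n}=\mathrm{Unif}(\{x_{0,i}\}_{i\le n})\otimes\mathcal N(0,I_d)$. $X\prec Y$ (nonnegative random sequences) means: for every $\epsilon>0$ there are $c>0,d_0$ with $\mathbb P(X_d>d^{\epsilon}Y_d)\le e^{-d^{c}}$ for $d\ge d_0$. **Operators.** $K$ is continuous and $K(u,u)$ is integrable under the pushforwards of $\pi_d$ and $\widehat\pi_{d,n}$ by $(x,z)\mapsto\rho x+\sigma z$. The operators $\widehat{\mathcal K}:L^2(\widehat\pi_{d,n})\to L^2(\widehat\pi_{d,n})$ and $\mathcal K:L^2(\widehat\pi_{d,n})\to L^2(\pi_d)$ are both given by the formula $f\mapsto\big[(x,z)\mapsto\mathbb E_{(x',z')\sim\widehat\pi_{d,n}}[K(\rho x+\sigma z,\rho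 x'+\sigma z')f(x',z')]\big]$, viewed respectively in $L^2(\widehat\pi_{d,n})$ and $L^2(\pi_d)$. With $\delta_n=\frac{h(\rho^2\tau_\Sigma)-\rho^2\tau_\Sigma}{n}$, $$\widehat{\mathcal K}_{\mathrm{eff}}f(x,z)=\mathbb E_{(x',z')\sim\widehat\pi_{d,n}}\Big[\tfrac{\langle\rho x+\sigma z,\rho x'+\sigma z'\rangle}{d}f(x',z')\Big]+\delta_n\mathbb E_{z'\sim\mathcal N(0,I_d)}[f(x,z')]$$ as an operator $L^2(\widehat\pi_{d,n})\to L^2(\widehat\pi_{d,n})$, and $$\mathcal K_{\mathrm{eff}}f(x,z)=\mathbb E_{(x',z')\sim\widehat\pi_{d,n}}\Big[\tfrac{\langle\rho x+\sigma z,\rho x'+\sigma z'\rangle}{d}f(x',z')\Big]$$ as an operator $L^2(\widehat\pi_{d,n})\to L^2(\pi_d)$. *)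

(* Defs.v *)
From HB Require Import structures.
From mathcomp Require Import all_boot all_order all_algebra.
From mathcomp Require Import all_classical all_reals all_analysis.
From mathcomp Require Import measurable_realfun.

Set Implicit Arguments.
Unset Strict Implicit.
Unset Printing Implicit Defensive.

Import Order.TTheory GRing.Theory Num.Theory.
Import numFieldTopology.Exports numFieldNormedType.Exports.

Local Open Scope classical_set_scope.
Local Open Scope ring_scope.

(** R^d is ['rV[R]_d], with the product (= Borel) sigma-algebra generated by
    the coordinates. *)

Fact rV_display : measure_display. Proof. exact: default_measure_display. Qed.

Section rV_measurable.
Context {R : realType} (d : nat).

Let coord (i : 'I_d) (x : 'rV[R]_d) : R := x ord0 i.

Let rV_set0 : g_sigma_preimage coord set0.
Proof. exact: sigma_algebra0. Qed.

Let rV_setC A : g_sigma_preimage coord A -> g_sigma_preimage coord (~` A).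
Proof. exact: sigma_algebraC. Qed.

Let rV_bigcup (F : (set 'rV[R]_d)^nat) :
  (forall i, g_sigma_preimage coord (F i)) ->
  g_sigma_preimage coord (\bigcup_i (F i)).
Proof. exact: sigma_algebra_bigcup. Qed.

HB.instance Definition _ := @isMeasurable.Build rV_display 'rV[R]_d
  (g_sigma_preimage coord) rV_set0 rV_setC rV_bigcup.

End rV_measurable.

Section rV_measurable_fun.
Context {R : realType}.

Lemma measurable_rV_coord d (i : 'I_d) :
  measurable_fun [set: 'rV[R]_d] (fun x : 'rV[R]_d => x ord0 i).
Proof.
move=> _ Y mY; rewrite setTI; apply: sub_sigma_algebra => /=.
rewrite -bigcup_seq/=; exists i => /=; first by rewrite mem_index_enum.
by exists Y => //; rewrite setTI.
Qed.

Lemma measurable_fun_rV d disp (T : measurableType disp) (f : T -> 'rV[R]_d) :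
  (forall i, measurable_fun [set: T] (fun w => f w ord0 i)) ->
  measurable_fun [set: T] f.
Proof.
move=> mf _ A mA; rewrite setTI.
suff : measurable `<=` [set B : set 'rV[R]_d | measurable (f @^-1` B)].
  by apply.
apply: smallest_sub.
- split => /=.
  + by rewrite preimage_set0.
  + by move=> B mB; rewrite setTD preimage_setC; exact: measurableC.
  + by move=> F mF; rewrite preimage_bigcup; exact: bigcup_measurable.
- rewrite -bigcup_seq => B [i _] [C mC <-] /=.
  rewrite setTI -comp_preimage -[X in measurable X]setTI.
  exact: mf.
Qed.

End rV_measurable_fun.

(** ** The standard Gaussian measure on R^d *)

Section std_gaussian.
Context {R : realType}.

Definition rV_cons d (p : measurableTypeR R * 'rV[R]_d) : 'rV[R]_d.+1 :=
  row_mx (p.1 : R)%:M p.2.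

Lemma rV_cons0 d (p : measurableTypeR R * 'rV[R]_d) : rV_cons p ord0 ord0 = p.1.
Proof.
have -> : ord0 = lshift d ord0 :> 'I_(1 + d) by exact: val_inj.
by rewrite [LHS]row_mxEl mxE eqxx mulr1n.
Qed.

Lemma rV_consS d (p : measurableTypeR R * 'rV[R]_d) (i : 'I_d) :
  rV_cons p ord0 (lift ord0 i) = p.2 ord0 i.
Proof.
have -> : lift ord0 i = rshift 1 i :> 'I_(1 + d) by exact: val_inj.
by rewrite [LHS]row_mxEr.
Qed.

Lemma measurable_rV_cons d : measurable_fun setT (@rV_cons d).
Proof.
apply: measurable_fun_rV => i; have [j ->|->] := unliftP ord0 i.
- under eq_fun do rewrite rV_consS.
  exact: (measurableT_comp (measurable_rV_coord j) measurable_snd).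
- under eq_fun do rewrite rV_cons0.
  exact: measurable_fst.
Qed.

HB.instance Definition _ d :=
  isMeasurableFun.Build _ _ _ _ (@rV_cons d) (@measurable_rV_cons d).

(** N(0, I_d): the law of a vector with independent N(0, 1) coordinates. *)
Fixpoint std_gaussian (d : nat) : probability 'rV[R]_d R :=
  if d is d'.+1 then
    distribution (normal_prob (0 : R) 1 \x std_gaussian d')%E (@rV_cons d')
  else \d_(0 : 'rV[R]_0).

Lemma std_gaussian_box d (A : 'I_d -> set (measurableTypeR R)) :
  (forall i, measurable (A i)) ->
  std_gaussian d [set z : 'rV[R]_d | forall i, A i (z ord0 i)]
  = (\prod_(i < d) normal_prob 0 1 (A i))%E.
Proof.
elim: d A => [|d IH] A mA /=.
  rewrite big_ord0 (_ : [set z | _] = setT) ?diracT//.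
  by apply/seteqP; split=> // z _ [].
rewrite big_ord_recl -IH// -product_measure1E//; last first.
  rewrite (_ : [set z | _] =
    \bigcap_(i in [set: 'I_d]) ((fun z : 'rV[R]_d => z ord0 i) @^-1` A (lift ord0 i))).
    apply: fin_bigcap_measurable => // i _.
    by have := measurable_rV_coord i measurableT (mA (lift ord0 i)); rewrite setTI.
  by apply/seteqP; split => z /= h i; [move=> _|]; exact: h.
rewrite /distribution /pushforward; congr (_ _).
apply/seteqP; split => -[a z] /=.
- move=> h; split => /=; first by have := h ord0; rewrite rV_cons0.
  by move=> i; have := h (lift ord0 i); rewrite rV_consS.
- move=> [/= Aa h] i; have [j ->|->] := unliftP ord0 i.
  + by rewrite rV_consS.
  + by rewrite rV_cons0.
Qed.

End std_gaussian.

(** ** The distribution of the data *)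

Section data.
Context {R : realType} {d : nat}.
Implicit Types (mu : probability 'rV[R]_d R) (f : 'rV[R]_d -> R)
  (g : 'rV[R]_d -> 'rV[R]_d).

Definition dotp (u v : 'rV[R]_d) : R := \sum_i u ord0 i * v ord0 i.

Definition gradient f (x : 'rV[R]_d) : 'rV[R]_d :=
  \row_i 'D_(delta_mx ord0 i) f x.

Definition C1 f := (forall x, differentiable f x) /\ continuous (gradient f).

Definition L2_field mu g := forall i, (fun x => g x ord0 i) \in Lfun mu 2%:E.

(** The Sobolev space W^{1,2}(mu) of a probability measure that need not have
    a density: the closure, in the norm (|f|_2^2 + |grad f|_2^2)^(1/2), of the
    C^1 functions of finite norm (equivalently, of the compactly supported
    smooth functions).  [W12 mu f g] says that [f] is in W^{1,2}(mu) and that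
    [g] is a gradient of [f]. *)
Definition W12 mu f g :=
  [/\ f \in Lfun mu 2%:E, L2_field mu g &
    exists phi : nat -> 'rV[R]_d -> R,
    [/\ forall k, [/\ C1 (phi k), phi k \in Lfun mu 2%:E
                    & L2_field mu (gradient (phi k))],
        (fun k => \int[mu]_x ((phi k x - f x) ^+ 2)%:E)%E @ \oo --> 0%E &
        (fun k => \int[mu]_x (dotp (gradient (phi k) x - g x)
                                   (gradient (phi k) x - g x))%:E)%E
          @ \oo --> 0%E]].

(** Since [ln 0 = 0], the integrand [f^2 log f^2] is 0 where [f] vanishes; it
    is bounded below, so its integral exists in ]-oo, +oo]. *)
Definition log_sobolev mu (C : R) :=
  forall f g, W12 mu f g ->
  let m := \int[mu]_x (f x ^+ 2) in
  (\int[mu]_x (f x ^+ 2 * ln (f x ^+ 2))%:E - (m * ln m)%:E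
   <= (2 * C)%:E * \int[mu]_x (dotp (g x) (g x))%:E)%E.

Definition centered mu := forall i, ('E_mu[fun x => x ord0 i] = 0)%E.

Definition has_covariance mu (Sigma : 'M[R]_d) := forall i j,
  covariance mu (fun x => x ord0 i) (fun x => x ord0 j) = (Sigma i j)%:E.

Definition iid_sample disp (Omega : measurableType disp)
    (P : probability Omega R) mu n (X : 'I_n -> Omega -> 'rV[R]_d) :=
  [/\ forall i, measurable_fun setT (X i),
      forall i A, measurable A -> P (X i @^-1` A) = mu A &
      forall A : 'I_n -> set 'rV[R]_d, (forall i, measurable (A i)) ->
        P [set w | forall i, A i (X i w)] = (\prod_(i < n) P (X i @^-1` A i))%E].

(** [\sum_k \d_(s`_k) / size s]: points are counted with multiplicity. *)
Definition empirical (s : seq 'rV[R]_d) : {measure set 'rV[R]_d -> \bar R} :=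
  mscale ((size s)%:R^-1)%:nng (msum (fun k => \d_(s`_k)) (size s)).

End data.

(** [X ≺ Y].  The probability is the outer one, which is [P] itself on events. *)
Definition prec {R : realType} disp (Omega : measurableType disp)
    (P : probability Omega R) (X Y : nat -> Omega -> \bar R) :=
  forall eps : R, 0 < eps -> exists (c : R) (d0 : nat), 0 < c /\
  forall d, (d0 <= d)%N ->
  (mu_ext P [set w | (d%:R `^ eps)%:E * Y d w < X d w]
   <= (expR (- (d%:R `^ c)))%:E)%E.

(** ** Kernels and operators *)

Definition pd_kernel {R : realType} (T : Type) (K : T -> T -> R) :=
  (forall x y, K x y = K y x) /\
  forall m (x : 'I_m -> T) (c : 'I_m -> R),
    0 <= \sum_i \sum_j c i * c j * K (x i) (x j).

(** The operator norm of [T : L^2(mu) -> L^2(nu)]; [T] acts on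
    representatives, and is meant to respect a.e. equality. *)
Definition opnorm {R : realType} d1 (T1 : measurableType d1) d2
    (T2 : measurableType d2) (mu : {measure set T1 -> \bar R})
    (nu : {measure set T2 -> \bar R}) (T : (T1 -> R) -> T2 -> R) : \bar R :=
  ereal_sup [set ('N[nu]_2%:E [EFin \o T f])%E | f in
    [set f : T1 -> R | f \in Lfun mu 2%:E /\ ('N[mu]_2%:E [EFin \o f] <= 1)%E]].

Section operators.
Context {R : realType} (h : R -> R) (t : R) {d : nat}.
Local Notation V := 'rV[R]_d.
Implicit Types (mu : probability V R) (s : seq V) (f : V * V -> R).

Definition rho : R := expR (- t).
Definition sigma : R := Num.sqrt (1 - expR (- (2 * t))).

Definition noised (p : V * V) : V := rho *: p.1 + sigma *: p.2.

Lemma measurable_noised : measurable_fun setT noised.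
Proof.
apply: measurable_fun_rV => i; rewrite /noised.
under eq_fun do rewrite !mxE.
apply: measurable_funD; apply: measurable_funM => //.
- exact: (measurableT_comp (measurable_rV_coord i) measurable_fst).
- exact: (measurableT_comp (measurable_rV_coord i) measurable_snd).
Qed.

Section noised_law.
Variable nu : {measure set (V * V) -> \bar R}.

Definition noised_law := pushforward nu noised.

Let m_noised A : measurable A -> measurable (noised @^-1` A).
Proof. by move=> mA; rewrite -[X in measurable X]setTI; exact: measurable_noised. Qed.

Let noised_law0 : noised_law set0 = 0%E.
Proof. by rewrite /noised_law /pushforward preimage_set0 measure0. Qed.

Let noised_law_ge0 A : (0 <= noised_law A)%E.
Proof. exact: (measure_ge0 nu). Qed.

Let noised_law_sigma_additive : semi_sigma_additive noised_law.
Proof.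
move=> F mF tF mUF; rewrite /noised_law /pushforward preimage_bigcup.
apply: measure_semi_sigma_additive.
- by move=> k; exact: m_noised.
- apply/trivIsetP => i j _ _ ij; rewrite -preimage_setI.
  by move/trivIsetP : tF => /(_ _ _ _ _ ij) ->//; rewrite preimage_set0.
- by rewrite -preimage_bigcup; exact: m_noised.
Qed.

HB.instance Definition _ := isMeasure.Build _ _ _ noised_law
  noised_law0 noised_law_ge0 noised_law_sigma_additive.

End noised_law.

Definition noisy mu : {measure set (V * V) -> \bar R} :=
  (mu \x std_gaussian d)%E.

Definition noisy_empirical s : {measure set (V * V) -> \bar R} :=
  (empirical s \x std_gaussian d)%E.

Definition inner_kernel (x y : V) : R := h (dotp x y / d%:R).

Definition linear_kernel (x y : V) : R := dotp x y / d%:R.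

Definition diag_integrable (nu : {measure set (V * V) -> \bar R}) :=
  (noised_law nu).-integrable setT (fun u => (inner_kernel u u)%:E).

Definition kernel_op (K : V -> V -> R) s f (p : V * V) : R :=
  \int[noisy_empirical s]_q (K (noised p) (noised q) * f q).

Definition delta (Sigma : 'M[R]_d) (n : nat) : R :=
  let tau := \tr Sigma / d%:R in
  (h (rho ^+ 2 * tau) - rho ^+ 2 * tau) / n%:R.

(** [Khat] and [Kop] have the same formula; they are viewed as maps from
    [L^2(noisy_empirical s)] into [L^2(noisy_empirical s)] and into
    [L^2(noisy mu)] respectively. *)
Definition Khat s := kernel_op inner_kernel s.

Definition Kop s := kernel_op inner_kernel s.

Definition Khat_eff Sigma s f (p : V * V) : R :=
  kernel_op linear_kernel s f p +
  delta Sigma (size s) * \int[std_gaussian d]_z f (p.1, z).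

Definition Kop_eff s := kernel_op linear_kernel s.

Definition train_error Sigma s : \bar R :=
  opnorm (noisy_empirical s) (noisy_empirical s)
    (fun f => Khat s f \- Khat_eff Sigma s f).

Definition test_error mu s : \bar R :=
  opnorm (noisy_empirical s) (noisy mu) (fun f => Kop s f \- Kop_eff s f).

End operators.

Definition sample {R : realType} {d n : nat} (Omega : Type)
    (X : 'I_n -> Omega -> 'rV[R]_d) (w : Omega) : seq 'rV[R]_d :=
  [seq X i w | i <- enum 'I_n].

(* Main.v *)
Require Import Defs.
From HB Require Import structures.
From mathcomp Require Import all_boot all_order all_algebra.
From mathcomp Require Import all_classical all_reals all_analysis.
From mathcomp Require Import measurable_realfun.
From mathcomp Require Import ring lra.

(** Both differences are integral operators whose kernel, on the fibre of the
    pair of training points [(x_i, x_j)], is [g(<u, u'>/d) - g(s_ij)], where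
    [g(s) = h(s) - s] is the cubic remainder of [h], [u] and [u'] are the noised
    points, and [s_ij] is [rho^2 tau] if [i = j] in the training operator and
    [0] otherwise.  Hilbert-Schmidt norms suffice.  For [i <> j],
    [<u, u'>/d] is of order [d^(-1/2)], so [g] contributes [d^(-3/2)]; on the
    diagonal, [<u, u'>/d] is within [d^(-1/2)] of [rho^2 tau], and the weight
    [1/n] of the fibre brings the missing factor [1/d].

    With [k = d^(1/2 - eta)], all polynomial moments are absorbed in
    exponential ones through [v^m <= (m/k)^m exp(k v)], and the exponential
    moments of [<u, u'>] are Gaussian integrals, computed in closed form over
    the noise and bounded over the data by Herbst's argument applied to the
    linear functions and to the squared norm.  The same bounds, with Chernoff's
    inequality and the product law of two samples, give the concentration of
    [|x_i|^2] and of [<x_i, x_j>] outside an event of probability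
    [exp(- d^(eta/2))]. *)

Set Implicit Arguments.
Unset Strict Implicit.
Unset Printing Implicit Defensive.

Import Order.TTheory GRing.Theory Num.Theory.
Import numFieldTopology.Exports numFieldNormedType.Exports.

Local Open Scope classical_set_scope.
Local Open Scope ring_scope.

(** * Gaussian exponential moments *)

(** The scale $k=d^{1/2-\eta}$ meets two demands. Inner products enter the exponentials with the
    coefficient $2k/d$, so the quadratic terms in data and noise carry $4k^2/d^2$ and have a bounded
    total because $k^2\le d$. The sample is allowed the deviation $d/k=d^{1/2+\eta}$, slightly above
    its natural fluctuation, which makes failure stretched-exponentially rare. The squared error is
    then of order $k^{-6}+n^{-2}k^{-2}$, at most $d^{-3+6\eta}$, and $d^{\epsilon}$ pays for the
    loss.

    Exponentials of linear functions and of the squared norm are not known beforehand to lie in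
    $W^{1,2}$, so Herbst's argument runs on bounded truncations and then passes to the limit. The
    squared norm is not Lipschitz; since its squared gradient is $4|x|^2$, the argument is set up
    for $|\nabla P|^2\le A+BP$, which covers linear functions with $B=0$. On the diagonal,
    subtracting $g(\rho^2\tau)$ is what $\delta_n$ achieves: a kernel constant on a fibre acts as
    integration over the noise. *)

Section density.
Local Open Scope ereal_scope.
Context disp (T : measurableType disp) (R : realType).
Variables (mu nu : {measure set T -> \bar R}) (g : T -> R).
Hypothesis mg : measurable_fun setT g.
Hypothesis g0 : forall x, (0 <= g x)%R.
Hypothesis nuE : forall A, measurable A -> nu A = \int[mu]_(x in A) (g x)%:E.

Import HBNNSimple.

(** For simple functions linearity reduces the identity to [nuE]; both sides then pass to monotone
    limits along [nnsfun_approx]. *)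
Lemma ge0_integral_density (f : T -> \bar R) : measurable_fun setT f ->
  (forall x, 0 <= f x) -> \int[nu]_x f x = \int[mu]_x (f x * (g x)%:E).
Proof.
move=> mf f0.
have meg : measurable_fun setT (EFin \o g) by exact/measurable_EFinP.
have simple (s : {nnsfun T >-> R}) :
    \int[nu]_x (s x)%:E = \int[mu]_x ((s x)%:E * (g x)%:E).
  under eq_integral do rewrite fimfunE -fsumEFin//.
  rewrite ge0_integral_fsum//; last 2 first.
    - by move=> r; exact/measurable_EFinP/measurableT_comp.
    - by move=> r x _; rewrite EFinM nnfun_muleindic_ge0.
  under [RHS]eq_integral => x _.
    rewrite fimfunE -fsumEFin// ge0_mule_fsuml; last first.
      by move=> r; rewrite EFinM nnfun_muleindic_ge0.
    over.
  rewrite ge0_integral_fsum//; last 2 first.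
    - move=> r; apply: emeasurable_funM => //.
      by apply/measurable_EFinP/measurableT_comp.
    - by move=> r x _; rewrite mule_ge0 ?lee_fin// -?lee_fin EFinM nnfun_muleindic_ge0.
  apply: eq_fsbigr => r _.
  rewrite integralZl_indic_nnsfun//= integral_indic// setIT nuE//.
  have [r0|r0] := leP 0%R r; last first.
    rewrite preimage_nnfun0// integral_set0 mule0 integral0_eq// => x _.
    by rewrite indic0 mulr0 mul0e.
  rewrite integral_mkcond -ge0_integralZl//.
  - apply: eq_integral => x _.
    rewrite /patch EFinM -muleA indicE; case: ifPn => xr; first by rewrite mul1e.
    by rewrite mul0e !mule0.
  - by apply/(measurable_restrictT _ _).1 => //; exact: measurable_funTS.
  - by move=> x _; rewrite erestrict_ge0// => y _; rewrite lee_fin.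
pose f_ := nnsfun_approx measurableT mf.
transitivity (limn (fun n => \int[nu]_x (f_ n x)%:E)).
  rewrite -monotone_convergence//=.
  - apply: eq_integral => x /[!inE] xD; apply/esym/cvg_lim => //=.
    exact: cvg_nnsfun_approx.
  - by move=> n; apply: measurableT_comp.
  - by move=> n x _; rewrite lee_fin.
  - by move=> x _ a b ab; rewrite lee_fin//; exact/lefP/nd_nnsfun_approx.
under eq_fun do rewrite simple.
rewrite -monotone_convergence//=.
- apply: eq_integral => x /[!inE] xD; apply/cvg_lim => //=.
  apply: cvgeZr => //; exact: cvg_nnsfun_approx.
- by move=> n; apply: emeasurable_funM => //; exact: measurableT_comp.
- by move=> n x _; rewrite mule_ge0 ?lee_fin.
- move=> x _ a b ab; rewrite lee_wpmul2r ?lee_fin//.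
  exact/lefP/nd_nnsfun_approx.
Qed.

End density.

Section gaussian_mgf.
Context {R : realType}.
Local Notation N01 := (@normal_prob R 0 1).

Lemma normal_pdfME (m s : R) : s != 0 ->
  normal_pdf m s = fun x => normal_peak s * normal_fun m s x.
Proof. by move=> s0; rewrite normal_pdfE. Qed.

Lemma ge0_integral_normal01 (f : R -> \bar R) : measurable_fun setT f ->
  (forall x, (0 <= f x)%E) ->
  (\int[N01]_x f x = \int[lebesgue_measure]_x (f x * (normal_pdf 0 1 x)%:E))%E.
Proof.
move=> mf f0; apply: ge0_integral_density => //.
- exact: measurable_normal_pdf.
- by move=> x; exact: normal_pdf_ge0.
Qed.

(** Completing the square turns $e^{ax}$ times the standard density into $e^{a^2/2}$ times the
    density of $\mathcal N(a,1)$. *)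
Lemma normal01_mgf (a : R) :
  (\int[N01]_x (expR (a * x))%:E = (expR (a ^+ 2 / 2))%:E)%E.
Proof.
rewrite ge0_integral_normal01; last 2 first.
- apply/measurable_EFinP; apply: measurableT_comp => //.
- by move=> x; rewrite lee_fin expR_ge0.
under eq_integral => x _.
  rewrite -EFinM normal_pdfME ?oner_eq0// mulrCA -expRD.
  have -> : a * x + - (x - 0) ^+ 2 / (1 ^+ 2 *+ 2)
            = a ^+ 2 / 2 + - (x - a) ^+ 2 / (1 ^+ 2 *+ 2) :> R by field.
  rewrite expRD mulrCA -/(normal_fun a 1 x).
  rewrite (_ : normal_peak 1 * _ = normal_pdf a 1 x); last first.
    by rewrite normal_pdfME ?oner_eq0.
  rewrite EFinM.
  over.
rewrite ge0_integralZl//.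
- by rewrite integral_normal_pdf mule1.
- by apply/measurable_EFinP; exact: measurable_normal_pdf.
- by move=> x _; rewrite lee_fin normal_pdf_ge0.
Qed.

(** Against the standard density the integrand becomes $s$ times the density of $\mathcal N(0,s^2)$
    with $s^2=(1-2a)^{-1}$, so the integral equals $s$. The bound $s\le e^{2a}$ follows from
    $(1-2a)(1+4a)=1+2a-8a^2\ge1$, which is where $a\le1/4$ enters. *)
Lemma normal01_mgf_sqr (a : R) : 0 <= a <= 1 / 4 ->
  (\int[N01]_x (expR (a * x ^+ 2))%:E <= (expR (2 * a))%:E)%E.
Proof.
move=> /andP[a0 a4].
have u0 : 0 < 1 - 2 * a by lra.
pose s := Num.sqrt (1 - 2 * a)^-1.
have s0 : 0 < s by rewrite sqrtr_gt0 invr_gt0.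
have s2 : s ^+ 2 = (1 - 2 * a)^-1 by rewrite sqr_sqrtr// invr_ge0 ltW.
rewrite ge0_integral_normal01; last 2 first.
- apply/measurable_EFinP; apply: measurableT_comp => //.
  by apply: measurable_funM => //; exact: measurable_funX.
- by move=> x; rewrite lee_fin expR_ge0.
under eq_integral => x _.
  rewrite -EFinM normal_pdfME ?oner_eq0// mulrCA -expRD.
  have -> : a * x ^+ 2 + - (x - 0) ^+ 2 / (1 ^+ 2 *+ 2)
            = - (x - 0) ^+ 2 / (s ^+ 2 *+ 2) :> R.
    by rewrite s2; field; lra.
  rewrite -/(normal_fun 0 s x).
  have -> : normal_peak 1 = s * normal_peak s.
    rewrite /normal_peak expr1n mul1r -mulrnAr sqrtrM ?sqr_ge0//.
    by rewrite sqrtr_sqr gtr0_norm// invfM mulVKf ?gt_eqF.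
  rewrite -mulrA (_ : normal_peak s * _ = normal_pdf 0 s x); last first.
    by rewrite normal_pdfME ?gt_eqF.
  rewrite EFinM.
  over.
rewrite ge0_integralZl//; last 3 first.
- by apply/measurable_EFinP; exact: measurable_normal_pdf.
- by move=> x _; rewrite lee_fin normal_pdf_ge0.
- by rewrite lee_fin ltW.
rewrite integral_normal_pdf mule1 lee_fin.
rewrite -(@ler_pXn2r _ 2) ?nnegrE ?expR_ge0 ?(ltW s0)// s2 -expRM_natl.
rewrite invf_ple ?posrE ?expR_gt0// -expRN.
rewrite -[leLHS]opprK lerNl.
have := expR_ge1Dx (2%:R * (2 * a)); set e := expR _ => he.
rewrite expRN -/e.
have e0 : 0 < e by exact: expR_gt0.
rewrite -lerN2 !opprK -subr_ge0.
have -> : 1 - 2 * a - e^-1 = ((1 - 2 * a) * e - 1) / e by field; lra.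
by apply: divr_ge0; [nra|lra].
Qed.

(** Since [std_gaussian] is built by recursion on the dimension, Tonelli splits off one coordinate
    of a product integrand; this is the induction step for both moment generating functions in
    dimension $d$. *)
Lemma ge0_integral_std_gaussianS d (f : R -> R) (g : 'rV[R]_d -> R) :
  measurable_fun setT f -> measurable_fun setT g ->
  (forall x, 0 <= f x) -> (forall y, 0 <= g y) ->
  (\int[std_gaussian d.+1]_z (f (z ord0 ord0) * g (\row_i z ord0 (lift ord0 i)))%:E =
   \int[N01]_x (f x)%:E * \int[std_gaussian d]_y (g y)%:E)%E.
Proof.
move=> mf mg f0 g0 /=.
rewrite ge0_integral_distribution; last 2 first.
- apply/measurable_EFinP; apply: measurable_funM; apply: measurableT_comp => //.
    exact: measurable_rV_coord.
  apply: measurable_fun_rV => i; under eq_fun do rewrite mxE.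
  exact: measurable_rV_coord.
- by move=> y; rewrite lee_fin mulr_ge0.
transitivity (\int[(N01 \x std_gaussian d)%E]_p (f p.1 * g p.2)%:E)%E.
  apply: eq_integral => p _ /=; rewrite rV_cons0; congr (_ * g _)%:E.
  by apply/rowP => i; rewrite mxE rV_consS.
rewrite fubini_tonelli1; last 2 first.
- apply/measurable_EFinP; apply: measurable_funM; apply: measurableT_comp => //.
- by move=> y; rewrite lee_fin mulr_ge0.
rewrite /fubini_F /=.
under eq_integral => x _.
  under eq_integral do rewrite EFinM.
  rewrite ge0_integralZl//; last 3 first.
  - exact/measurable_EFinP.
  - by move=> y _; rewrite lee_fin.
  - by rewrite lee_fin.
  over.
rewrite ge0_integralZr//.
- exact/measurable_EFinP.
- by move=> x _; rewrite lee_fin.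
- by apply: integral_ge0 => y _; rewrite lee_fin.
Qed.

End gaussian_mgf.

(** * Algebra and measurability of the inner product *)

Section dotp_theory.
Context {R : realType}.

Lemma dotpC d (u v : 'rV[R]_d) : dotp u v = dotp v u.
Proof. by apply: eq_bigr => i _; rewrite mulrC. Qed.

Lemma dotpDl d (u v w : 'rV[R]_d) : dotp (u + v) w = dotp u w + dotp v w.
Proof. by rewrite -big_split; apply: eq_bigr => i _; rewrite mxE mulrDl. Qed.

Lemma dotpDr d (u v w : 'rV[R]_d) : dotp w (u + v) = dotp w u + dotp w v.
Proof. by rewrite !(dotpC w) dotpDl. Qed.

Lemma dotpZl d k (u v : 'rV[R]_d) : dotp (k *: u) v = k * dotp u v.
Proof. by rewrite mulr_sumr; apply: eq_bigr => i _; rewrite mxE mulrA. Qed.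

Lemma dotpZr d k (u v : 'rV[R]_d) : dotp v (k *: u) = k * dotp v u.
Proof. by rewrite !(dotpC v) dotpZl. Qed.

Lemma dotp_ge0 d (u : 'rV[R]_d) : 0 <= dotp u u.
Proof. by apply: sumr_ge0 => i _; rewrite -expr2 sqr_ge0. Qed.

Lemma dotpD_le d (u v : 'rV[R]_d) :
  dotp (u + v) (u + v) <= 2 * dotp u u + 2 * dotp v v.
Proof.
have := dotp_ge0 (u + -1 *: v).
rewrite !(dotpDl, dotpDr, dotpZl, dotpZr) (dotpC v u); lra.
Qed.

Lemma dotp_recl d (u v : 'rV[R]_d.+1) :
  dotp u v = u ord0 ord0 * v ord0 ord0 +
    dotp (\row_i u ord0 (lift ord0 i)) (\row_i v ord0 (lift ord0 i)).
Proof.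
by rewrite /dotp big_ord_recl; congr (_ + _); apply: eq_bigr => i _; rewrite !mxE.
Qed.

Lemma dotp_delta d (i : 'I_d) (k : R) (x : 'rV[R]_d) :
  dotp (k *: delta_mx ord0 i) x = k * x ord0 i.
Proof.
rewrite dotpZl /dotp (bigD1 i)//= mxE !eqxx mul1r big1 ?addr0// => j ji.
by rewrite mxE eqxx (negbTE ji) mul0r.
Qed.

Lemma measurable_dotp d disp (T : measurableType disp) (f g : T -> 'rV[R]_d) :
  measurable_fun setT f -> measurable_fun setT g ->
  measurable_fun setT (fun w => dotp (f w) (g w)).
Proof.
move=> mf mg; apply: measurable_sum => i; apply: measurable_funM.
- exact: (measurableT_comp (measurable_rV_coord i) mf).
- exact: (measurableT_comp (measurable_rV_coord i) mg).
Qed.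

Lemma measurable_rVZ d disp (T : measurableType disp) (k : R) (f : T -> 'rV[R]_d) :
  measurable_fun setT f -> measurable_fun setT (fun w => k *: f w).
Proof.
move=> mf; apply: measurable_fun_rV => i; under eq_fun do rewrite mxE.
by apply: measurable_funM => //; exact: (measurableT_comp (measurable_rV_coord i) mf).
Qed.

Lemma measurable_rVD d disp (T : measurableType disp) (f g : T -> 'rV[R]_d) :
  measurable_fun setT f -> measurable_fun setT g ->
  measurable_fun setT (fun w => f w + g w).
Proof.
move=> mf mg; apply: measurable_fun_rV => i; under eq_fun do rewrite mxE.
by apply: measurable_funD; [exact: (measurableT_comp (measurable_rV_coord i) mf)
  |exact: (measurableT_comp (measurable_rV_coord i) mg)].
Qed.

Lemma le_AMGM_expR (x y : R) : expR (x + y) <= 2^-1 * expR (2 * x) + 2^-1 * expR (2 * y).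
Proof.
rewrite expRD !expRM_natl.
have := sqr_ge0 (expR x - expR y); rewrite !expr2; nra.
Qed.

End dotp_theory.

(** * Exponential moments in dimension $d$ and light-tailed laws *)

Section exponential_moments.
Context {R : realType}.

Lemma measurable_expR_quad d (a : 'rV[R]_d) (k : R) :
  measurable_fun setT (fun x : 'rV[R]_d => expR (dotp a x + k * dotp x x)).
Proof.
apply: measurableT_comp => //; apply: measurable_funD.
- exact: measurable_dotp.
- by apply: measurable_funM => //; exact: measurable_dotp.
Qed.

Lemma measurable_expR_dotp d (a : 'rV[R]_d) :
  measurable_fun setT (fun x : 'rV[R]_d => expR (dotp a x)).
Proof. by apply: measurableT_comp => //; exact: measurable_dotp. Qed.

Lemma measurable_expR_sqr d (k : R) :
  measurable_fun setT (fun x : 'rV[R]_d => expR (k * dotp x x)).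
Proof.
apply: measurableT_comp => //.
by apply: measurable_funM => //; exact: measurable_dotp.
Qed.

Lemma std_gaussian_mgf d (a : 'rV[R]_d) :
  (\int[std_gaussian d]_z (expR (dotp a z))%:E = (expR (dotp a a / 2))%:E)%E.
Proof.
elim: d a => [|d IH] a.
  rewrite /= integral_dirac//; last by apply/measurable_EFinP; exact: measurable_expR_dotp.
  by rewrite diracT mul1e /dotp !big_ord0 mul0r.
under eq_integral do rewrite dotp_recl expRD.
rewrite (@ge0_integral_std_gaussianS _ d (fun x => expR (a ord0 ord0 * x))
  (fun y => expR (dotp (\row_i a ord0 (lift ord0 i)) y)))//.
- rewrite IH normal01_mgf -EFinM -expRD [in RHS]dotp_recl.
  by rewrite -mulrDl expr2.
- by apply: measurableT_comp => //; exact: mulrl_measurable.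
- exact: measurable_expR_dotp.
Qed.

Lemma std_gaussian_mgf_sqr d (a : R) : 0 <= a <= 1 / 4 ->
  (\int[std_gaussian d]_z (expR (a * dotp z z))%:E <= (expR (2 * a * d%:R))%:E)%E.
Proof.
move=> a4; elim: d => [|d IH].
  rewrite /= integral_dirac//; last by apply/measurable_EFinP; exact: measurable_expR_sqr.
  by rewrite diracT mul1e /dotp !big_ord0 !mulr0.
under eq_integral do rewrite dotp_recl mulrDr expRD.
rewrite (@ge0_integral_std_gaussianS _ d (fun x => expR (a * (x * x)))
  (fun y => expR (a * dotp y y)))//.
- rewrite -[in leRHS](@natr1 _ d) mulrDr mulr1 addrC expRD EFinM; apply: lee_pmul => //.
  + by apply: integral_ge0 => x _; rewrite lee_fin expR_ge0.
  + by apply: integral_ge0 => x _; rewrite lee_fin expR_ge0.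
  + under eq_integral do rewrite -expr2.
    exact: normal01_mgf_sqr.
- by apply: measurableT_comp => //; apply: measurable_funM => //; exact: measurable_funM.
- exact: measurable_expR_sqr.
Qed.

(* [C] is the sub-Gaussian constant and [M] bounds the second moment per
   coordinate. *)
Definition light_tailed d (mu : probability 'rV[R]_d R) (C M : R) :=
  (forall a, (\int[mu]_x (expR (dotp a x))%:E <= (expR (C * dotp a a / 2))%:E)%E) /\
  (forall k, 0 <= k <= (4 * C)^-1 ->
     (\int[mu]_x (expR (k * dotp x x))%:E <= (expR (2 * k * M * d%:R))%:E)%E).

Lemma std_gaussian_light_tailed d (C M : R) : 1 <= C -> 1 <= M ->
  light_tailed (std_gaussian d) C M.
Proof.
move=> C1 M1; split.
  move=> a; rewrite std_gaussian_mgf lee_fin ler_expR ler_pM2r//.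
  by rewrite ler_peMl// dotp_ge0.
move=> k /andP[k0 kC].
apply: le_trans.
  apply: std_gaussian_mgf_sqr; rewrite k0 (le_trans kC)// div1r lef_pV2 ?posrE; lra.
rewrite lee_fin ler_expR; have : 0 <= d%:R :> R by [].
by move=> d0; rewrite ler_wpM2r// ler_peMr// mulr_ge0.
Qed.

(** The linear and the quadratic exponent depend on the same variable, so they are separated by the
    arithmetic-geometric mean inequality. This doubles each of them, hence the range of [k] is half
    of that in [light_tailed]. *)
Lemma light_tailed_quad d (mu : probability 'rV[R]_d R) (C M : R)
    (b : 'rV[R]_d) (k : R) : 0 < C ->
  light_tailed mu C M -> 0 <= k <= (8 * C)^-1 ->
  (\int[mu]_x (expR (dotp b x + k * dotp x x))%:E <=
   (2^-1 * expR (2 * C * dotp b b) + 2^-1 * expR (4 * k * M * d%:R))%:E)%E.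
Proof.
move=> C0 [lin sqr] /andP[k0 kC].
apply: (@le_trans _ _ (\int[mu]_x ((2^-1)%:E * (expR (dotp (2 *: b) x))%:E +
    (2^-1)%:E * (expR (2 * k * dotp x x))%:E))%E).
  apply: ge0_le_integral => //.
  - by apply/measurable_EFinP; exact: measurable_expR_quad.
  - apply/measurable_EFinP; apply: measurable_funD; apply: measurable_funM => //.
      exact: measurable_expR_dotp.
    exact: measurable_expR_sqr.
  - move=> x _; rewrite dotpZl -mulrA -!EFinM -EFinD lee_fin.
    exact: le_AMGM_expR.
have mE a : measurable_fun setT (fun x : 'rV[R]_d => (expR (dotp a x))%:E).
  by apply/measurable_EFinP; exact: measurable_expR_dotp.
have mS a : measurable_fun setT (fun x : 'rV[R]_d => (expR (a * dotp x x))%:E).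
  by apply/measurable_EFinP; exact: measurable_expR_sqr.
have half0 : 0 <= 2^-1 :> R by rewrite invr_ge0.
rewrite ge0_integralD//; last 2 first.
- exact: measurable_funeM.
- exact: measurable_funeM.
rewrite !ge0_integralZl//; try by move=> x _; rewrite lee_fin expR_ge0.
rewrite EFinD EFinM [in leRHS]EFinM; apply: leeD; apply: lee_wpmul2l; rewrite ?lee_fin//.
- apply: (le_trans (lin _)); rewrite lee_fin ler_expR dotpZl dotpZr; lra.
- apply: le_trans (sqr (2 * k) _) _; last by rewrite lee_fin ler_expR; nra.
  rewrite mulr_ge0//=; apply: le_trans (_ : 2 * (8 * C)^-1 <= _).
    by rewrite ler_pM2l.
  by rewrite !invfM; lra.
Qed.

End exponential_moments.

(** * Herbst's argument *)

Section gradient_comp.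
Context {R : realType} {d : nat}.
Local Notation V := 'rV[R]_d.

Lemma continuous_rV (f : V -> V) :
  (forall i, continuous (fun x => f x ord0 i)) -> continuous f.
Proof.
move=> cf x A [B /= nB sBA].
have H : nbhs x [set y | forall i : 'I_d, B ord0 i (f y ord0 i)].
  apply: (@filter_forall _ _ _ (nbhs x) (nbhs_filter x)) => i.
  exact: cf (nB ord0 i).
by apply: filterS H => y By; apply: sBA => i j; rewrite ord1.
Qed.

Lemma gradient_diff (P : V -> R) (x : V) i : differentiable P x ->
  gradient P x ord0 i = 'd P x (delta_mx ord0 i).
Proof. by move=> dP; rewrite mxE deriveE. Qed.

Lemma gradient_comp (psi dpsi : R -> R) (P : V -> R) (x : V) :
  (forall s : R, is_derive s 1 psi (dpsi s)) -> differentiable P x ->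
  gradient (psi \o P) x = dpsi (P x) *: gradient P x.
Proof.
move=> dpsiE dP.
have dps : differentiable psi (P x) by apply/derivable1_diffP.
apply/rowP => i; rewrite [RHS]mxE gradient_diff//; last exact: differentiable_comp.
rewrite diff_comp//= deriv1E// gradient_diff//= derive1E (@derive_val _ _ _ _ _ _ _ (dpsiE _)).
by rewrite mulrC.
Qed.

Lemma C1_comp (psi dpsi : R -> R) (P : V -> R) :
  (forall s : R, is_derive s 1 psi (dpsi s)) -> continuous dpsi -> C1 P -> C1 (psi \o P).
Proof.
move=> dpsiE cdpsi [dP cP]; split.
  by move=> x; apply: differentiable_comp => //; exact/derivable1_diffP.
apply: continuous_rV => i x.
rewrite (_ : (fun _ => _) = fun y => dpsi (P y) * gradient P y ord0 i); last first.
  by apply/funext => y; rewrite (@gradient_comp _ dpsi)// !mxE.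
apply: cvgM; last first.
  exact: (@continuous_comp _ _ _ (gradient P) (fun y : V => y ord0 i) x (cP x) (@coord_continuous _ _ _ _ _ _)).
  apply: continuous_comp; last exact: cdpsi.
  exact: differentiable_continuous.
exact: (nbhs_filter x).
Qed.

Let coordD i (x : V) : differentiable (fun y : V => y ord0 i) x.
Proof. exact: differentiable_coord. Qed.

Let derive_coord i (x v : V) : is_derive x v (fun y : V => y ord0 i) (v ord0 i).
Proof.
apply: DeriveDef; first exact/diff_derivable/coordD.
rewrite /derive; apply: cvg_lim => //=.
apply: (@cvg_trans _ (cst (v ord0 i) @ (0 : R)^')); last exact: cvg_cst.
apply: near_eq_cvg; near=> h.
rewrite /= !mxE addrK; apply/esym/mulKf.
by near: h; exact: nbhs_dnbhs_neq.
Unshelve. all: by end_near. Qed.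

Lemma dotpE (a : V) : dotp a = \sum_i (fun x : V => a ord0 i * x ord0 i).
Proof. by apply/funext => x; rewrite fct_sumE. Qed.

Lemma gradient_dotp (a x : V) : gradient (dotp a) x = a.
Proof.
apply/rowP => j; rewrite mxE dotpE.
have H i : is_derive x (delta_mx ord0 j) (fun y : V => a ord0 i * y ord0 i)
    (a ord0 i *: (delta_mx ord0 j : V) ord0 i).
  exact: (@is_deriveZ _ _ _ (fun y : V => y ord0 i) (a ord0 i) x).
rewrite (@derive_val _ _ _ _ _ _ _ (is_derive_sum H)).
rewrite (bigD1 j)//= big1 ?addr0; last first.
  by move=> i ij; rewrite mxE eqxx (negbTE ij) scaler0.
by rewrite mxE !eqxx; apply: mulr1.
Qed.

Lemma C1_dotp (a : V) : C1 (dotp a).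
Proof.
split; last first.
  by rewrite (_ : gradient _ = cst a); [exact: cst_continuous|apply/funext => x; exact: gradient_dotp].
move=> x; rewrite dotpE; apply: differentiable_sum => i.
exact: (@differentiableZ _ _ _ (fun y : V => y ord0 i)).
Qed.

Definition sqnorm (x : V) : R := dotp x x.

Lemma sqnormE : sqnorm = \sum_i (fun x : V => x ord0 i * x ord0 i).
Proof. by apply/funext => x; rewrite fct_sumE. Qed.

Lemma gradient_sqnorm (x : V) : gradient sqnorm x = 2 *: x.
Proof.
apply/rowP => j; rewrite mxE sqnormE.
have H i : is_derive x (delta_mx ord0 j) (fun y : V => y ord0 i * y ord0 i)
    (x ord0 i *: (delta_mx ord0 j : V) ord0 i + x ord0 i *: (delta_mx ord0 j : V) ord0 i).
  exact: (@is_deriveM _ _ (fun y : V => y ord0 i) (fun y : V => y ord0 i) x).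
rewrite (@derive_val _ _ _ _ _ _ _ (is_derive_sum H)).
rewrite (bigD1 j)//= big1 ?addr0; last first.
  by move=> i ij; rewrite mxE eqxx (negbTE ij) scaler0 addr0.
rewrite !mxE !eqxx -[_ *: _]/(x ord0 j * 1) mulr1.
by rewrite [RHS]mulr_natl mulr2n.
Qed.

Lemma C1_sqnorm : C1 sqnorm.
Proof.
split; last first.
  rewrite (_ : gradient _ = *:%R 2); last by apply/funext => x; exact: gradient_sqnorm.
  exact: scaler_continuous.
move=> x; rewrite sqnormE; apply: differentiable_sum => i.
exact: (@differentiableM _ _ (fun y : V => y ord0 i) (fun y : V => y ord0 i)).
Qed.

End gradient_comp.

(** * Membership and norm in $L^2$ through plain integrals *)

Section L2_facts.
Context disp (T : measurableType disp) (R : realType).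
Variable mu : {measure set T -> \bar R}.

Lemma Lnorm2E (f : T -> R) :
  ('N[mu]_2%:E [EFin \o f] = (\int[mu]_x ((f x) ^+ 2)%:E) `^ 2^-1)%E.
Proof.
rewrite unlock; congr (_ `^ _)%E; apply: eq_integral => x _.
by rewrite /= powR_mulrn// -normrX ger0_norm// sqr_ge0.
Qed.

Lemma Lfun2P (f : T -> R) : f \in Lfun mu 2%:E <->
  measurable_fun setT f /\ (\int[mu]_x ((f x) ^+ 2)%:E < +oo)%E.
Proof.
have i0 : (0 <= \int[mu]_x ((f x) ^+ 2)%:E)%E.
  by apply: integral_ge0 => x _; rewrite lee_fin sqr_ge0.
split.
- move=> /andP[/set_mem mf /set_mem h].
  have {}h : ('N[mu]_2%:E [EFin \o f] < +oo)%E := h.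
  move: h; rewrite Lnorm2E => h.
  split=> //; move: i0 h; case: (\int[mu]_x _)%E => [x _ _| _|//]; first by rewrite ltry.
  by rewrite /= ifF// invr_eq0 pnatr_eq0.
- move=> [mf h]; apply/andP; split; apply/mem_set => //.
  suff : ('N[mu]_2%:E [EFin \o f] < +oo)%E by [].
  by rewrite Lnorm2E poweR_lty.
Qed.

Lemma Lnorm2_le (f : T -> R) (c : R) : 0 <= c ->
  ('N[mu]_2%:E [EFin \o f] <= c%:E)%E = (\int[mu]_x ((f x) ^+ 2)%:E <= (c ^+ 2)%:E)%E.
Proof.
move=> c0; rewrite Lnorm2E.
have : (0 <= \int[mu]_x ((f x) ^+ 2)%:E)%E.
  by apply: integral_ge0 => x _; rewrite lee_fin sqr_ge0.
case: (\int[mu]_x _)%E => // [r|_]; last first.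
  by rewrite /= ifF ?invr_eq0 ?pnatr_eq0// !leNgt !ltry.
rewrite !lee_fin => r0; rewrite powR12_sqrt// -[in RHS](sqr_sqrtr r0).
by rewrite ler_pXn2r// ?nnegrE// sqrtr_ge0.
Qed.

Lemma EFin_Rintegral (f : T -> R) : mu.-integrable setT (EFin \o f) ->
  (\int[mu]_x (f x)%:E = (\int[mu]_x f x)%:E)%E.
Proof. by move=> intf; rewrite /Rintegral fineK//; exact: integrable_fin_num. Qed.

Lemma integrable_EFinZ (c : R) (f : T -> R) : mu.-integrable setT (EFin \o f) ->
  mu.-integrable setT (EFin \o (fun x => c * f x)).
Proof.
by move=> /(integrableZl measurableT c); apply: eq_integrable => // x _; rewrite -EFinM.
Qed.

Lemma integrable_EFinD (f g : T -> R) : mu.-integrable setT (EFin \o f) ->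
  mu.-integrable setT (EFin \o g) ->
  mu.-integrable setT (EFin \o (fun x => f x + g x)).
Proof.
by move=> intf intg; have := integrableD measurableT intf intg; apply: eq_integrable.
Qed.

End L2_facts.

Section bounded_probability.
Context disp (T : measurableType disp) (R : realType) (mu : probability T R).

Lemma bounded_integrable (f : T -> R) (B : R) : measurable_fun setT f ->
  (forall x, `|f x| <= B) -> mu.-integrable setT (EFin \o f).
Proof.
move=> mf fB; apply: measurable_bounded_integrable => //.
  by rewrite ltey_eq fin_num_measure.
exists B; split; first exact: num_real.
by move=> M BM x _; exact: le_trans (fB x) (ltW BM).
Qed.

Lemma bounded_Lfun2 (f : T -> R) (B : R) : measurable_fun setT f ->
  (forall x, `|f x| <= B) -> f \in Lfun mu 2%:E.
Proof.
move=> mf fB; apply/Lfun2P; split => //.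
have : mu.-integrable setT (EFin \o (fun x => f x ^+ 2)).
  apply: (@bounded_integrable _ (B ^+ 2)); first exact: measurable_funX.
  by move=> x; rewrite normrX lerXn2r ?nnegrE// (le_trans _ (fB x)).
move/integrableP => [_]; apply: le_lt_trans.
by under [leRHS]eq_integral do rewrite /= ger0_norm ?sqr_ge0//.
Qed.

End bounded_probability.

(** * The mean value inequality and the differential inequality of Herbst *)

Section mean_value.
Context {R : realType}.
Implicit Types (f df : R -> R).

Lemma MVT_le f df (a b B : R) : a <= b ->
  (forall x : R, x \in `[a, b] -> is_derive x 1 f (df x)) ->
  (forall x, x \in `]a, b[ -> df x <= B) -> f b - f a <= B * (b - a).
Proof.
rewrite le_eqVlt => /predU1P[->|ab] dfE dfB; first by rewrite !subrr mulr0.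
have dfo x : x \in `]a, b[ -> is_derive x 1 f (df x).
  by move=> xab; apply: dfE; apply: subset_itv_oo_cc xab.
have cf : {within `[a, b], continuous f}.
  by apply: derivable_within_continuous => x /dfE ?; exact: ex_derive.
have [c cab E] := MVT ab dfo cf.
by rewrite E ler_pM2r ?subr_gt0// dfB.
Qed.

(* Divided by [s^2], the last hypothesis says that [(s^-1 - B) L(s) - A s] is
   nonincreasing; its limit at [0] is [L'(0)]. *)
Lemma herbst_ode (L dL : R -> R) (A B : R) :
  L 0 = 0 -> (forall s : R, 0 <= s -> is_derive s 1 L (dL s)) ->
  (forall s : R, 0 < s -> s * dL s - L s <= s ^+ 2 * (A + B * dL s)) ->
  forall s : R, 0 < s -> (1 - B * s) * L s <= s * dL 0 + A * s ^+ 2.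
Proof.
move=> L0 dLE ent s s0.
pose w u := (u^-1 - B) * L u - A * u.
suff ws : w s <= dL 0.
  have -> : (1 - B * s) * L s = s * w s + A * s ^+ 2.
    by rewrite /w; field; rewrite gt_eqF.
  by rewrite lerD2r ler_pM2l.
have dw (u : R) : 0 < u -> is_derive u 1 w ((u^-1 - B) * dL u - u ^- 2 * L u - A).
  move=> u0; have dLu := dLE u (ltW u0).
  have dinv : is_derive u 1 (fun v : R => v^-1 - B) (- u ^- 2).
    have -> : - u ^- 2 = - u ^- 2 *: 1 - 0 :> R by rewrite subr0 scaler1.
    by apply: is_deriveB; apply: is_deriveV => //; rewrite gt_eqF.
  have dM : is_derive u 1 (fun v : R => (v^-1 - B) * L v)
      ((u^-1 - B) * dL u + L u * - u ^- 2).
    exact: (@is_deriveM _ _ (fun v : R => v^-1 - B) L).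
  have dA : is_derive u 1 (fun v : R => A * v) A.
    rewrite -[X in is_derive _ _ _ X](mulr1 A).
    exact: (@is_deriveZ _ _ _ (fun v : R => v) A).
  rewrite (mulrC (u ^- 2)) -mulrN.
  exact: (@is_deriveB _ _ _ (fun v : R => (v^-1 - B) * L v) (fun v : R => A * v)).
have mono (u : R) : 0 < u -> u <= s -> w s <= w u.
  move=> u0 us; rewrite -subr_le0 -(mul0r (s - u)).
  apply: (@MVT_le w _ u s 0 us).
    by move=> x; rewrite in_itv/= => /andP[ux _]; apply: dw; exact: lt_le_trans ux.
  move=> x; rewrite in_itv/= => /andP[ux _].
  have x0 : 0 < x by exact: lt_trans ux.
  have -> : (x^-1 - B) * dL x - x ^- 2 * L x - A =
      (x * dL x - L x - x ^+ 2 * (A + B * dL x)) / x ^+ 2.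
    by field; rewrite gt_eqF.
  by rewrite pmulr_lle0 ?invr_gt0 ?exprn_gt0// subr_le0 ent.
(* As $L(0)=0$, $L(u)/u$ is the difference quotient of [L] at 0; the terms $BL(u)$ and $Au$ vanish
   in the limit. *)
have cw : w u @[u --> 0^'+] --> dL 0.
  have dL0 := dLE 0 (lexx _).
  have cL : L u @[u --> 0^'+] --> 0.
    rewrite -[X in _ --> X]L0; apply: cvg_at_right_filter.
    by apply: differentiable_continuous; exact/derivable1_diffP.
  have cLu : u^-1 * L u @[u --> 0^'+] --> dL 0.
    have /derivableP := @ex_derive _ _ _ _ _ _ _ dL0; rewrite (@derive_val _ _ _ _ _ _ _ dL0) => -[+ dLv].
    move=> /cvg_ex[/= l Hl]; have ldL : l = dL 0.
      by rewrite -dLv; apply/esym/cvg_lim.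
    move: Hl; rewrite ldL => /cvg_dnbhs_at_right.
    suff -> : (fun u : R => u^-1 * L u) =
        (fun x : R => x^-1 *: (L (x *: (1 : R^o) + 0) - L 0)) by [].
    apply/funext => x; rewrite addr0 L0 subr0.
    by rewrite -[x *: 1]/(x * 1) mulr1.
  rewrite /w.
  have -> : dL 0 = dL 0 - B * 0 - A * 0 by rewrite !mulr0 !subr0.
  under eq_fun do rewrite mulrBl.
  apply: cvgB; first apply: cvgB => //.
    by apply: cvgMr.
  by apply: cvgMr; apply: cvg_at_right_filter; exact: cvg_id.
apply: cvgr_to_ge cw _.
near=> u; apply: mono; first by near: u; exact: nbhs_right_gt.
by near: u; exact: nbhs_right_le.
Unshelve. all: by end_near. Qed.

End mean_value.

(** * The moment generating function of a bounded function *)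

Section exponential_integral.
Context disp (T : measurableType disp) (R : realType) (mu : probability T R).
Variables (F : T -> R) (M : R).
Hypotheses (M0 : 0 <= M) (mF : measurable_fun setT F) (FM : forall x, `|F x| <= M).

Lemma measurable_expRM (s : R) : measurable_fun setT (fun x => expR (s * F x)).
Proof. by apply: measurableT_comp => //; exact: measurable_funM. Qed.

Let expRM_le s x : expR (s * F x) <= expR (`|s| * M).
Proof.
rewrite ler_expR; apply: le_trans (ler_norm _) _; rewrite normrM.
by rewrite ler_wpM2l.
Qed.

Lemma integrable_expRM s : mu.-integrable setT (EFin \o (fun x => expR (s * F x))).
Proof.
apply: (@bounded_integrable _ _ _ _ _ (expR (`|s| * M))); first exact: measurable_expRM.
by move=> x; rewrite ger0_norm ?expR_ge0.
Qed.

Lemma integrable_FexpRM s :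
  mu.-integrable setT (EFin \o (fun x => F x * expR (s * F x))).
Proof.
apply: (@bounded_integrable _ _ _ _ _ (M * expR (`|s| * M))).
  by apply: measurable_funM => //; exact: measurable_expRM.
by move=> x; rewrite normrM ler_pM// ger0_norm ?expR_ge0.
Qed.

Lemma Rintegral_expRM_gt0 s : 0 < \int[mu]_x expR (s * F x).
Proof.
apply: (@lt_le_trans _ _ (expR (- (`|s| * M)))); first exact: expR_gt0.
have <- : \int[mu]_x (cst (expR (- (`|s| * M)))) x = expR (- (`|s| * M)).
  rewrite Rintegral_cst// (_ : fine _ = 1) ?mulr1//.
  by rewrite -[RHS]/(fine 1%E); congr fine; exact: probability_setT.
apply: le_Rintegral => //.
- exact: (@bounded_integrable _ _ _ _ _ `|expR (- (`|s| * M))|).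
- exact: integrable_expRM.
- move=> x _; rewrite /= ler_expR lerNl; apply: le_trans (ler_norm _) _.
  by rewrite normrN normrM ler_wpM2l.
Qed.

Lemma is_derive_Rintegral_expRM (s : R) : is_derive s 1
  (fun u : R => \int[mu]_x expR (u * F x)) (\int[mu]_x (F x * expR (s * F x))).
Proof.
pose f := fun (u : R) x => expR (u * F x).
have df (u : R) y : is_derive u 1 (f ^~ y) (F y * expR (u * F y)).
  have d1 : is_derive u 1 (fun v : R => v * F y) (F y).
    rewrite -[X in is_derive _ _ _ X](mulr1 (F y)).
    under eq_fun do rewrite mulrC.
    exact: (@is_deriveZ _ _ _ (fun v : R => v) (F y)).
  rewrite mulrC; exact: (@is_derive1_comp _ expR (fun v : R => v * F y)).
have d1f (u : R) y : partial1of2 f u y = F y * expR (u * F y).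
  by rewrite partial1of2E (@derive_val _ _ _ _ _ _ _ (df u y)).
have sI : `](s - 1), (s + 1)[%classic s by rewrite /= in_itv/=; apply/andP; split; lra.
have intf (x : R) : `](s - 1), (s + 1)[%classic x -> mu.-integrable setT (EFin \o f x).
  by move=> _; exact: integrable_expRM.
have derf (x : R) y : `](s - 1), (s + 1)[%classic x -> setT y -> derivable (f ^~ y) x 1.
  by move=> _ _; have := df x y; move=> ?; exact: ex_derive.
(* On the interval of radius 1 around [s] the exponent stays below $(|s|+1)M$, so this constant
   dominates the derivative. *)
pose G := fun _ : T => M * expR ((`|s| + 1) * M).
have G0 y : 0 <= G y by rewrite mulr_ge0 ?expR_ge0.
have intG : mu.-integrable setT (EFin \o G).
  by apply: (@bounded_integrable _ _ _ _ _ `|M * expR ((`|s| + 1) * M)|); [exact: measurable_cst|].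
have Gub (x : R) y : `](s - 1), (s + 1)[%classic x -> setT y -> `|partial1of2 f x y| <= G y.
  move=> /=; rewrite in_itv/= => /andP[x1 x2] _; rewrite d1f normrM ler_pM// ger0_norm ?expR_ge0//.
  apply: le_trans (expRM_le _ _) _; rewrite ler_expR ler_wpM2r//.
  by have := ler_norm s; have := ler_norm (- s); rewrite normrN ler_norml; lra.
apply: DeriveDef.
  exact: (@derivable_under_integral _ _ _ mu f setT measurableT s (s - 1) (s + 1) sI intf derf G G0 intG Gub).
rewrite -derive1E.
rewrite (@differentiation_under_integral _ _ _ mu f setT measurableT s (s - 1) (s + 1) sI intf derf G G0 intG Gub).
by apply: eq_Rintegral => y _; rewrite d1f.
Qed.

End exponential_integral.

(** * Herbst's argument for bounded functions of $P$ *)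

Section herbst.
Context {R : realType} {d : nat}.
Local Notation V := 'rV[R]_d.
Variables (mu : probability V R) (C : R).
Hypotheses (C0 : 0 <= C) (lsi : log_sobolev mu C).
Variables (P : V -> R) (G : V -> V).
Hypotheses (mP : measurable_fun setT P) (mG : measurable_fun setT G).
Hypotheses (C1P : C1 P) (GE : forall x, gradient P x = G x).

(* The constant sequence [psi \o P] witnesses membership in [W12]. *)
Lemma lsi_comp (psi dpsi : R -> R) (B1 B2 : R) :
  (forall s : R, is_derive s 1 psi (dpsi s)) -> continuous dpsi ->
  (forall x, `|psi (P x)| <= B1) ->
  (forall x, dpsi (P x) ^+ 2 * dotp (G x) (G x) <= B2) ->
  let m := \int[mu]_x (psi (P x) ^+ 2) in
  (\int[mu]_x (psi (P x) ^+ 2 * ln (psi (P x) ^+ 2))%:E - (m * ln m)%:E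
   <= (2 * C)%:E * \int[mu]_x (dpsi (P x) ^+ 2 * dotp (G x) (G x))%:E)%E.
Proof.
move=> dpsiE cdpsi psiB1 psiB2.
have mpsi : measurable_fun setT psi.
  apply: continuous_measurable_fun => x.
  by apply: differentiable_continuous; exact/derivable1_diffP.
have mdpsi : measurable_fun setT dpsi by exact: continuous_measurable_fun.
have gE x : gradient (psi \o P) x = dpsi (P x) *: G x.
  by rewrite (@gradient_comp _ _ psi dpsi)// ?GE//; exact: C1P.1.
have fL2 : psi \o P \in Lfun mu 2%:E.
  by apply: (@bounded_Lfun2 _ _ _ _ _ B1) => //; exact: measurableT_comp.
have gL2 : L2_field mu (fun x => dpsi (P x) *: G x).
  move=> i; apply: (@bounded_Lfun2 _ _ _ _ _ (Num.sqrt B2)).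
    under eq_fun do rewrite mxE.
    apply: measurable_funM; first exact: measurableT_comp.
    exact: (measurableT_comp (measurable_rV_coord i)).
  move=> x; rewrite -sqrtr_sqr; apply: ler_wsqrtr; rewrite mxE exprMn.
  apply: le_trans (psiB2 x); rewrite ler_wpM2l ?sqr_ge0//.
  rewrite /dotp (bigD1 i)//= -expr2 lerDl.
  by apply: sumr_ge0 => j _; rewrite -expr2 sqr_ge0.
have W : W12 mu (psi \o P) (fun x => dpsi (P x) *: G x).
  split; [exact: fL2|exact: gL2|exists (fun=> psi \o P); split].
  - move=> k; split; [exact: (@C1_comp R d psi dpsi P dpsiE cdpsi C1P)|exact: fL2|].
    move=> i; under eq_fun do rewrite gE.
    exact: gL2.
  - apply: cvg_near_cst; apply: nearW => k /=; rewrite integral0_eq// => x _.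
    by rewrite subrr expr0n.
  - apply: cvg_near_cst; apply: nearW => k /=; rewrite integral0_eq// => x _.
    by rewrite gE subrr /dotp big1// => i _; rewrite mxE mul0r.
have := lsi W => /=.
under [X in (_ <= _ * X)%E]eq_integral do
  rewrite dotpZl dotpZr mulrA -expr2.
by [].
Qed.

(** The log-Sobolev inequality is applied to $e^{u\theta(P)/2}$. With $H$ the moment generating
    function of $\theta(P)$ and $K=H'$, the entropy is $uK-H\ln H$ and the energy is at most
    $(u^2/4)(AH+BK)$. Division by $H$ gives for $\ln H$ the inequality of [herbst_ode] with
    constants $CA/2$ and $CB/2$; there $\ln H(0)=0$ and $(\ln H)'(0)$ is the mean. *)
Lemma herbst_bounded (theta dtheta : R -> R) (M A B : R) :
  (forall s : R, is_derive s 1 theta (dtheta s)) -> continuous dtheta ->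
  0 <= M -> (forall s, `|theta s| <= M) ->
  (forall x, dtheta (P x) ^+ 2 * dotp (G x) (G x) <= A + B * theta (P x)) ->
  forall s, 0 < s ->
  (1 - C / 2 * B * s) * ln (\int[mu]_x expR (s * theta (P x))) <=
  s * \int[mu]_x theta (P x) + C / 2 * A * s ^+ 2.
Proof.
move=> dthE cdth M0 thM AB s s0.
pose F x := theta (P x).
have mth : measurable_fun setT theta.
  apply: continuous_measurable_fun => x.
  by apply: differentiable_continuous; exact/derivable1_diffP.
have mF : measurable_fun setT F by exact: measurableT_comp.
have FM x : `|F x| <= M by exact: thM.
pose H u := \int[mu]_x expR (u * F x).
pose K u := \int[mu]_x (F x * expR (u * F x)).
have H0 u : 0 < H u by exact: (Rintegral_expRM_gt0 mu mF FM).
have H_0 : H 0 = 1.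
  rewrite /H; under eq_Rintegral do rewrite mul0r expR0.
  rewrite Rintegral_cst// mul1r.
  by rewrite -[RHS]/(fine 1%E); congr fine; exact: probability_setT.
have K_0 : K 0 = \int[mu]_x theta (P x).
  by apply: eq_Rintegral => x _; rewrite mul0r expR0 mulr1.
have ent u : 0 < u -> u * K u - H u * ln (H u) <= C / 2 * u ^+ 2 * (A * H u + B * K u).
  move=> u0.
  pose psi v := expR (u / 2 * theta v).
  pose dpsi v := psi v * (u / 2 * dtheta v).
  have psi2 v : psi v ^+ 2 = expR (u * theta v).
    by rewrite /psi -expRM_natl; congr expR; field.
  have dpsiE (v : R) : is_derive v 1 psi (dpsi v).
    apply: (@is_derive1_comp _ expR (fun w : R => u / 2 * theta w)).
  have cpsi : continuous psi.
    by move=> x; apply: differentiable_continuous; exact/derivable1_diffP.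
  have cdpsi : continuous dpsi.
    move=> x; apply: cvgM; first exact: cpsi.
    by apply: cvgMr; exact: cdth.
  have bnd x : dpsi (P x) ^+ 2 * dotp (G x) (G x) <=
      u ^+ 2 / 4 * (A + B * F x) * expR (u * F x).
    have -> : dpsi (P x) ^+ 2 * dotp (G x) (G x) =
        u ^+ 2 / 4 * (dtheta (P x) ^+ 2 * dotp (G x) (G x)) * expR (u * F x).
      by rewrite /dpsi exprMn psi2 -/(F x); field.
    apply: ler_wpM2r; first exact: expR_ge0.
    apply: ler_wpM2l; first by rewrite divr_ge0// sqr_ge0.
    exact: AB.
  have iF : mu.-integrable setT (EFin \o (fun x => F x * expR (u * F x))).
    exact: integrable_FexpRM.
  have iH : mu.-integrable setT (EFin \o (fun x => expR (u * F x))).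
    exact: integrable_expRM.
  (* This bound and the next are crude and uniform in [x]; they only place the test function in
     [W12]. *)
  have bdB x : dpsi (P x) ^+ 2 * dotp (G x) (G x) <=
      u ^+ 2 / 4 * (`|A| + `|B| * M) * expR (`|u| * M).
    apply: le_trans (bnd x) _; apply: ler_pM.
    - apply: mulr_ge0; first by rewrite divr_ge0// sqr_ge0.
      by apply: le_trans (AB x); rewrite mulr_ge0 ?sqr_ge0// dotp_ge0.
    - exact: expR_ge0.
    - apply: ler_wpM2l; first by rewrite divr_ge0// sqr_ge0.
      apply: lerD; first exact: ler_norm.
      by apply: le_trans (ler_norm _) _; rewrite normrM ler_wpM2l.
    - rewrite ler_expR; apply: le_trans (ler_norm _) _.
      by rewrite normrM ler_wpM2l.
  have psiB x : `|psi (P x)| <= expR (u / 2 * M).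
    rewrite ger0_norm ?expR_ge0// ler_expR ler_wpM2l//.
      by rewrite divr_ge0// ltW.
    by apply: le_trans (FM x); exact: ler_norm.
  have := lsi_comp dpsiE cdpsi psiB bdB; cbv zeta.
  rewrite (_ : \int[mu]_x (psi (P x) ^+ 2) = H u); last first.
    by apply: eq_Rintegral => x _; rewrite psi2.
  rewrite (_ : (\int[mu]_x (psi (P x) ^+ 2 * ln (psi (P x) ^+ 2))%:E = (u * K u)%:E)%E); last first.
    rewrite -RintegralZl// -EFin_Rintegral//; last exact: integrable_EFinZ.
    by apply: eq_integral => x _; congr (_%:E); rewrite psi2 expRK /F; ring.
  move=> h; rewrite -lee_fin EFinB; apply: (le_trans h).
  rewrite (_ : C / 2 * u ^+ 2 * (A * H u + B * K u) =
    2 * C * (u ^+ 2 / 4 * (A * H u + B * K u))); last by field.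
  rewrite [leRHS]EFinM; apply: lee_wpmul2l; first by rewrite lee_fin mulr_ge0.
  have iAB : mu.-integrable setT (EFin \o (fun x =>
      A * expR (u * F x) + B * (F x * expR (u * F x)))).
    by apply: integrable_EFinD; exact: integrable_EFinZ.
  rewrite /H /K -!RintegralZl// -RintegralD//; [|exact: integrable_EFinZ|exact: integrable_EFinZ].
  rewrite -RintegralZl// -EFin_Rintegral//; last exact: integrable_EFinZ.
  apply: ge0_le_integral => //.
  - by move=> x _; rewrite lee_fin mulr_ge0 ?sqr_ge0// dotp_ge0.
  - apply/measurable_EFinP; apply: measurable_funM.
      by apply: measurable_funX; apply: measurableT_comp => //; exact: continuous_measurable_fun.
    exact: measurable_dotp.
  - have /integrableP[] := integrable_EFinZ (u ^+ 2 / 4) iAB; exact.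
  - move=> x _; rewrite lee_fin; apply: le_trans (bnd x) _.
    by rewrite le_eqVlt; apply/orP; left; apply/eqP; ring.
pose L u := ln (H u).
pose dL u := (H u)^-1 * K u.
have := @herbst_ode R L dL (C / 2 * A) (C / 2 * B) _ _ _ s s0.
rewrite /L H_0 ln1 /dL H_0 K_0 invr1 mul1r; apply.
- by [].
- move=> u u0; apply: (@is_derive1_comp _ (@ln R) H).
    exact: is_derive1_ln.
  exact: (is_derive_Rintegral_expRM mu M0 mF FM).
- move=> u u0; have := ent u u0.
  rewrite -(ler_pM2l (_ : 0 < (H u)^-1)) ?invr_gt0//.
  have Hu := H0 u.
  set k := K u; set l := ln _.
  rewrite (_ : (H u)^-1 * (u * k - H u * l) = u * ((H u)^-1 * k) - l); last first.
    by field; rewrite gt_eqF.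
  move=> h; apply: (le_trans h).
  by rewrite le_eqVlt; apply/orP; left; apply/eqP; field; rewrite gt_eqF.
Qed.

End herbst.

(** * Smooth bounded truncations of the identity *)

Section truncation.
Context {R : realType}.
Implicit Types e u s : R.

(* This truncation of the identity is compatible with both gradient bounds that
   feed Herbst's argument: [trunc'^2 <= 1], for linear functions, and
   [s trunc'(s)^2 <= trunc(s)] for [s >= 0], for the squared norm.  The sign [e]
   serves negative exponents. *)
Definition trunc e u s := e * (s / (1 + (u * s) ^+ 2)).
Definition dtrunc e u s := e * ((1 - (u * s) ^+ 2) / (1 + (u * s) ^+ 2) ^+ 2).

Let den_gt0 u s : 0 < 1 + (u * s) ^+ 2.
Proof. by rewrite ltr_wpDr// sqr_ge0. Qed.

Lemma is_derive_trunc e u s : is_derive s 1 (trunc e u) (dtrunc e u s).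
Proof.
have d1 : is_derive s 1 (fun v : R => 1 + (u * v) ^+ 2) (2 * u ^+ 2 * s).
  have du : is_derive s 1 (fun v : R => u * v) u.
    rewrite -[X in is_derive _ _ _ X](mulr1 u).
    exact: (@is_deriveZ _ _ _ (fun v : R => v) u).
  have dX : is_derive s 1 (fun v : R => (u * v) ^+ 2) (2 * u ^+ 2 * s).
    have -> : 2 * u ^+ 2 * s = (u * s) *: u + (u * s) *: u.
      by rewrite /GRing.scale/=; ring.
    exact: (@is_deriveM _ _ (fun v : R => u * v) (fun v : R => u * v)).
  rewrite -[X in is_derive _ _ _ X]add0r.
  exact: (is_deriveD (is_derive_cst (1 : R) s 1) dX).
have d2 : is_derive s 1 (fun v : R => (1 + (u * v) ^+ 2)^-1)
    (- (1 + (u * s) ^+ 2) ^- 2 *: (2 * u ^+ 2 * s)).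
  by apply: is_deriveV => //; rewrite gt_eqF.
have d3 : is_derive s 1 (fun v : R => v * (1 + (u * v) ^+ 2)^-1)
    (s *: (- (1 + (u * s) ^+ 2) ^- 2 *: (2 * u ^+ 2 * s)) + (1 + (u * s) ^+ 2)^-1 *: 1).
  exact: (@is_deriveM _ _ (fun v : R => v) (fun v : R => (1 + (u * v) ^+ 2)^-1)).
have -> : dtrunc e u s = e *: (s *: (- (1 + (u * s) ^+ 2) ^- 2 *: (2 * u ^+ 2 * s))
    + (1 + (u * s) ^+ 2)^-1 *: 1).
  by rewrite /dtrunc /GRing.scale/=; field; rewrite gt_eqF.
exact: (@is_deriveZ _ _ _ (fun v : R => v * (1 + (u * v) ^+ 2)^-1)).
Qed.

Lemma continuous_dtrunc e u : continuous (dtrunc e u).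
Proof.
have c1 : continuous (fun s : R => (u * s) ^+ 2).
  move=> s; have : (u * v) * (u * v) @[v --> s] --> (u * s) * (u * s).
    by apply: cvgM; apply: cvgMr; exact: cvg_id.
  exact.
move=> s; rewrite /dtrunc; apply: cvgMr; apply: cvgM.
  by apply: cvgB; [exact: cvg_cst|exact: c1].
apply: cvgV; first by rewrite expf_neq0// gt_eqF.
have c2 : 1 + (u * v) ^+ 2 @[v --> s] --> 1 + (u * s) ^+ 2.
  by apply: cvgD; [exact: cvg_cst|exact: c1].
have : (1 + (u * v) ^+ 2) * (1 + (u * v) ^+ 2) @[v --> s] -->
  (1 + (u * s) ^+ 2) * (1 + (u * s) ^+ 2) by exact: cvgM.
exact.
Qed.

Lemma trunc_bounded e u s : e ^+ 2 = 1 -> 0 < u -> `|trunc e u s| <= u^-1.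
Proof.
move=> e2 u0; have e1 : `|e| = 1.
  by apply/eqP; rewrite -sqr_norm_eq1 ?e2.
rewrite /trunc normrM e1 mul1r normrM normfV (gtr0_norm (den_gt0 _ _)).
rewrite ler_pdivrMr// ler_pdivlMl//.
have := sqr_ge0 (`|u * s| - 1); rewrite normrM (gtr0_norm u0) => h.
by rewrite -(real_normK (num_real (u * s))) normrM (gtr0_norm u0); nra.
Qed.

Lemma trunc_le e u s : e ^+ 2 = 1 -> `|trunc e u s| <= `|s|.
Proof.
move=> e2; have e1 : `|e| = 1.
  by apply/eqP; rewrite -sqr_norm_eq1 ?e2.
rewrite /trunc normrM e1 mul1r normrM normfV (gtr0_norm (den_gt0 _ _)).
by rewrite ler_pdivrMr// ler_peMr// lerDl sqr_ge0.
Qed.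

Lemma dtrunc_sqr_le1 e u s : e ^+ 2 = 1 -> dtrunc e u s ^+ 2 <= 1.
Proof.
move=> e2; rewrite /dtrunc exprMn e2 mul1r expr_div_n ler_pdivrMr ?mul1r ?exprn_gt0//.
have h := sqr_ge0 (u * s); set w := (u * s) ^+ 2 in h *.
apply: (@le_trans _ _ ((1 + w) ^+ 2)); first by nra.
by rewrite [leRHS]expr2 ler_peMr ?sqr_ge0//; nra.
Qed.

(** With $w=(us)^2$ the claim reduces to $(1-w)^2\le(1+w)^3$, which holds already with the exponent
    2 on the right. *)
Lemma dtrunc_sqr_le e u s : e ^+ 2 = 1 -> 0 <= s -> s * dtrunc e u s ^+ 2 <= e * trunc e u s.
Proof.
move=> e2 s0; have h := sqr_ge0 (u * s).
rewrite /dtrunc /trunc mulrA -expr2 exprMn e2 !mul1r; apply: ler_wpM2l => //.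
set w := (u * s) ^+ 2 in h *.
have w1 : 0 < 1 + w by lra.
rewrite expr_div_n ler_pdivrMr ?exprn_gt0//.
have -> : (1 + w)^-1 * ((1 + w) ^+ 2) ^+ 2 = (1 + w) * (1 + w) ^+ 2.
  by field; rewrite gt_eqF.
apply: (@le_trans _ _ ((1 + w) ^+ 2)); first by nra.
by rewrite ler_peMl ?sqr_ge0//; lra.
Qed.

Lemma cvg_trunc e s : trunc e (k.+1%:R^-1) s @[k --> \oo] --> e * s.
Proof.
rewrite /trunc; apply: cvgMr.
rewrite -[X in _ --> X]divr1; apply: cvgMr; apply: cvgV; first exact: oner_neq0.
rewrite -[X in _ --> X]addr0; apply: cvgD; first exact: cvg_cst.
have : (k.+1%:R^-1 * s) * (k.+1%:R^-1 * s) @[k --> \oo] --> (0 * s) * (0 * s).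
  by apply: cvgM; apply: cvgMl; exact: cvg_harmonic.
by rewrite !mul0r.
Qed.

End truncation.

(** * Removal of the truncation *)

Section herbst_unbounded.
Context {R : realType} {d : nat}.
Local Notation V := 'rV[R]_d.
Variables (mu : probability V R) (C : R).
Hypotheses (C0 : 0 <= C) (lsi : log_sobolev mu C).
Variables (P : V -> R) (G : V -> V).
Hypotheses (mP : measurable_fun setT P) (mG : measurable_fun setT G).
Hypotheses (C1P : C1 P) (GE : forall x, gradient P x = G x).
Hypothesis iP : mu.-integrable setT (EFin \o P).
Variables A B : R.
Hypotheses (A0 : 0 <= A) (B0 : 0 <= B).
Hypothesis GAB : forall x, dotp (G x) (G x) <= A + B * P x.
Hypothesis BP : B = 0 \/ forall x, 0 <= P x.

(** The bounded case is used at $|s|$ for the truncations with $u_k=1/(k+1)$ and $e$ the sign of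
    $s$, which tend to $eP$; thus $|s|e=s$ and both signs are treated together. The gradient
    hypothesis survives with [B] replaced by [e * B], which turns $1-(C/2)(eB)|s|$ into the stated
    denominator. The means converge by domination by $|P|$. *)
Lemma herbst (s : R) : s != 0 -> 0 < 1 - C / 2 * B * s ->
  (\int[mu]_x (expR (s * P x))%:E <=
   (expR ((s * \int[mu]_x P x + C / 2 * A * s ^+ 2) / (1 - C / 2 * B * s)))%:E)%E.
Proof.
move=> sn0 D0.
pose e := Num.sg s.
have e2 : e ^+ 2 = 1 by rewrite /e sqr_sg sn0.
have es : `|s| * e = s by rewrite mulrC -numEsg.
have s0 : 0 < `|s| by rewrite normr_gt0.
pose u (k : nat) : R := k.+1%:R^-1.
have u0 k : 0 < u k by rewrite invr_gt0.
pose F k x := trunc e (u k) (P x).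
have ctr k : continuous (trunc e (u k)).
  move=> x; apply: differentiable_continuous; apply/derivable1_diffP.
  by have := is_derive_trunc e (u k) x; move=> ?; exact: ex_derive.
have mF k : measurable_fun setT (F k).
  by apply: measurableT_comp => //; exact: continuous_measurable_fun.
have FB k x : `|F k x| <= (u k)^-1 by exact: trunc_bounded.
have bnd k : (\int[mu]_x (expR (`|s| * F k x))%:E <=
   (expR ((`|s| * \int[mu]_x F k x + C / 2 * A * s ^+ 2) / (1 - C / 2 * B * s)))%:E)%E.
  have AB x : dtrunc e (u k) (P x) ^+ 2 * dotp (G x) (G x) <=
      A + e * B * trunc e (u k) (P x).
    have dt1 := dtrunc_sqr_le1 (u k) (P x) e2.
    apply: (@le_trans _ _ (dtrunc e (u k) (P x) ^+ 2 * (A + B * P x))).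
      by rewrite ler_wpM2l// sqr_ge0.
    rewrite mulrDr; apply: lerD; first by rewrite ler_piMl.
    case: BP => [->|P0]; first by rewrite mul0r !mulr0 mul0r.
    have := ler_wpM2l B0 (dtrunc_sqr_le (u k) e2 (P0 x)).
    move: (dtrunc _ _ _ ^+ 2) (trunc _ _ _) => a b.
    have -> : B * (P x * a) = a * (B * P x) by ring.
    by have -> : B * (e * b) = e * B * b by ring.
  have uV0 : 0 <= (u k)^-1 by rewrite invr_ge0 ltW.
  have := herbst_bounded C0 lsi mP mG C1P GE (is_derive_trunc e (u k))
    (@continuous_dtrunc _ e (u k)) uV0 (fun x => trunc_bounded x e2 (u0 k)) AB s0.
  have -> : 1 - C / 2 * (e * B) * `|s| = 1 - C / 2 * B * s.
    by rewrite -[in RHS]es; ring.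
  rewrite real_normK ?num_real// => h.
  rewrite (EFin_Rintegral (integrable_expRM mu (mF k) (FB k) _)).
  rewrite lee_fin -ler_ln ?posrE ?expR_gt0//; last first.
    exact: (Rintegral_expRM_gt0 mu (mF k) (FB k)).
  by rewrite expRK ler_pdivlMr// mulrC.
have cF x : F k x @[k --> \oo] --> e * P x by exact: cvg_trunc.
have cint : \int[mu]_x F k x @[k --> \oo] --> e * \int[mu]_x P x.
  have ieP : mu.-integrable setT (EFin \o (fun x => e * P x)) by exact: integrable_EFinZ.
  have mFe k : measurable_fun setT (EFin \o F k) by exact/measurable_EFinP.
  have cFe : {ae mu, forall x, setT x ->
      (EFin \o F k) x @[k --> \oo] --> (EFin \o (fun x => e * P x)) x}.
    by apply: aeW => x _; apply: cvg_EFin; [exact: nearW|exact: cF].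
  have FP : {ae mu, forall x k, setT x -> (`|(EFin \o F k) x| <= `|(EFin \o P) x|)%E}.
    by apply: aeW => x k _; rewrite /= lee_fin; exact: trunc_le.
  have [_ _] := dominated_convergence measurableT mFe
    (measurable_int _ ieP) cFe (integrable_abse iP) FP.
  rewrite /= EFin_Rintegral// RintegralZl// => /fine_cvgP[_]; apply.
(* Only an upper bound is wanted, so Fatou's lemma suffices and the exponentials need no dominating
   function. *)
apply: (@le_trans _ _ (\int[mu]_x limn_einf (fun k => (expR (`|s| * F k x))%:E))%E).
  rewrite le_eqVlt; apply/orP; left; apply/eqP; apply: eq_integral => x _.
  apply/esym; apply: (cvg_limn_einf_sup _).1.
  apply: cvg_EFin; first exact: nearW.
  have c : `|s| * F k x @[k --> \oo] --> s * P x.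
    by rewrite -[X in X * P x]es -mulrA; apply: cvgMr; exact: cF.
  exact: (cvg_comp _ _ c (@continuous_expR R _)).
apply: le_trans (fatou _ _ _ _) _ => //.
  by move=> k; apply/measurable_EFinP; exact: measurable_expRM.
pose b k := expR ((`|s| * \int[mu]_x F k x + C / 2 * A * s ^+ 2) / (1 - C / 2 * B * s)).
have cb : (b k)%:E @[k --> \oo] --> (expR ((s * \int[mu]_x P x + C / 2 * A * s ^+ 2) / (1 - C / 2 * B * s)))%:E.
  apply: cvg_EFin; first exact: nearW.
  have c : (`|s| * \int[mu]_x F k x + C / 2 * A * s ^+ 2) / (1 - C / 2 * B * s) @[k --> \oo]
      --> (s * \int[mu]_x P x + C / 2 * A * s ^+ 2) / (1 - C / 2 * B * s).
    apply: cvgMl; apply: cvgD; last exact: cvg_cst.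
    by rewrite -[X in X * \int[mu]_x P x]es -mulrA; apply: cvgMr; exact: cint.
  exact: (cvg_comp _ _ c (@continuous_expR R _)).
rewrite -(cvg_lim (@ereal_hausdorff R) cb) limn_einf_lim; apply: lee_lim.
- exact: is_cvg_einfs.
- by apply/cvg_ex; eexists; exact: cb.
apply: nearW => k; apply: le_trans (bnd k).
by apply: ereal_inf_lbound; exists k => /=.
Qed.

End herbst_unbounded.

(** * Concentration of the sample *)

Lemma measurable_ltr disp (T : measurableType disp) (R : realType) (f g : T -> R) :
  measurable_fun setT f -> measurable_fun setT g -> measurable [set x | f x < g x].
Proof.
move=> mf mg; have mt : measurable [set true] by [].
by have := measurable_fun_ltr mf mg measurableT mt; rewrite setTI.
Qed.

(** * Moments and tails under the log-Sobolev inequality *)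

Section moments.
Context {R : realType} {d : nat}.
Local Notation V := 'rV[R]_d.
Variables (mu : probability V R) (Sigma : 'M[R]_d) (C : R).
Hypotheses (C1 : 1 <= C) (lsi : log_sobolev mu C).
Hypotheses (mean0 : centered mu) (cov : has_covariance mu Sigma).

(** In [\bar R] a difference with an infinite part is never finite, so a finite value of the
    integral forces both parts to be finite. This extracts integrability from the hypotheses on mean
    and covariance, which only state values. *)
Lemma integrable_of_fin_num disp (T : measurableType disp)
    (nu : {measure set T -> \bar R}) (f : T -> \bar R) : measurable_fun setT f ->
  (\int[nu]_x f x)%E \is a fin_num -> nu.-integrable setT f.
Proof.
move=> mf; rewrite integralE => fin.
have p0 : (0 <= \int[nu]_x f^\+ x)%E by exact: integral_ge0.
have n0 : (0 <= \int[nu]_x f^\- x)%E by exact: integral_ge0.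
apply/integrableP; split => //.
have -> : (\int[nu]_x `|f x| = \int[nu]_x f^\+ x + \int[nu]_x f^\- x)%E.
  rewrite -ge0_integralD//; last 2 first.
  - exact: measurable_funepos.
  - exact: measurable_funeneg.
  by apply: eq_integral => x _; rewrite -/((abse \o f) x) fune_abse.
by move: fin p0 n0; case: (integral _ _ f^\+)%E => [a| |]; case: (integral _ _ f^\-)%E => [b| |] //= _ _ _; rewrite ltry.
Qed.

Let mcoord (i : 'I_d) : measurable_fun setT (fun x : V => x ord0 i).
Proof. exact: measurable_rV_coord. Qed.

Let int_coord i : (\int[mu]_x (x ord0 i)%:E = 0)%E.
Proof. by have := mean0 i; rewrite unlock. Qed.

Lemma integrable_coord i : mu.-integrable setT (fun x : V => (x ord0 i)%:E).
Proof.
by apply: integrable_of_fin_num; [exact/measurable_EFinP|rewrite int_coord].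
Qed.

Lemma int_coord_sqr i : (\int[mu]_x (x ord0 i * x ord0 i)%:E = (Sigma i i)%:E)%E.
Proof.
have E0 : ('E_mu[fun x => x ord0 i] = 0)%E := mean0 i.
rewrite -(cov i i) covariance.unlock E0 expectation.unlock.
apply: eq_integral => x _; rewrite /= fctE /= !subr0; exact: erefl.
Qed.

Lemma integrable_coord_sqr i : mu.-integrable setT (fun x : V => (x ord0 i * x ord0 i)%:E).
Proof.
apply: integrable_of_fin_num; last by rewrite int_coord_sqr.
by apply/measurable_EFinP; apply: measurable_funM.
Qed.

Lemma integral_dotp (a : V) : mu.-integrable setT (EFin \o dotp a) /\
  \int[mu]_x dotp a x = 0.
Proof.
have iZ i : mu.-integrable setT (fun x : V => (a ord0 i)%:E * (x ord0 i)%:E)%E.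
  by apply: integrableZl => //; exact: integrable_coord.
have dE (x : V) : (dotp a x)%:E = (\sum_i (a ord0 i)%:E * (x ord0 i)%:E)%E.
  by rewrite /dotp -sumEFin.
split.
  by have := integrable_sum measurableT (index_enum 'I_d) (P := xpredT) (fun i _ => iZ i); apply: eq_integrable => // x _; rewrite /= dE.
rewrite /Rintegral; under eq_integral do rewrite dE.
rewrite (integral_sum measurableT iZ) big1// => i _.
by rewrite integralZl ?int_coord ?mule0//; exact: integrable_coord.
Qed.

Lemma integral_sqnorm : mu.-integrable setT (EFin \o sqnorm) /\
  \int[mu]_x sqnorm x = \tr Sigma.
Proof.
have dE (x : V) : (sqnorm x)%:E = (\sum_i (x ord0 i * x ord0 i)%:E)%E.
  by rewrite /sqnorm /dotp -sumEFin.
split.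
  by have := integrable_sum measurableT (index_enum 'I_d) (P := xpredT) (fun i _ => integrable_coord_sqr i); apply: eq_integrable => // x _; rewrite /= dE.
rewrite /Rintegral; under eq_integral do rewrite dE.
rewrite (integral_sum measurableT integrable_coord_sqr).
by under eq_bigr do rewrite int_coord_sqr; rewrite sumEFin.
Qed.

Let C0 : 0 <= C. Proof. by rewrite (le_trans _ C1). Qed.

(** This is [herbst] with constant squared gradient: $A=|a|^2$, $B=0$, $s=1$, and the mean term
    vanishes by centring. *)
Lemma lsi_mgf_dotp (a : V) :
  (\int[mu]_x (expR (dotp a x))%:E <= (expR (C * dotp a a / 2))%:E)%E.
Proof.
have [ia i0] := integral_dotp a.
have /= := @herbst R d mu C C0 lsi (dotp a) (cst a) _ _ (C1_dotp a) (gradient_dotp a) ia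
  (dotp a a) 0 (dotp_ge0 a) (lexx _) _ (or_introl erefl) 1 (oner_neq0 _) _.
rewrite i0 expr1n !mulr0 !mulr1 subr0 divr1 add0r mulrAC.
under eq_integral do rewrite mul1r.
apply => //.
- exact: measurable_dotp.
- by move=> x; rewrite mul0r addr0.
Qed.

(** This is [herbst] with $A=0$ and $B=4$, since $|2x|^2=4|x|^2$; the mean of the squared norm is
    the trace. *)
Lemma lsi_mgf_sqnorm (s : R) : s != 0 -> 0 < 1 - 2 * C * s ->
  (\int[mu]_x (expR (s * dotp x x))%:E <= (expR (s * \tr Sigma / (1 - 2 * C * s)))%:E)%E.
Proof.
move=> s0 D0; have [iq qE] := integral_sqnorm.
have DE : C / 2 * 4 * s = 2 * C * s by field.
have /= := @herbst R d mu C C0 lsi sqnorm ( *:%R 2) _ _ C1_sqnorm gradient_sqnorm iq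
  0 4 (lexx _) _ _ (or_intror (@dotp_ge0 _ _)) s s0 _.
rewrite qE DE mulr0 mul0r addr0; apply => //.
- exact: measurable_dotp.
- exact: measurable_rVZ.
- by move=> x; rewrite dotpZl dotpZr add0r /sqnorm mulrA; lra.
Qed.

(** The constant arises from $v^2\le4(e^v+e^{-v})$, integrated with the sub-Gaussian bound $e^{c/2}$
    along the two unit vectors of a coordinate axis. *)
Definition variance_bound (c : R) : R := 8 * expR (c / 2).

Lemma variance_coord_le i : Sigma i i <= variance_bound C.
Proof.
rewrite -lee_fin -int_coord_sqr.
apply: (@le_trans _ _ (\int[mu]_x (4%:E * ((expR (dotp (delta_mx ord0 i) x))%:E
   + (expR (dotp (- 1 *: delta_mx ord0 i) x))%:E)))%E).
  apply: ge0_le_integral => //.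
  - by move=> x _; rewrite lee_fin -expr2 sqr_ge0.
  - by apply/measurable_EFinP; exact: measurable_funM.
  - apply: measurable_funeM; apply: emeasurable_funD;
      by apply/measurable_EFinP; exact: measurable_expR_dotp.
  - move=> x _; rewrite -[delta_mx _ _]scale1r scalerA !dotp_delta mulr1 mul1r mulN1r.
    rewrite -EFinD -EFinM lee_fin -expr2.
    set v := x ord0 i.
    wlog v0 : v / 0 <= v.
      move=> H; have [/H//|v0] := leP 0 v.
      have := H (- v); rewrite oppr_ge0 (ltW v0) sqrrN opprK addrC; exact.
    have := expR_ge1Dx (v / 2); have -> : expR v = expR (v / 2) ^+ 2.
      by rewrite -expRM_natl; congr expR; field.
    have := expR_gt0 (- v); nra.
have me a : measurable_fun setT (fun x : V => (expR (dotp a x))%:E).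
  by apply/measurable_EFinP; exact: measurable_expR_dotp.
rewrite ge0_integralZl//; last 2 first.
- exact: emeasurable_funD.
- by move=> x _; rewrite -EFinD lee_fin addr_ge0// expR_ge0.
rewrite ge0_integralD//.
have dd : dotp (delta_mx ord0 i) (delta_mx ord0 i) = 1 :> R.
  have := dotp_delta i 1 (delta_mx ord0 i : V).
  by rewrite scale1r mul1r mxE !eqxx.
have -> : variance_bound C = 4 * (expR (C / 2) + expR (C / 2)).
  by rewrite /variance_bound; ring.
rewrite EFinM; apply: lee_wpmul2l; first by rewrite lee_fin.
rewrite [leRHS]EFinD; apply: leeD; apply: (le_trans (lsi_mgf_dotp _)); rewrite lee_fin ler_expR.
  by rewrite dd mulr1.
by rewrite dotpZl dotpZr dd mulr1 mulN1r opprK mulr1.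
Qed.

Lemma trace_ge0 : 0 <= \tr Sigma.
Proof.
apply: sumr_ge0 => i _; rewrite -lee_fin -int_coord_sqr.
by apply: integral_ge0 => x _; rewrite lee_fin -expr2 sqr_ge0.
Qed.

Lemma trace_le : \tr Sigma <= variance_bound C * d%:R.
Proof.
apply: le_trans (ler_sum _ (fun i _ => variance_coord_le i)) _.
by rewrite sumr_const card_ord mulr_natr.
Qed.

(** For $k\le(4C)^{-1}$ the denominator in [lsi_mgf_sqnorm] is at least $1/2$, which is the origin
    of the factor 2 in the second clause of [light_tailed]. The value $k=0$ is separate because
    [herbst] divides by the exponent. *)
Lemma lsi_light_tailed : light_tailed mu C (variance_bound C).
Proof.
split; first exact: lsi_mgf_dotp.
move=> k /andP[k0 kC].
have [->|kn0] := eqVneq k 0.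
  under eq_integral do rewrite mul0r expR0.
  rewrite integral_cst// mulr0 !mul0r expR0 mul1e.
  exact: probability_le1.
have Ck : 2 * C * k <= 2^-1.
  have : 2 * C * k <= 2 * C * (4 * C)^-1 by rewrite ler_wpM2l// mulr_ge0.
  by rewrite (_ : 2 * C * (4 * C)^-1 = 2^-1)//; field; rewrite gt_eqF// (lt_le_trans _ C1).
have D0 : 0 < 1 - 2 * C * k by lra.
apply: (le_trans (lsi_mgf_sqnorm kn0 D0)); rewrite lee_fin ler_expR.
rewrite ler_pdivrMr//.
have := trace_le; have := trace_ge0.
set T := \tr Sigma; set M := variance_bound C => T0 TM.
have : k * T <= k * (M * d%:R) by rewrite ler_wpM2l.
have kT0 : 0 <= k * T by rewrite mulr_ge0.
rewrite -!mulrA; set Q := k * (M * d%:R); nra.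
Qed.

Lemma chernoff disp (T : measurableType disp) (nu : {measure set T -> \bar R})
    (A : set T) (g : T -> R) : measurable A ->
  measurable_fun setT g -> (forall x, A x -> 0 <= g x) ->
  (nu A <= \int[nu]_x (expR (g x))%:E)%E.
Proof.
move=> mA mg Ag; rewrite -[leLHS]mul1e -integral_cst//.
rewrite integral_mkcond; apply: ge0_le_integral => //.
- by move=> x _; rewrite erestrict_ge0.
- by apply/(measurable_restrictT _ _).1.
- by apply/measurable_EFinP; exact: measurableT_comp.
- move=> x _; rewrite /patch; case: ifPn => [/set_mem /Ag gx|_]; rewrite lee_fin ?expR_ge0//.
  by rewrite -expR0 ler_expR.
Qed.

(** Chernoff's inequality at $e=s$ and $e=-s$ gives the two tails. Centring costs
    $eT/(1-2Ce)-eT=2Ce^2T/(1-2Ce)$, at most $4Cs^2T$ because $2C|e|\le1/2$. *)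
Lemma sqnorm_concentration (s delta : R) : 0 < s <= (4 * C)^-1 ->
  (mu [set x | (delta < `|dotp x x - \tr Sigma|)%R] <=
   (2 * expR (- (s * delta) + 4 * C * s ^+ 2 * \tr Sigma))%:E)%E.
Proof.
move=> /andP[s0 sC].
have Cs : 2 * C * s <= 2^-1.
  have : 2 * C * s <= 2 * C * (4 * C)^-1 by rewrite ler_wpM2l// mulr_ge0.
  by rewrite (_ : 2 * C * (4 * C)^-1 = 2^-1)//; field; rewrite gt_eqF// (lt_le_trans _ C1).
have Cs0 : 0 < 2 * C * s by rewrite !mulr_gt0// (lt_le_trans _ C1).
have T0 := trace_ge0; set T := \tr Sigma in T0 *.
have mq : measurable_fun setT (fun x : V => dotp x x) by exact: measurable_dotp.
have tail (e : R) : `|e| = s ->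
    (mu [set x | (e * T + s * delta < e * dotp x x)%R] <=
     (expR (- (s * delta) + 4 * C * s ^+ 2 * T))%:E)%E.
  move=> es.
  have en0 : e != 0 by rewrite -normr_eq0 es gt_eqF.
  have eb : - s <= e <= s by rewrite -ler_norml es.
  have e2 : e ^+ 2 = s ^+ 2 by rewrite -es real_normK ?num_real.
  have D0 : 0 < 1 - 2 * C * e.
    have : 2 * C * e <= 2 * C * s by rewrite ler_wpM2l ?mulr_ge0//; case/andP: eb.
    lra.
  apply: (le_trans (@chernoff _ _ mu _ (fun x => - (e * T + s * delta) + e * dotp x x) _ _ _)).
  - apply: measurable_ltr.
    + exact: measurable_cst.
    + by apply: measurable_funM.
  - by apply: measurable_funD => //; apply: measurable_funM.
  - by move=> x /= h; rewrite addrC subr_ge0 ltW.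
  under eq_integral do rewrite expRD EFinM.
  rewrite ge0_integralZl//; last by apply/measurable_EFinP; exact: measurable_expR_sqr.
  apply: le_trans (lee_wpmul2l _ (lsi_mgf_sqnorm en0 D0)) _; first by rewrite lee_fin expR_ge0.
  rewrite -EFinM -expRD lee_fin ler_expR.
  suff : e * T / (1 - 2 * C * e) <= e * T + 4 * C * s ^+ 2 * T by lra.
  rewrite ler_pdivrMr// -e2 -subr_ge0.
  rewrite (_ : _ - _ = 2 * C * e ^+ 2 * T * (1 - 4 * C * e)); last by ring.
  apply: mulr_ge0; first by rewrite mulr_ge0// mulr_ge0 ?sqr_ge0// mulr_ge0.
  have : 2 * C * e <= 2 * C * s by rewrite ler_wpM2l ?mulr_ge0//; case/andP: eb.
  lra.
have -> : [set x | delta < `|dotp x x - T|] =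
    ([set x : V | s * T + s * delta < s * dotp x x] `|`
    [set x : V | - s * T + s * delta < - s * dotp x x])%classic.
  apply/seteqP; split => x /=.
    rewrite ltr_normr => /orP[h|h]; [left|right].
      by rewrite -mulrDr ltr_pM2l//; lra.
    by rewrite !mulNr addrC -ltrBrDr opprK addrC -mulrBr ltr_pM2l//; lra.
  rewrite ltr_normr => -[h|h]; apply/orP; [left|right].
    by move: h; rewrite -mulrDr ltr_pM2l//; lra.
  by move: h; rewrite !mulNr addrC -ltrBrDr opprK addrC -mulrBr ltr_pM2l//; lra.
have mS (e : R) : measurable [set x : V | e * T + s * delta < e * dotp x x].
  apply: measurable_ltr.
  - exact: measurable_cst.
  - by apply: measurable_funM.
apply: (le_trans (measureU2 mu (mS s) (mS (- s)))).
rewrite mulr2n mulrDl mul1r EFinD; apply: leeD; apply: tail.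
  by rewrite gtr0_norm.
by rewrite normrN gtr0_norm.
Qed.

Lemma dotp_tail (y : V) (s delta : R) : 0 < s ->
  (mu [set x | (delta < `|dotp y x|)%R] <=
   (2 * expR (- (s * delta) + C * s ^+ 2 * dotp y y / 2))%:E)%E.
Proof.
move=> s0.
have md a : measurable_fun setT (fun x : V => dotp a x) by exact: measurable_dotp.
have tail (e : R) : `|e| = s ->
    (mu [set x | (s * delta < dotp (e *: y) x)%R] <=
     (expR (- (s * delta) + C * s ^+ 2 * dotp y y / 2))%:E)%E.
  move=> es.
  have e2 : e ^+ 2 = s ^+ 2 by rewrite -es real_normK ?num_real.
  apply: (le_trans (@chernoff _ _ mu _ (fun x => - (s * delta) + dotp (e *: y) x) _ _ _)).
  - by apply: measurable_ltr; [exact: measurable_cst|exact: md].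
  - by apply: measurable_funD.
  - by move=> x /= h; rewrite addrC subr_ge0 ltW.
  under eq_integral do rewrite expRD EFinM.
  rewrite ge0_integralZl//; last by apply/measurable_EFinP; exact: measurable_expR_dotp.
  apply: le_trans (lee_wpmul2l _ (lsi_mgf_dotp _)) _; first by rewrite lee_fin expR_ge0.
  rewrite -EFinM -expRD lee_fin ler_expR dotpZl dotpZr -e2.
  by rewrite le_eqVlt; apply/orP; left; apply/eqP; ring.
have -> : [set x | delta < `|dotp y x|] =
    ([set x : V | s * delta < dotp (s *: y) x] `|`
    [set x : V | s * delta < dotp (- s *: y) x])%classic.
  apply/seteqP; split => x /=; rewrite !dotpZl ltr_normr mulNr -mulrN !ltr_pM2l//.
    by move=> /orP[h|h]; [left|right].
  by move=> [h|h]; apply/orP; [left|right].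
have mS (e : R) : measurable [set x : V | s * delta < dotp (e *: y) x].
  by apply: measurable_ltr; [exact: measurable_cst|exact: md].
apply: (le_trans (measureU2 mu (mS s) (mS (- s)))).
rewrite mulr2n mulrDl mul1r EFinD; apply: leeD; apply: tail.
  by rewrite gtr0_norm.
by rewrite normrN gtr0_norm.
Qed.

End moments.

(** Measurability is proved together with the union bound, since each induction step of the latter
    uses it. *)
Lemma measure_bigsetU_le disp (T : measurableType disp) (R : realType)
    (mu : {measure set T -> \bar R}) (I : Type) (r : seq I) (Q : pred I)
    (A : I -> set T) (c : R) : 0 <= c ->
  (forall i, Q i -> measurable (A i)) -> (forall i, Q i -> (mu (A i) <= c%:E)%E) ->
  measurable (\big[setU/set0]_(i <- r | Q i) A i) /\
  (mu (\big[setU/set0]_(i <- r | Q i) A i) <= ((size r)%:R * c)%:E)%E.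
Proof.
move=> c0 mA Ac; elim: r => [|i r [mU IH]].
  by rewrite big_nil measure0 mul0r; split.
rewrite big_cons /=; case: ifPn => Qi; last first.
  by split => //; apply: (le_trans IH); rewrite lee_fin ler_wpM2r// ler_nat.
split; first by apply: measurableU => //; exact: mA.
apply: (le_trans (measureU2 mu (mA _ Qi) mU)).
rewrite -natr1 mulrDl mul1r addrC EFinD; apply: leeD => //.
exact: Ac.
Qed.

(** * The exceptional event for the sample *)

Section bad_event.
Context {R : realType} {d : nat}.
Local Notation V := 'rV[R]_d.
Variables (mu : probability V R) (Sigma : 'M[R]_d) (C : R).
Hypotheses (C1 : 1 <= C) (lsi : log_sobolev mu C).
Hypotheses (mean0 : centered mu) (cov : has_covariance mu Sigma).
Context disp (Omega : measurableType disp) (P : probability Omega R).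
Variables (n : nat) (X : 'I_n -> Omega -> V).
Hypothesis iidX : iid_sample P mu X.

(** Independence is given for boxes in all coordinates; with [setT] in the others it yields
    rectangles in the coordinates [i] and [j], and these determine the product measure. *)
Lemma sample_pair_law i j (A : set (V * V)) : i != j -> measurable A ->
  P [set w | A (X i w, X j w)] = (mu \x mu)%E A.
Proof.
move=> ij mA; have [mX lawX indX] := iidX.
pose f w := (X i w, X j w).
have mf : measurable_fun setT f by exact: measurable_fun_pair.
pose F : {mfun Omega >-> (V * V)%type} := HB.pack f (isMeasurableFun.Build _ _ _ _ f mf).
rewrite -[LHS]/(distribution P F A).
apply/esym; apply: product_measure_unique => // B1 B2 mB1 mB2.
pose D k : set V := if k == i then B1 else if k == j then B2 else setT.
have mD k : measurable (D k).
  by rewrite /D; case: ifP => // _; case: ifP.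
have E : F @^-1` (B1 `*` B2) = [set w | forall k, D k (X k w)].
  apply/seteqP; split => w /=.
    move=> [/= h1 h2] k; rewrite /D; case: eqP => [->//|_].
    by case: eqP => [->//|_].
  move=> h; split => /=; first by have := h i; rewrite /D eqxx.
  by have := h j; rewrite /D eq_sym (negbTE ij) eqxx.
apply: (etrans (congr1 P E)).
rewrite indX// (bigD1 i)//= (bigD1 j) 1?eq_sym//= big1 ?mule1.
  by rewrite !lawX// /D eqxx eq_sym (negbTE ij) eqxx.
move=> k /andP[ki kj]; rewrite lawX// /D (negbTE ki) (negbTE kj).
exact: probability_setT.
Qed.

Lemma pair_tail i j (s delta Q : R) : i != j -> 0 < s ->
  (P [set w | (dotp (X i w) (X i w) <= Q)%R /\ (delta < `|dotp (X i w) (X j w)|)%R]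
   <= (2 * expR (- (s * delta) + C * s ^+ 2 * Q / 2))%:E)%E.
Proof.
move=> ij s0.
pose A := [set p : V * V | dotp p.1 p.1 <= Q] `&` [set p : V * V | delta < `|dotp p.1 p.2|].
have mA : measurable A.
  apply: measurableI; last first.
    apply: measurable_ltr => //; apply: measurableT_comp => //.
    exact: measurable_dotp.
  rewrite -[X in measurable X]setCK; apply: measurableC.
  rewrite (_ : ~` _ = [set p : V * V | Q < dotp p.1 p.1]).
    by apply: measurable_ltr => //; exact: measurable_dotp.
  by apply/seteqP; split => p /=; [move/negP; rewrite -ltNge|rewrite ltNge => /negP].
rewrite (sample_pair_law ij mA) /product_measure1 /=.
have c0 : (0 <= (2 * expR (- (s * delta) + C * s ^+ 2 * Q / 2))%:E :> \bar R)%E.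
  by rewrite lee_fin mulr_ge0// expR_ge0.
apply: (@le_trans _ _ (\int[mu]_x (2 * expR (- (s * delta) + C * s ^+ 2 * Q / 2))%:E)%E); last first.
  by rewrite integral_cst//= (_ : mu _ = 1%E) ?mule1//; exact: probability_setT.
apply: ge0_le_integral => //.
- exact: measurable_fun_xsection.
- move=> x _ /=; have [xQ|xQ] := leP (dotp x x) Q; last first.
    rewrite (_ : xsection _ _ = set0) ?measure0//.
    apply/seteqP; split => y //; rewrite /xsection /= inE => -[/= h _].
    by move: h; rewrite leNgt xQ.
  apply: (@le_trans _ _ (mu [set y | (delta < `|dotp x y|)%R])).
    apply: le_measure; rewrite ?inE.
    - exact: measurable_xsection.
    - apply: measurable_ltr => //; apply: measurableT_comp => //.
      exact: measurable_dotp.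
    - by move=> y; rewrite /xsection /= inE => -[].
  apply: (le_trans (dotp_tail C1 lsi mean0 x delta s0)).
  rewrite lee_fin ler_wpM2l// ler_expR lerD2l.
  apply: ler_wpM2r => //; apply: ler_wpM2l => //.
  by rewrite mulr_ge0 ?sqr_ge0// (le_trans _ C1).
Qed.

(** Where the squared norms are within [delta] of the trace they are at most [Q], so the cut-off in
    the events for pairs excludes nothing there. The exceptional set is the union of the events for
    points and for ordered pairs. *)
Lemma bad_event (s delta Q : R) : 0 < s <= (4 * C)^-1 -> \tr Sigma + delta <= Q ->
  exists B : set Omega, [/\ measurable B,
    (P B <= (n%:R * (2 * expR (- (s * delta) + 4 * C * s ^+ 2 * \tr Sigma)) +
             n%:R * n%:R * (2 * expR (- (s * delta) + C * s ^+ 2 * Q / 2)))%:E)%E &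
    forall w, ~ B w ->
      (forall i, `|dotp (X i w) (X i w) - \tr Sigma| <= delta) /\
      (forall i j, i != j -> `|dotp (X i w) (X j w)| <= delta)].
Proof.
move=> sC TQ; have [mX lawX indX] := iidX.
have s0 : 0 < s by case/andP: sC.
pose A1 i := [set w | delta < `|dotp (X i w) (X i w) - \tr Sigma|].
pose A2 (p : 'I_n * 'I_n) := [set w | (dotp (X p.1 w) (X p.1 w) <= Q)%R /\
  (delta < `|dotp (X p.1 w) (X p.2 w)|)%R].
have mq : measurable_fun setT (fun x : V => dotp x x) by exact: measurable_dotp.
have mA1 i : measurable (A1 i).
  apply: measurable_ltr => //; apply: measurableT_comp => //.
  apply: measurable_funB => //; exact: measurable_dotp.
have mA2 p : measurable (A2 p).
  apply: measurableI; last first.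
    apply: measurable_ltr => //; apply: measurableT_comp => //.
    exact: measurable_dotp.
  rewrite -[X in measurable X]setCK; apply: measurableC.
  rewrite (_ : ~` _ = [set w | Q < dotp (X p.1 w) (X p.1 w)]).
    by apply: measurable_ltr => //; exact: measurable_dotp.
  by apply/seteqP; split => w /=; [move/negP; rewrite -ltNge|rewrite ltNge => /negP].
have PA1 i : true -> (P (A1 i) <= (2 * expR (- (s * delta) + 4 * C * s ^+ 2 * \tr Sigma))%:E)%E.
  move=> _; have mS : measurable [set x : V | delta < `|dotp x x - \tr Sigma|].
    apply: measurable_ltr => //; apply: measurableT_comp => //.
    exact: measurable_funB.
  have -> : A1 i = X i @^-1` [set x : V | delta < `|dotp x x - \tr Sigma|] by [].
  by rewrite lawX//; exact: sqnorm_concentration.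
have PA2 (p : 'I_n * 'I_n) : p.1 != p.2 ->
    (P (A2 p) <= (2 * expR (- (s * delta) + C * s ^+ 2 * Q / 2))%:E)%E.
  by move=> ij; exact: pair_tail.
have [|mU1 PU1] := @measure_bigsetU_le _ _ _ P _ (enum 'I_n) xpredT A1 _ _ (fun i _ => mA1 i) PA1.
  by rewrite mulr_ge0// expR_ge0.
have [|mU2 PU2] := @measure_bigsetU_le _ _ _ P _ (enum {: 'I_n * 'I_n}) (fun p => p.1 != p.2) A2 _ _ (fun i _ => mA2 i) PA2.
  by rewrite mulr_ge0// expR_ge0.
exists ((\big[setU/set0]_(i <- enum 'I_n) A1 i) `|`
        (\big[setU/set0]_(p <- enum {: 'I_n * 'I_n} | p.1 != p.2) A2 p)); split.
- exact: measurableU.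
- apply: (le_trans (measureU2 P mU1 mU2)); rewrite EFinD; apply: leeD.
    by apply: (le_trans PU1); rewrite -cardE card_ord.
  by apply: (le_trans PU2); rewrite -cardE card_prod card_ord natrM.
move=> w Bw.
have H1 i : `|dotp (X i w) (X i w) - \tr Sigma| <= delta.
  rewrite leNgt; apply/negP => h; apply: Bw; left.
  rewrite -bigcup_seq; exists i => //=; by rewrite mem_enum.
split => // i j ij; rewrite leNgt; apply/negP => h; apply: Bw; right.
rewrite -bigcup_seq_cond; exists (i, j) => /=; first by rewrite mem_enum ij.
split => //=; have := H1 i; rewrite ler_norml => /andP[_]; lra.
Qed.

End bad_event.

(** * The cubic remainder of the kernel function *)

Section cubic_remainder.
Context {R : realType}.

Lemma MVT_abs (f df : R -> R) (a x B : R) :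
  (forall y : R, is_derive y 1 f (df y)) ->
  (forall y, `|y - a| <= `|x - a| -> `|df y| <= B) ->
  `|f x - f a| <= B * `|x - a|.
Proof.
move=> dfE dfB.
have cf (u v : R) : {within `[u, v], continuous f}.
  by apply: derivable_within_continuous => y _; have := dfE y => ?; exact: ex_derive.
have dfo (u v y : R) : y \in `]u, v[ -> is_derive y 1 f (df y) by [].
have [ax|xa|->] := ltgtP a x; last by rewrite !subrr normr0 mulr0.
- have [c + E] := MVT ax (@dfo a x) (cf a x).
  rewrite in_itv/= => /andP[ac cx].
  by rewrite E normrM ler_wpM2r// dfB// !gtr0_norm ?subr_gt0// lerD2r ltW.
- have [c + E] := MVT xa (@dfo x a) (cf x a).
  rewrite in_itv/= => /andP[xc ca].
  rewrite distrC E normrM (distrC x) ler_wpM2r// dfB//.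
  by rewrite distrC (distrC x) !gtr0_norm ?subr_gt0// lerD2l lerN2 ltW.
Qed.

Variables (h : R -> R) (C : R).
Hypothesis h_C3 : forall k : nat, (k < 3)%N -> forall x : R, derivable (derive1n k h) x 1.
Hypotheses (h_at0 : h 0 = 0) (h1_at0 : derive1n 1 h 0 = 1) (h2_at0 : derive1n 2 h 0 = 0).
Hypothesis C1 : 1 <= C.
Hypothesis h3_bound : forall x : R, `|derive1n 3 h x| <= C * expR (C * `|x|).

Let C0 : 0 <= C. Proof. by rewrite (le_trans _ C1). Qed.

Let dh k : (k < 3)%N -> forall x : R, is_derive x 1 (derive1n k h) (derive1n k.+1 h x).
Proof. by move=> k3 x; rewrite derive1nS derive1E; apply/derivableP; exact: h_C3. Qed.

Let le_expC (x y : R) : `|y| <= `|x| -> expR (C * `|y|) <= expR (C * `|x|).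
Proof. by move=> yx; rewrite ler_expR ler_wpM2l. Qed.

Let h2_bound (x : R) : `|derive1n 2 h x| <= C * `|x| * expR (C * `|x|).
Proof.
have := @MVT_abs (derive1n 2 h) (derive1n 3 h) 0 x (C * expR (C * `|x|)) (dh (ltnSn 2)).
rewrite h2_at0 !subr0 => H.
have -> : C * `|x| * expR (C * `|x|) = C * expR (C * `|x|) * `|x| by ring.
apply: H => y; rewrite subr0 => yx.
by apply: (le_trans (h3_bound y)); rewrite ler_wpM2l// le_expC.
Qed.

Let h1_bound (x : R) : `|derive1n 1 h x - 1| <= C * `|x| ^+ 2 * expR (C * `|x|).
Proof.
have := @MVT_abs (derive1n 1 h) (derive1n 2 h) 0 x (C * `|x| * expR (C * `|x|)) (dh (isT : (1 < 3)%N)).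
rewrite h1_at0 subr0 => H.
have -> : C * `|x| ^+ 2 * expR (C * `|x|) = C * `|x| * expR (C * `|x|) * `|x| by ring.
apply: H => y; rewrite subr0 => yx; apply: (le_trans (h2_bound y)).
by rewrite ler_pM ?le_expC ?ler_wpM2l ?mulr_ge0 ?expR_ge0.
Qed.

Definition remainder (x : R) := h x - x.

Let remainder0 : remainder 0 = 0.
Proof. by rewrite /remainder h_at0 subrr. Qed.

Let dremainder (x : R) : is_derive x 1 remainder (derive1n 1 h x - 1).
Proof. by have := dh (isT : (0 < 3)%N) x => ?; apply: is_deriveB. Qed.

(** The bound on $h'''$ is integrated twice from 0 to control $h'-1$, the derivative of the
    remainder; the mean value theorem then acts between $a$ and $x$, where $|y|\le|a|+|x-a|$. At
    $a=0$ this is cubic in $x$, elsewhere linear in $x-a$. *)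
Lemma remainder_lip (a x : R) : `|remainder x - remainder a| <=
  C * (`|a| + `|x - a|) ^+ 2 * expR (C * (`|a| + `|x - a|)) * `|x - a|.
Proof.
apply: (MVT_abs dremainder) => y yx.
have yb : `|y| <= `|a| + `|x - a|.
  have -> : y = a + (y - a) by ring.
  by apply: (le_trans (ler_normD _ _)); rewrite lerD2l.
apply: (le_trans (h1_bound y)).
apply: ler_pM; rewrite ?expR_ge0 ?mulr_ge0 ?exprn_ge0//.
  by rewrite ler_wpM2l// lerXn2r// nnegrE ?addr_ge0.
by rewrite ler_expR ler_wpM2l.
Qed.

Lemma continuous_remainder : continuous remainder.
Proof.
by move=> x; apply: differentiable_continuous; apply/derivable1_diffP; have := dremainder x => ?; exact: ex_derive.
Qed.

(** This is $y\le e^y$ at $y=kv/m$, raised to the power $m$. *)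
Lemma expr_le_expR (m : nat) (k v : R) : 0 < k -> 0 <= v ->
  v ^+ m <= m%:R ^+ m * k ^- m * expR (k * v).
Proof.
move=> k0 v0; case: m => [|m].
  by rewrite !expr0 invr1 !mul1r -expR0 ler_expR mulr_ge0// ltW.
have m0 : 0 < m.+1%:R :> R by [].
have kv : k * v / m.+1%:R <= expR (k * v / m.+1%:R).
  by apply: le_trans (expR_ge1Dx _); rewrite lerDr.
have : (k * v / m.+1%:R) ^+ m.+1 <= expR (k * v).
  apply: (@le_trans _ _ (expR (k * v / m.+1%:R) ^+ m.+1)).
    by rewrite lerXn2r// nnegrE ?expR_ge0// divr_ge0// mulr_ge0// ltW.
  by rewrite -expRM_natl mulrC divfK// gt_eqF.
rewrite expr_div_n exprMn ler_pdivrMr ?exprn_gt0// => hh.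
rewrite -mulrA mulrCA ler_pdivlMl ?exprn_gt0//.
by rewrite [leRHS]mulrC.
Qed.

(** One constant serves both bounds below: $6^6$ comes from the sixth power in the first,
    $e^{(4+2C)T}$ from the centre $|a|\le T$ in the second. *)
Definition remainder_const (T : R) : R := 6 ^+ 6 * C ^+ 2 * expR ((4 + 2 * C) * T).

Lemma remainder_const_ge0 T : 0 <= remainder_const T.
Proof. by rewrite !mulr_ge0 ?sqr_ge0 ?expR_ge0. Qed.

(** The cubic bound squares to $C^2v^6e^{2Cv}$. One factor $e^{kv}$ absorbs $v^6$ and produces
    $k^{-6}$, the other absorbs $e^{2Cv}$ since $2C\le k$. *)
Lemma remainder_sqr_le (T k x : R) : 0 <= T -> 2 * C <= k ->
  remainder x ^+ 2 <= remainder_const T * k ^- 6 * expR (2 * k * `|x|).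
Proof.
have C1' := C1; move=> T0 kC; have k0 : 0 < k by lra.
have := remainder_lip 0 x; rewrite remainder0 normr0 !subr0 add0r.
set v := `|x| => lip.
have v0 : 0 <= v by exact: normr_ge0.
have h1 : remainder x ^+ 2 <= C ^+ 2 * v ^+ 6 * expR (2 * C * v).
  rewrite -(real_normK (num_real (remainder x))).
  apply: (@le_trans _ _ ((C * v ^+ 2 * expR (C * v) * v) ^+ 2)).
    by rewrite lerXn2r// nnegrE !mulr_ge0 ?expR_ge0// exprn_ge0.
  rewrite (_ : expR (2 * C * v) = expR (C * v) ^+ 2); last first.
    by rewrite -expRM_natl mulrA.
  by rewrite le_eqVlt; apply/orP; left; apply/eqP; ring.
apply: (le_trans h1).
have h2 := expr_le_expR 6 k0 v0.
apply: (@le_trans _ _ (C ^+ 2 * (6 ^+ 6 * k ^- 6 * expR (k * v)) * expR (k * v))).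
  apply: ler_pM; rewrite ?expR_ge0 ?mulr_ge0 ?exprn_ge0//.
    by rewrite ler_wpM2l// sqr_ge0.
  by rewrite ler_expR ler_wpM2r.
have -> : expR (2 * k * v) = expR (k * v) * expR (k * v).
  by rewrite -expRD; congr expR; ring.
rewrite /remainder_const.
have eT : 1 <= expR ((4 + 2 * C) * T).
  by rewrite -[leLHS]expR0 ler_expR mulr_ge0//; lra.
set e := expR (k * v); set f := expR ((4 + 2 * C) * T).
rewrite [leRHS](_ : _ = (C ^+ 2 * (6 ^+ 6 * k ^- 6 * e) * e) * f); last by ring.
apply: ler_peMr => //; rewrite !mulr_ge0 ?expR_ge0 ?invr_ge0 ?exprn_ge0 ?sqr_ge0//.
exact: ltW.
Qed.

(** Here only the Lipschitz factor $v^2$ is small and produces $k^{-2}$. The remaining $m^4e^{2Cm}$,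
    with $m=|a|+v$, is at most $e^{(4+2C)m}$: the part in $|a|$ goes into the constant, the part in
    $v$ into $e^{kv}$, as $4+2C\le k$. *)
Lemma remainder_diff_sqr_le (T k a x : R) : `|a| <= T -> 4 + 2 * C <= k ->
  (remainder x - remainder a) ^+ 2 <=
  remainder_const T * k ^- 2 * expR (2 * k * `|x - a|).
Proof.
have C1' := C1; move=> aT kC; have k0 : 0 < k by lra.
have := remainder_lip a x; set v := `|x - a| => lip.
have v0 : 0 <= v by exact: normr_ge0.
set m := `|a| + v in lip.
have m0 : 0 <= m by rewrite addr_ge0.
have T0 : 0 <= T by rewrite (le_trans _ aT).
have h1 : (remainder x - remainder a) ^+ 2 <= C ^+ 2 * m ^+ 4 * expR (2 * C * m) * v ^+ 2.
  rewrite -(real_normK (num_real (remainder x - remainder a))).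
  apply: (@le_trans _ _ ((C * m ^+ 2 * expR (C * m) * v) ^+ 2)).
    by rewrite lerXn2r// nnegrE !mulr_ge0 ?expR_ge0// exprn_ge0.
  rewrite (_ : expR (2 * C * m) = expR (C * m) ^+ 2); last first.
    by rewrite -expRM_natl mulrA.
  by rewrite le_eqVlt; apply/orP; left; apply/eqP; ring.
apply: (le_trans h1).
have h2 := expr_le_expR 2 k0 v0.
have h4 : m ^+ 4 <= expR (4 * m).
  rewrite expRM_natl lerXn2r ?nnegrE ?expR_ge0//.
  by apply: le_trans (expR_ge1Dx _); rewrite lerDr.
have h5 : m ^+ 4 * expR (2 * C * m) <= expR ((4 + 2 * C) * T) * expR (k * v).
  apply: (@le_trans _ _ (expR (4 * m) * expR (2 * C * m))).
    by rewrite ler_wpM2r ?expR_ge0.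
  rewrite -!expRD ler_expR -mulrDl /m mulrDr; apply: lerD.
    by rewrite ler_wpM2l//; lra.
  by rewrite ler_wpM2r.
apply: (@le_trans _ _ (C ^+ 2 * (expR ((4 + 2 * C) * T) * expR (k * v)) * (2 ^+ 2 * k ^- 2 * expR (k * v)))).
  apply: ler_pM => //; rewrite ?mulr_ge0 ?expR_ge0 ?exprn_ge0//.
  by rewrite -mulrA ler_wpM2l// sqr_ge0.
have -> : expR (2 * k * v) = expR (k * v) * expR (k * v).
  by rewrite -expRD; congr expR; ring.
rewrite /remainder_const.
set e := expR (k * v); set f := expR ((4 + 2 * C) * T).
rewrite [leLHS](_ : _ = 2 ^+ 2 * (C ^+ 2 * f * k ^- 2 * e * e)); last by ring.
rewrite [leRHS](_ : _ = 6 ^+ 6 * (C ^+ 2 * f * k ^- 2 * e * e)); last by ring.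
apply: ler_wpM2r; first by rewrite !mulr_ge0 ?expR_ge0 ?invr_ge0 ?sqr_ge0.
by rewrite -!natrX ler_nat.
Qed.

End cubic_remainder.

(** * Operator norms *)

Section cauchy_schwarz.
Context {R : realType}.

(** The choice $c=S/A$ gives the claim. If $A=0$ and $S>0$, then $c=(F+1)/S$ would give $2S\le
    SF/(F+1)$, which is impossible. Cauchy-Schwarz follows from this for sums and for integrals
    alike. *)
Lemma sqr_le_of_AMGM (A F S : R) : 0 <= A -> 0 <= F ->
  (forall c, 0 < c -> 2 * S <= c * A + c^-1 * F) -> 0 <= S -> S ^+ 2 <= A * F.
Proof.
move=> A0 F0 H; rewrite le_eqVlt => /predU1P[<-|S0]; first by rewrite expr0n mulr_ge0.
have [A_eq0|A_neq0] := eqVneq A 0.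
  have c0 : 0 < (F + 1) / S by rewrite divr_gt0// ltr_wpDl.
  have := H _ c0; rewrite A_eq0 mulr0 add0r invf_div => h.
  have F1 : 0 < F + 1 by rewrite ltr_wpDl.
  move: h; rewrite mulrAC ler_pdivlMr//; nra.
have A_gt0 : 0 < A by rewrite lt_def A_neq0.
have c0 : 0 < S / A by rewrite divr_gt0.
have := H _ c0; rewrite divfK// invf_div => h.
have {}h : S <= A / S * F by lra.
by move: h; rewrite mulrAC ler_pdivlMr// expr2.
Qed.

(** Square roots are avoided: $2|S_i|\le cA_i+c^{-1}F_i$ because $(cA_i+c^{-1}F_i)^2\ge4A_iF_i$, and
    these bounds can be summed. *)
Lemma sqr_sum_le (I : Type) (r : seq I) (Q : pred I) (S A F : I -> R) :
  (forall i, 0 <= A i) -> (forall i, 0 <= F i) ->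
  (forall i, S i ^+ 2 <= A i * F i) ->
  (\sum_(i <- r | Q i) S i) ^+ 2 <=
  (\sum_(i <- r | Q i) A i) * (\sum_(i <- r | Q i) F i).
Proof.
move=> A0 F0 SAF; rewrite -(real_normK (num_real (\sum_(i <- r | Q i) S i))).
apply: sqr_le_of_AMGM => //; try by apply: sumr_ge0.
move=> c c0; apply: (@le_trans _ _ (2 * \sum_(i <- r | Q i) `|S i|)).
  by rewrite ler_pM2l// ler_norm_sum.
rewrite !mulr_sumr -big_split; apply: ler_sum => i _.
suff : 2 * `|S i| <= c * A i + c^-1 * F i by [].
have p0 : 0 <= c * A i + c^-1 * F i by rewrite addr_ge0 ?mulr_ge0 ?invr_ge0 ?(ltW c0).
have q0 : 0 <= 2 * `|S i| by rewrite mulr_ge0.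
rewrite -(@ler_pXn2r _ 2) ?nnegrE//.
rewrite exprMn real_normK ?num_real//.
have := SAF i; have := sqr_ge0 (c * A i - c^-1 * F i).
have -> : (c * A i - c^-1 * F i) ^+ 2 =
  (c * A i + c^-1 * F i) ^+ 2 - 4 * (A i * F i) by field; rewrite gt_eqF.
rewrite (_ : 2 ^+ 2 = 4 :> R); last by ring.
lra.
Qed.

Context disp (T : measurableType disp) (mu : {measure set T -> \bar R}).

(* [f] need not be measurable: this spares proving the measurability of the
   images under the operators. *)
Lemma le_integral_nonmeas (f g : T -> \bar R) : (forall x, 0 <= f x)%E ->
  (forall x, f x <= g x)%E -> (\int[mu]_x f x <= \int[mu]_x g x)%E.
Proof.
move=> f0 fg; have g0 x : (0 <= g x)%E by exact: le_trans (fg x).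
rewrite !ge0_integralTE//; apply: ereal_sup_le => _ [phi phif <-].
by exists phi => // x; exact: le_trans (fg x).
Qed.

Lemma integrable_mul_L2 (k f : T -> R) :
  measurable_fun setT k -> measurable_fun setT f ->
  (\int[mu]_x (k x ^+ 2)%:E < +oo)%E -> (\int[mu]_x (f x ^+ 2)%:E < +oo)%E ->
  mu.-integrable setT (EFin \o (fun x => k x * f x)).
Proof.
move=> mk mf k2 f2; apply/integrableP; split.
  by apply/measurable_EFinP; exact: measurable_funM.
apply: (@le_lt_trans _ _ (\int[mu]_x ((k x ^+ 2)%:E + (f x ^+ 2)%:E))%E).
  apply: le_integral_nonmeas => x //; rewrite -EFinD lee_fin normrM.
  rewrite -(real_normK (num_real (k x))) -(real_normK (num_real (f x))).
  by have := sqr_ge0 (`|k x| - `|f x|); have := normr_ge0 (k x); have := normr_ge0 (f x); nra.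
rewrite ge0_integralD//; first exact: lte_add_pinfty.
- by move=> x _; rewrite lee_fin sqr_ge0.
- by apply/measurable_EFinP; exact: measurable_funX.
- by move=> x _; rewrite lee_fin sqr_ge0.
- by apply/measurable_EFinP; exact: measurable_funX.
Qed.

Lemma integral_mul_L2_le (k f : T -> R) (A F : R) :
  measurable_fun setT k -> measurable_fun setT f ->
  (\int[mu]_x (k x ^+ 2)%:E <= A%:E)%E -> (\int[mu]_x (f x ^+ 2)%:E <= F%:E)%E ->
  (\int[mu]_x (k x * f x)) ^+ 2 <= A * F.
Proof.
move=> mk mf kA fF.
have k0 : (0 <= \int[mu]_x (k x ^+ 2)%:E)%E.
  by apply: integral_ge0 => x _; rewrite lee_fin sqr_ge0.
have f0 : (0 <= \int[mu]_x (f x ^+ 2)%:E)%E.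
  by apply: integral_ge0 => x _; rewrite lee_fin sqr_ge0.
have A0 : 0 <= A by rewrite -lee_fin (le_trans k0).
have F0 : 0 <= F by rewrite -lee_fin (le_trans f0).
have ikf : mu.-integrable setT (EFin \o (fun x => k x * f x)).
  by apply: integrable_mul_L2 => //; [exact: le_lt_trans kA (ltry _)|exact: le_lt_trans fF (ltry _)].
rewrite -(real_normK (num_real (\int[mu]_x _))).
apply: sqr_le_of_AMGM => // c c0.
have mk2 : measurable_fun setT (fun x => (k x ^+ 2)%:E).
  by apply/measurable_EFinP; exact: measurable_funX.
have mf2 : measurable_fun setT (fun x => (f x ^+ 2)%:E).
  by apply/measurable_EFinP; exact: measurable_funX.
apply: (@le_trans _ _ (2 * \int[mu]_x `|k x * f x|)).
  by rewrite ler_pM2l// le_normr_Rintegral.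
have inkf : mu.-integrable setT (EFin \o (fun x => `|k x * f x|)).
  by have := integrable_abse ikf; apply: eq_integrable.
rewrite -RintegralZl// -lee_fin -EFin_Rintegral; last exact: integrable_EFinZ.
apply: (@le_trans _ _ (\int[mu]_x (c%:E * (k x ^+ 2)%:E + (c^-1)%:E * (f x ^+ 2)%:E))%E).
  apply: le_integral_nonmeas => x; first by rewrite lee_fin mulr_ge0.
  rewrite -!EFinM -EFinD lee_fin normrM.
  rewrite -(real_normK (num_real (k x))) -(real_normK (num_real (f x))).
  have := sqr_ge0 (c * `|k x| - `|f x|) => h.
  rewrite -(@ler_pM2l _ c)// mulrDr [c * (c^-1 * _)]mulVKf ?gt_eqF//.
  by move: h; nra.
rewrite ge0_integralD//; last 4 first.
- by move=> x _; rewrite -EFinM lee_fin mulr_ge0 ?sqr_ge0// ltW.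
- exact: measurable_funeM.
- by move=> x _; rewrite -EFinM lee_fin mulr_ge0 ?sqr_ge0// invr_ge0 ltW.
- exact: measurable_funeM.
rewrite !ge0_integralZl//; last 4 first.
- by move=> x _; rewrite lee_fin sqr_ge0.
- by rewrite lee_fin invr_ge0 ltW.
- by move=> x _; rewrite lee_fin sqr_ge0.
- by rewrite lee_fin ltW.
rewrite EFinD !EFinM; apply: leeD; apply: lee_wpmul2l => //; rewrite lee_fin ?invr_ge0 ltW//.
Qed.

End cauchy_schwarz.

(** * Integration against the noisy empirical measure, fibre by fibre *)

Section empirical_integral.
Context {R : realType} {d : nat}.
Local Notation V := 'rV[R]_d.
Local Notation gamma := (std_gaussian d : probability V R).
Variable s : seq V.
Local Notation n := (size s).
Local Notation nu := (noisy_empirical s).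

Lemma measurable_pair_cst disp1 disp2 (T1 : measurableType disp1)
  (T2 : measurableType disp2) (x : T1) : measurable_fun setT (fun z : T2 => (x, z)).
Proof. by apply: measurable_fun_pair => //; exact: measurable_cst. Qed.

Lemma noisy_empirical_sum (A : set (V * V)) : measurable A ->
  nu A = ((n%:R^-1)%:E * \sum_(j < n) gamma [set z | A (s`_j, z)])%E.
Proof.
move=> mA.
have w0 : 0 <= n%:R^-1 :> R by rewrite invr_ge0.
pose w : {nonneg R} := NngNum w0.
transitivity (\int[mscale w (msum (fun k => \d_(s`_k)) n)]_x
  (gamma \o xsection A) x)%E; first by [].
have mg : measurable_fun setT (gamma \o xsection A) by exact: measurable_fun_xsection.
rewrite ge0_integral_mscale//=.
rewrite ge0_integral_measure_sum//; congr (_ * _)%E; apply: eq_bigr => j _.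
rewrite integral_dirac// diracT mul1e /=; congr (gamma _).
by apply/seteqP; split => z /=; rewrite /xsection /= inE.
Qed.

Import HBNNSimple.

(** The product measure is the average of the images of the Gaussian law under $z\mapsto(x_j,z)$. *)
Lemma ge0_integral_noisy_empirical (F : V * V -> \bar R) : measurable_fun setT F ->
  (forall p, 0 <= F p)%E ->
  (\int[nu]_p F p = (n%:R^-1)%:E * \sum_(j < n) \int[gamma]_z F (s`_j, z))%E.
Proof.
move=> mF F0.
pose f k (z : V) : V * V := (s`_k, z).
have mf k : measurable_fun setT (f k) by exact: measurable_pair_cst.
pose f' k : {mfun V >-> (V * V)%type} :=
  HB.pack (f k) (isMeasurableFun.Build _ _ _ _ (f k) (mf k)).
have w0 : 0 <= n%:R^-1 :> R by rewrite invr_ge0.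
pose m := mscale (NngNum w0) (msum (fun k => distribution gamma (f' k)) n).
rewrite (@eq_measure_integral _ _ _ setT m); last first.
  by move=> A mA _; rewrite noisy_empirical_sum.
rewrite /m ge0_integral_mscale// ge0_integral_measure_sum//; congr (_ * _)%E.
apply: eq_bigr => j _; rewrite ge0_integral_distribution//.
Qed.

(** Without measurability of [F] only this inequality is claimed, which is enough for images under
    the operators: the exact formula is applied to the simple functions below [F]. *)
Lemma integral_noisy_empirical_le (F : V * V -> \bar R) : (forall p, 0 <= F p)%E ->
  (\int[nu]_p F p <= (n%:R^-1)%:E * \sum_(j < n) \int[gamma]_z F (s`_j, z))%E.
Proof.
move=> F0; rewrite ge0_integralTE//; apply: ub_ereal_sup => _ [phi phiF <-].
have -> : sintegral nu phi = (\int[nu]_x (phi x)%:E)%E.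
  by rewrite integral_nnsfun// patch_setT.
rewrite ge0_integral_noisy_empirical//; last 2 first.
- exact/measurable_EFinP.
- by move=> p; rewrite lee_fin.
apply: lee_wpmul2l => //; apply: lee_sum => j _.
by apply: le_integral_nonmeas => z; [rewrite lee_fin|exact: phiF].
Qed.

Lemma Rintegral_noisy_empirical (G : V * V -> R) : measurable_fun setT G ->
  (forall j : 'I_n, gamma.-integrable setT (EFin \o (fun z => G (s`_j, z)))) ->
  \int[nu]_p G p = n%:R^-1 * \sum_(j < n) \int[gamma]_z G (s`_j, z).
Proof.
move=> mG iG.
have mGe : measurable_fun setT (EFin \o G) by exact/measurable_EFinP.
have part (F : V * V -> \bar R) : measurable_fun setT F -> (forall p, 0 <= F p)%E ->
    (forall j : 'I_n, gamma.-integrable setT (fun z => F (s`_j, z))) ->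
    (\int[nu]_p F p = (n%:R^-1 * \sum_(j < n) fine (\int[gamma]_z F (s`_j, z)))%:E)%E.
  move=> mF F0 iF; rewrite ge0_integral_noisy_empirical// EFinM -sumEFin.
  congr (_ * _)%E; apply: eq_bigr => j _; rewrite fineK//; exact: integrable_fin_num.
have RE (j : 'I_n) : \int[gamma]_z G (s`_j, z) =
    fine (\int[gamma]_z ((EFin \o G)^\+ (s`_j, z))%E) -
    fine (\int[gamma]_z ((EFin \o G)^\- (s`_j, z))%E).
  have iP := integrable_funepos measurableT (iG j).
  have iN := integrable_funeneg measurableT (iG j).
  have fP := integrable_fin_num measurableT iP.
  have fN := integrable_fin_num measurableT iN.
  rewrite [LHS]/Rintegral integralE (fineB fP fN).
  by congr (fine _ - fine _); apply: eq_integral => z _; rewrite ?funeposE ?funenegE.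
rewrite [LHS]/Rintegral integralE !part//.
- rewrite -EFinB /= -mulrBr -sumrB; congr (_ * _); apply: eq_bigr => j _.
  by rewrite RE.
- exact: measurable_funeneg.
- by move=> j; have := integrable_funeneg measurableT (iG j); apply: eq_integrable => // z _; rewrite !funenegE.
- exact: measurable_funepos.
- by move=> j; have := integrable_funepos measurableT (iG j); apply: eq_integrable => // z _; rewrite !funeposE.
Qed.

End empirical_integral.

(** * Exponential moments of the inner product of two noised points *)

Section exponential_kernel.
Context {R : realType} {d : nat}.
Local Notation V := 'rV[R]_d.
Local Notation gamma := (std_gaussian d : probability V R).

(* The moment generating function of [dotp u (b + sigma *: z) - c] over a Gaussian
   [z], at [lam] and [- lam], with [sigma] replaced by [1]. *)
Definition exp_side (lam : R) (b : V) (c : R) (u : V) : R :=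
  expR (lam * (dotp u b - c) + lam ^+ 2 * dotp u u / 2).

Definition exp_bound (lam : R) (b : V) (c : R) (u : V) : R :=
  exp_side lam b c u + exp_side (- lam) b c u.

Lemma exp_bound_ge0 lam b c u : 0 <= exp_bound lam b c u.
Proof. by rewrite addr_ge0 ?expR_ge0. Qed.

Lemma measurable_exp_side lam b c disp (T : measurableType disp) (f : T -> V) :
  measurable_fun setT f -> measurable_fun setT (fun w => exp_side lam b c (f w)).
Proof.
move=> mf; rewrite /exp_side; apply: measurableT_comp => //; apply: measurable_funD.
  apply: measurable_funM => //; apply: measurable_funB => //.
  by apply: measurable_dotp.
by apply: measurable_funM => //; apply: measurable_funM => //; exact: measurable_dotp.
Qed.

Lemma measurable_exp_bound lam b c disp (T : measurableType disp) (f : T -> V) :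
  measurable_fun setT f -> measurable_fun setT (fun w => exp_bound lam b c (f w)).
Proof. by move=> mf; apply: measurable_funD; exact: measurable_exp_side. Qed.

Lemma expR_abs_le (lam y : R) :
  expR (lam * `|y|) <= expR (lam * y) + expR (- lam * y).
Proof.
have [y0|y0] := leP 0 y; first by rewrite ger0_norm// lerDl expR_ge0.
by rewrite ltr0_norm// mulrN mulNr lerDr expR_ge0.
Qed.

Lemma integral_exp_side (sig lam c : R) (b u : V) : 0 <= sig <= 1 ->
  (\int[gamma]_z (expR (lam * (dotp u (b + sig *: z) - c)))%:E <=
   (exp_side lam b c u)%:E)%E.
Proof.
move=> /andP[s0 s1].
under eq_integral => z _.
  rewrite (_ : lam * _ = lam * (dotp u b - c) + dotp ((lam * sig) *: u) z); last first.
    by rewrite dotpDr dotpZr dotpZl; ring.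
  rewrite expRD EFinM; over.
rewrite ge0_integralZl//; last by apply/measurable_EFinP; exact: measurable_expR_dotp.
rewrite std_gaussian_mgf -EFinM -expRD lee_fin ler_expR lerD2l ler_pM2r//.
rewrite dotpZl dotpZr mulrA; apply: ler_wpM2r; first exact: dotp_ge0.
rewrite (_ : lam * sig * (lam * sig) = lam ^+ 2 * sig ^+ 2); last by ring.
by apply: ler_piMr; [exact: sqr_ge0|exact: exprn_ile1].
Qed.

Lemma integral_exp_bound (sig lam c : R) (b u : V) : 0 <= sig <= 1 ->
  (\int[gamma]_z (expR (lam * `|dotp u (b + sig *: z) - c|))%:E <=
   (exp_bound lam b c u)%:E)%E.
Proof.
move=> s01.
have mE (l : R) : measurable_fun setT (fun z : V => (expR (l * (dotp u (b + sig *: z) - c)))%:E).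
  apply/measurable_EFinP; apply: measurableT_comp => //; apply: measurable_funM => //.
  apply: measurable_funB => //; apply: measurable_dotp => //.
  by apply: measurable_rVD => //; exact: measurable_rVZ.
apply: (@le_trans _ _ (\int[gamma]_z ((expR (lam * (dotp u (b + sig *: z) - c)))%:E +
    (expR (- lam * (dotp u (b + sig *: z) - c)))%:E))%E).
  apply: le_integral_nonmeas => z; first by rewrite lee_fin expR_ge0.
  by rewrite -EFinD lee_fin expR_abs_le.
rewrite ge0_integralD// /exp_bound EFinD.
by apply: leeD; exact: integral_exp_side.
Qed.

Variables (C M : R).
Hypotheses (C1 : 1 <= C) (M1 : 1 <= M).

(** [Q] bounds the two quantities left by [light_tailed_quad], $\lambda^2|b|^2$ and $\lambda^2Md$.
    It will be $4M$, independent of $d$; [e] is a sign and [sig] a contraction. *)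
Lemma exp_quad_le (mu : probability V R) (lam Q : R) (b : V) : light_tailed mu C M ->
  lam ^+ 2 <= (8 * C)^-1 -> lam ^+ 2 * dotp b b <= Q -> lam ^+ 2 * M * d%:R <= Q ->
  forall e sig : R, e ^+ 2 = 1 -> 0 <= sig <= 1 ->
  (\int[mu]_x (expR (dotp ((e * lam * sig) *: b) x + lam ^+ 2 * dotp x x))%:E <=
   (expR (4 * C * Q))%:E)%E.
Proof.
move=> lt_mu lamC bQ dQ e sig e2 /andP[s0 s1].
have C1' := C1.
have C0 : 0 < C by lra.
have k01 : 0 <= lam ^+ 2 <= (8 * C)^-1 by rewrite sqr_ge0.
apply: (le_trans (light_tailed_quad _ C0 lt_mu k01)); rewrite lee_fin.
have Q0 : 0 <= Q by apply: le_trans bQ; rewrite mulr_ge0 ?sqr_ge0// dotp_ge0.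
have E1 : expR (2 * C * dotp ((e * lam * sig) *: b) ((e * lam * sig) *: b)) <= expR (4 * C * Q).
  rewrite ler_expR dotpZl dotpZr.
  apply: (@le_trans _ _ (2 * C * Q)); last by rewrite ler_wpM2r//; lra.
  rewrite ler_wpM2l//; first by lra.
  apply: le_trans bQ; rewrite mulrA; apply: ler_wpM2r; first exact: dotp_ge0.
  rewrite (_ : e * lam * sig * (e * lam * sig) = e ^+ 2 * (lam ^+ 2 * sig ^+ 2)); last by ring.
  by rewrite e2 mul1r ler_piMr ?sqr_ge0// exprn_ile1.
have E2 : expR (4 * lam ^+ 2 * M * d%:R) <= expR (4 * C * Q).
  rewrite ler_expR (_ : 4 * lam ^+ 2 * M * d%:R = 4 * (lam ^+ 2 * M * d%:R)); last by ring.
  rewrite -(mulrA 4) ler_wpM2l//.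
  by apply: (le_trans dQ); rewrite ler_peMl.
lra.
Qed.

Lemma integral_exp_bound_std (sig lam c Q : R) (a b : V) : 0 <= sig <= 1 -> 0 <= lam ->
  lam ^+ 2 <= (8 * C)^-1 -> lam ^+ 2 * dotp a a <= Q -> lam ^+ 2 * dotp b b <= Q ->
  lam ^+ 2 * M * d%:R <= Q -> lam * `|dotp a b - c| <= 2 ->
  (\int[gamma]_z (exp_bound lam b c (a + sig *: z))%:E <=
   (2 * expR (2 + 5 * C * Q))%:E)%E.
Proof.
move=> s01 lam0 lamC aQ bQ dQ abc.
have side (e : R) : e ^+ 2 = 1 ->
    (\int[gamma]_z (exp_side (e * lam) b c (a + sig *: z))%:E <= (expR (2 + 5 * C * Q))%:E)%E.
  move=> e2.
  have e1 : `|e| = 1 by apply/eqP; rewrite -sqr_norm_eq1 ?e2.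
  apply: (@le_trans _ _ (\int[gamma]_z ((expR (2 + Q))%:E *
      (expR (dotp ((e * lam * sig) *: b) z + lam ^+ 2 * dotp z z))%:E))%E).
    apply: le_integral_nonmeas => z; first by rewrite lee_fin expR_ge0.
    rewrite -EFinM -expRD lee_fin ler_expR.
    rewrite dotpDl !dotpZl (dotpC z b) exprMn e2 mul1r.
    have h1 : e * lam * (dotp a b - c) <= 2.
      apply: le_trans (ler_norm _) _; rewrite !normrM e1 mul1r (ger0_norm lam0)//.
    have h2 : dotp (a + sig *: z) (a + sig *: z) <= 2 * dotp a a + 2 * dotp z z.
      apply: (le_trans (dotpD_le _ _)); rewrite lerD2l ler_wpM2l// dotpZl dotpZr mulrA.
      rewrite ler_piMl ?dotp_ge0//; case/andP: s01 => s0 s1.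
      by rewrite mulr_ile1.
    have h3 : lam ^+ 2 * dotp (a + sig *: z) (a + sig *: z) <=
        lam ^+ 2 * (2 * dotp a a + 2 * dotp z z) by rewrite ler_wpM2l ?sqr_ge0.
    rewrite [leLHS](_ : _ = e * lam * (dotp a b - c) + e * lam * sig * dotp b z +
      lam ^+ 2 * dotp (a + sig *: z) (a + sig *: z) / 2); last by ring.
    move: aQ h1 h3; move: (dotp a a) (dotp (a + sig *: z) (a + sig *: z)) => A B.
    lra.
  rewrite ge0_integralZl//; last by apply/measurable_EFinP; exact: measurable_expR_quad.
  apply: le_trans (lee_wpmul2l _ (exp_quad_le (std_gaussian_light_tailed d C1 M1) lamC bQ dQ e2 s01)) _.
    by rewrite lee_fin expR_ge0.
  rewrite -EFinM -expRD lee_fin ler_expR -addrA lerD2l.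
  have C1' := C1.
  have Q0 : 0 <= Q by apply: le_trans bQ; rewrite mulr_ge0 ?sqr_ge0// dotp_ge0.
  have : 1 * Q <= C * Q by rewrite ler_wpM2r.
  lra.
have ms l : measurable_fun setT (fun z : V => (exp_side l b c (a + sig *: z))%:E).
  apply/measurable_EFinP; apply: measurable_exp_side.
  by apply: measurable_rVD => //; exact: measurable_rVZ.
under eq_integral do rewrite EFinD.
rewrite ge0_integralD//; last 2 first.
- by move=> z _; rewrite lee_fin expR_ge0.
- by move=> z _; rewrite lee_fin expR_ge0.
rewrite mulr2n mulrDl mul1r EFinD; apply: leeD.
  by have := side 1 (expr1n _ _); rewrite mul1r.
by have := side (-1) (sqrr_sign _ 1); rewrite mulN1r.
Qed.

(** This is the case of a fresh point. Once $|\rho x+\sigma z|^2$ is bounded by $2|x|^2+2|z|^2$, the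
    integrand is a product of functions of $x$ and of $z$, and Tonelli leaves two factors
    $e^{4CQ}$. *)
Lemma integral_exp_bound_noisy (mu : probability V R) (rh sig lam Q : R) (b : V) :
  light_tailed mu C M ->
  0 <= rh <= 1 -> 0 <= sig <= 1 ->
  lam ^+ 2 <= (8 * C)^-1 -> lam ^+ 2 * dotp b b <= Q ->
  lam ^+ 2 * M * d%:R <= Q ->
  (\int[(mu \x gamma)%E]_p (exp_bound lam b 0 (rh *: p.1 + sig *: p.2))%:E <=
   (2 * expR (8 * C * Q))%:E)%E.
Proof.
move=> lt_mu r01 s01 lamC bQ dQ.
have side (e : R) : e ^+ 2 = 1 ->
    (\int[(mu \x gamma)%E]_p (exp_side (e * lam) b 0 (rh *: p.1 + sig *: p.2))%:E <=
     (expR (8 * C * Q))%:E)%E.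
  move=> e2.
  pose f1 (x : V) := expR (dotp ((e * lam * rh) *: b) x + lam ^+ 2 * dotp x x).
  pose f2 (x : V) := expR (dotp ((e * lam * sig) *: b) x + lam ^+ 2 * dotp x x).
  have mf1 : measurable_fun setT f1 by exact: measurable_expR_quad.
  have mf2 : measurable_fun setT f2 by exact: measurable_expR_quad.
  apply: (@le_trans _ _ (\int[(mu \x gamma)%E]_p (f1 p.1 * f2 p.2)%:E)%E).
    apply: le_integral_nonmeas => p; first by rewrite lee_fin expR_ge0.
    rewrite lee_fin /f1 /f2 -expRD ler_expR.
    case: p => x z /=.
    rewrite dotpDl !dotpZl (dotpC x b) (dotpC z b) exprMn e2 mul1r.
    have sq (u : R) (y : V) : 0 <= u <= 1 -> dotp (u *: y) (u *: y) <= dotp y y.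
      move=> /andP[u0 u1]; rewrite dotpZl dotpZr mulrA ler_piMl ?dotp_ge0//.
      by rewrite mulr_ile1.
    have h2 : dotp (rh *: x + sig *: z) (rh *: x + sig *: z) <= 2 * dotp x x + 2 * dotp z z.
      apply: (le_trans (dotpD_le _ _)).
      by have := sq _ x r01; have := sq _ z s01; lra.
    have h3 : lam ^+ 2 * dotp (rh *: x + sig *: z) (rh *: x + sig *: z) <=
        lam ^+ 2 * (2 * dotp x x + 2 * dotp z z) by rewrite ler_wpM2l ?sqr_ge0.
    rewrite [leLHS](_ : _ = e * lam * rh * dotp b x + e * lam * sig * dotp b z +
      lam ^+ 2 * dotp (rh *: x + sig *: z) (rh *: x + sig *: z) / 2); last by ring.
    move: h3; move: (dotp (rh *: x + sig *: z) (rh *: x + sig *: z)) => B.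
    lra.
  rewrite fubini_tonelli1; last 2 first.
  - apply/measurable_EFinP; apply: measurable_funM; apply: measurableT_comp => //.
  - by move=> y; rewrite lee_fin mulr_ge0 ?expR_ge0.
  rewrite /fubini_F /=.
  under eq_integral => x _.
    under eq_integral do rewrite EFinM.
    rewrite ge0_integralZl//; last 3 first.
    - exact/measurable_EFinP.
    - by move=> y _; rewrite lee_fin expR_ge0.
    - by rewrite lee_fin expR_ge0.
    over.
  rewrite ge0_integralZr//; last 3 first.
  - exact/measurable_EFinP.
  - by move=> x _; rewrite lee_fin expR_ge0.
  - by apply: integral_ge0 => y _; rewrite lee_fin expR_ge0.
  have -> : 8 * C * Q = 4 * C * Q + 4 * C * Q by ring.
  rewrite expRD EFinM; apply: lee_pmul.
  - by apply: integral_ge0 => y _; rewrite lee_fin expR_ge0.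
  - by apply: integral_ge0 => y _; rewrite lee_fin expR_ge0.
  - exact: exp_quad_le.
  - exact: (exp_quad_le (std_gaussian_light_tailed d C1 M1)).
have ms l : measurable_fun setT (fun p : V * V => (exp_side l b 0 (rh *: p.1 + sig *: p.2))%:E).
  apply/measurable_EFinP; apply: measurable_exp_side.
  by apply: measurable_rVD; exact: measurable_rVZ.
under eq_integral do rewrite EFinD.
rewrite ge0_integralD//; last 2 first.
- by move=> z _; rewrite lee_fin expR_ge0.
- by move=> z _; rewrite lee_fin expR_ge0.
rewrite mulr2n mulrDl mul1r EFinD; apply: leeD.
  by have := side 1 (expr1n _ _); rewrite mul1r.
by have := side (-1) (sqrr_sign _ 1); rewrite mulN1r.
Qed.

End exponential_kernel.

(** * Hilbert-Schmidt bounds for a fixed sample and a fixed function *)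

Section operator_bounds.
Context {R : realType}.
Variables (h : R -> R) (Ch : R).
Hypothesis h_C3 : forall k : nat, (k < 3)%N -> forall x : R, derivable (derive1n k h) x 1.
Hypotheses (h_at0 : h 0 = 0) (h1_at0 : derive1n 1 h 0 = 1) (h2_at0 : derive1n 2 h 0 = 0).
Hypothesis Ch1 : 1 <= Ch.
Hypothesis h3_bound : forall x : R, `|derive1n 3 h x| <= Ch * expR (Ch * `|x|).
Variable t : R.
Hypothesis t_gt0 : 0 < t.

Lemma rho_itv : 0 <= rho t <= 1.
Proof. by rewrite /rho expR_ge0 -[leRHS]expR0 ler_expR oppr_le0 ltW. Qed.

Lemma sigma_itv : 0 <= sigma t <= 1.
Proof.
by rewrite /sigma sqrtr_ge0 -[leRHS]sqrtr1 ler_wsqrtr// lerBlDr lerDl expR_ge0.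
Qed.

Context {d : nat}.
Hypothesis d_gt0 : (0 < d)%N.
Local Notation V := 'rV[R]_d.
Local Notation gamma := (std_gaussian d : probability V R).

Let d0 : 0 < d%:R :> R. Proof. by rewrite ltr0n. Qed.

Lemma integral_kernel_sqr_le (phi : R -> R) (k K x0 : R) (b u : V) : 0 <= K ->
  (forall x, phi x ^+ 2 <= K * expR (k * `|x - x0|)) ->
  (\int[gamma]_z (phi (dotp u (b + sigma t *: z) / d%:R) ^+ 2)%:E <=
   (K * exp_bound (k / d%:R) b (d%:R * x0) u)%:E)%E.
Proof.
move=> K0 phiK.
apply: (@le_trans _ _ (\int[gamma]_z (K%:E *
  (expR (k / d%:R * `|dotp u (b + sigma t *: z) - d%:R * x0|))%:E))%E).
  apply: le_integral_nonmeas => z; first by rewrite lee_fin sqr_ge0.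
  rewrite -EFinM lee_fin; apply: (le_trans (phiK _)).
  rewrite (_ : k / d%:R * _ = k * `|dotp u (b + sigma t *: z) / d%:R - x0|)//.
  rewrite -mulrA; congr (_ * _).
  rewrite -[X in X * _](@gtr0_norm _ d%:R^-1) ?invr_gt0// -normrM mulrBr mulKf ?gt_eqF//.
  by rewrite mulrC.
rewrite ge0_integralZl//; last first.
  apply/measurable_EFinP; apply: measurableT_comp => //; apply: measurable_funM => //.
  apply: measurableT_comp => //; apply: measurable_funB => //; apply: measurable_dotp => //.
  by apply: measurable_rVD => //; exact: measurable_rVZ.
rewrite EFinM; apply: lee_wpmul2l; first by rewrite lee_fin.
by apply: integral_exp_bound; exact: sigma_itv.
Qed.

Let remE := remainder_sqr_le h_C3 h_at0 h1_at0 h2_at0 Ch1 h3_bound.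
Let remdE := remainder_diff_sqr_le h_C3 h1_at0 h2_at0 Ch1 h3_bound.
Let rem_cont := continuous_remainder h_C3.

Lemma measurable_remainder : measurable_fun setT (remainder h).
Proof. by apply: continuous_measurable_fun; exact: rem_cont. Qed.

Lemma measurable_noised_kernel (phi : R -> R) (b u : V) : measurable_fun setT phi ->
  measurable_fun setT (fun z : V => phi (dotp u (b + sigma t *: z) / d%:R)).
Proof.
move=> mphi; apply: measurableT_comp => //; apply: measurable_funM => //.
apply: measurable_dotp => //.
by apply: measurable_rVD => //; exact: measurable_rVZ.
Qed.

(** This bound and the next serve only integrability, so that integrals over the training law split
    into fibres. *)
Let sqr_growth (x : R) : x ^+ 2 <= 4 * expR (1 * `|x - 0|).
Proof.
rewrite subr0 -(real_normK (num_real x)).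
have := @expr_le_expR R 2 1 `|x| ltr01 (normr_ge0 x).
by rewrite expr1n invr1 mulr1 -natrX.
Qed.

Let rem_growth (x : R) :
  remainder h x ^+ 2 <= remainder_const Ch 0 * (2 * Ch) ^- 6 * expR (2 * (2 * Ch) * `|x - 0|).
Proof. by rewrite subr0; exact: remE. Qed.

Let remK_ge0 : 0 <= remainder_const Ch 0 * (2 * Ch) ^- 6.
Proof.
rewrite mulr_ge0 ?remainder_const_ge0// invr_ge0 exprn_ge0// mulr_ge0//.
by rewrite (le_trans _ Ch1).
Qed.

Variable s : seq V.
Local Notation n := (size s).
Local Notation nu := (noisy_empirical s).
Hypothesis n_gt0 : (0 < n)%N.

Let n0 : 0 < n%:R :> R. Proof. by rewrite ltr0n. Qed.

Section fixed_function.
Variable f : V * V -> R.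
Hypotheses (fL2 : f \in Lfun nu 2%:E) (f1 : ('N[nu]_2%:E [EFin \o f] <= 1)%E).

Let mf : measurable_fun setT f. Proof. by have [] := (Lfun2P _ _).1 fL2. Qed.

Let mfj j : measurable_fun setT (fun z => f (s`_j, z)).
Proof. by apply: (measurableT_comp mf); exact: measurable_pair_cst. Qed.

(** The square of the $L^2$ norm on a fibre. Only the average over the fibres is bounded by 1; a
    single value may be of order $n$. *)
Definition fibre_norm (j : 'I_n) : R := fine (\int[gamma]_z (f (s`_j, z) ^+ 2)%:E).
Local Notation F := fibre_norm.

Let sum_int_le : ((n%:R^-1)%:E * \sum_(j < n) \int[gamma]_z (f (s`_j, z) ^+ 2)%:E <= 1)%E.
Proof.
have := f1; rewrite Lnorm2_le// expr1n.
rewrite ge0_integral_noisy_empirical//.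
- by apply/measurable_EFinP; exact: measurable_funX.
- by move=> p; rewrite lee_fin sqr_ge0.
Qed.

Let int_ge0 j : (0 <= \int[gamma]_z (f (s`_j, z) ^+ 2)%:E)%E.
Proof. by apply: integral_ge0 => z _; rewrite lee_fin sqr_ge0. Qed.

Lemma fibre_normE (j : 'I_n) : (\int[gamma]_z (f (s`_j, z) ^+ 2)%:E = (F j)%:E)%E.
Proof.
rewrite fineK// ge0_fin_numE//.
have : (\sum_(j < n) \int[gamma]_z (f (s`_j, z) ^+ 2)%:E <= n%:R%:E)%E.
  have := lee_wpmul2l (_ : (0 <= n%:R%:E)%E) sum_int_le.
  by rewrite muleA -EFinM mulfV ?gt_eqF// mul1e mule1; apply; rewrite lee_fin.
rewrite (bigD1 j)//= => h'; apply: le_lt_trans (ltry n%:R).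
by apply: le_trans h'; rewrite leeDl// sume_ge0.
Qed.

Lemma fibre_norm_ge0 (j : 'I_n) : 0 <= F j.
Proof. by rewrite fine_ge0. Qed.

Lemma sum_fibre_norm : \sum_(j < n) F j <= n%:R.
Proof.
have := sum_int_le; under eq_bigr do rewrite fibre_normE.
by rewrite sumEFin -EFinM lee_fin ler_pdivrMl// mulr1.
Qed.

Let kernel_int (phi : R -> R) (k K x0 : R) (b u : V) (j : 'I_n) :
  measurable_fun setT phi -> 0 <= K ->
  (forall x, phi x ^+ 2 <= K * expR (k * `|x - x0|)) ->
  gamma.-integrable setT (EFin \o (fun z : V =>
    phi (dotp u (b + sigma t *: z) / d%:R) * f (s`_j, z))).
Proof.
move=> mphi K0 phiK; apply: integrable_mul_L2 => //.
- exact: measurable_noised_kernel.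
- exact: le_lt_trans (integral_kernel_sqr_le b u K0 phiK) (ltry _).
- by rewrite fibre_normE ltry.
Qed.

Let kernel_op_sum (phi : R -> R) (k K : R) (p : V * V) :
  measurable_fun setT phi -> 0 <= K ->
  (forall x, phi x ^+ 2 <= K * expR (k * `|x - 0|)) ->
  kernel_op t (fun x y => phi (dotp x y / d%:R)) s f p =
  n%:R^-1 * \sum_(j < n) \int[gamma]_z
    (phi (dotp (noised t p) (rho t *: s`_j + sigma t *: z) / d%:R) * f (s`_j, z)).
Proof.
move=> mphi K0 phiK; rewrite /kernel_op Rintegral_noisy_empirical//.
- apply: measurable_funM => //; apply: (measurableT_comp mphi).
  apply: measurable_funM => //; apply: measurable_dotp => //.
  exact: measurable_noised.
- move=> j; exact: (@kernel_int phi k K 0 (rho t *: s`_j) (noised t p) j mphi K0 phiK).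
Qed.

Lemma kernel_op_diff (p : V * V) :
  Kop h t s f p - Kop_eff t s f p =
  n%:R^-1 * \sum_(j < n) \int[gamma]_z
    (remainder h (dotp (noised t p) (rho t *: s`_j + sigma t *: z) / d%:R) * f (s`_j, z)).
Proof.
have hE x : h x = remainder h x + x by rewrite /remainder; ring.
(* From $(g+x)^2\le2g^2+2x^2$ and the two growth bounds, with $8=2\cdot4$. *)
pose K := 2 * (remainder_const Ch 0 * (2 * Ch) ^- 6) + 8.
have K0 : 0 <= K by rewrite addr_ge0// mulr_ge0.
have mid : measurable_fun setT (fun x : R => x) by exact: measurable_id.
have mrem := measurable_remainder.
have mh : measurable_fun setT h.
  rewrite (_ : h = fun x => remainder h x + x); last by apply/funext.
  exact: measurable_funD.
have h_growth x : h x ^+ 2 <= K * expR (2 * (2 * Ch) * `|x - 0|).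
  rewrite hE.
  have := rem_growth x; have := sqr_growth x; rewrite !subr0 => g1 g2.
  have g3 : expR (1 * `|x|) <= expR (2 * (2 * Ch) * `|x|).
    by have C1' := Ch1; rewrite ler_expR ler_wpM2r//; lra.
  have := sqr_ge0 (remainder h x - x); rewrite /K; nra.
have E1 : Kop h t s f p = _ := kernel_op_sum p mh K0 h_growth.
have E2 : Kop_eff t s f p = _ := kernel_op_sum p mid (ler0n _ 4) sqr_growth.
rewrite E1 E2 -mulrBr -sumrB; congr (_ * _).
apply: eq_bigr => j _.
rewrite -RintegralB//; last 2 first.
- exact: (@kernel_int h _ _ _ (rho t *: s`_j) (noised t p) j mh K0 h_growth).
- exact: (@kernel_int id _ _ _ (rho t *: s`_j) (noised t p) j mid (ler0n _ 4) sqr_growth).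
by apply: eq_Rintegral => z _; rewrite -mulrBl hE addrK.
Qed.

(* As [remainder h 0 = 0], [x0 = 0] gives back the plain kernel. *)
Let S (x0 : R) (u : V) (j : 'I_n) := \int[gamma]_z
  ((remainder h (dotp u (rho t *: s`_j + sigma t *: z) / d%:R) - remainder h x0) * f (s`_j, z)).

(** The subtracted constant sees [f] only through its integral over the noise, which is the form of
    the [delta] term of the effective operator. *)
Let S_sub (x0 : R) (u : V) (j : 'I_n) :
  S x0 u j = \int[gamma]_z
    (remainder h (dotp u (rho t *: s`_j + sigma t *: z) / d%:R) * f (s`_j, z)) -
    remainder h x0 * \int[gamma]_z f (s`_j, z).
Proof.
have ifj : gamma.-integrable setT (EFin \o (fun z => f (s`_j, z))).
  have c1 (x : R) : (1 : R) ^+ 2 <= 1 * expR (0 * `|x - 0|) by rewrite mul0r expR0 expr1n mulr1.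
  have := @kernel_int (cst 1) 0 1 0 0 0 j (measurable_cst _) ler01 c1.
  by apply: eq_integrable => // z _; rewrite /= mul1r.
rewrite -RintegralZl// -RintegralB//; last 2 first.
- exact: (@kernel_int _ _ _ _ (rho t *: s`_j) u j measurable_remainder remK_ge0 rem_growth).
- exact: integrable_EFinZ.
by apply: eq_Rintegral => z _; rewrite mulrBl.
Qed.

Let S_le (x0 k K : R) (u : V) (j : 'I_n) : 0 <= K ->
  (forall x, (remainder h x - remainder h x0) ^+ 2 <= K * expR (k * `|x - x0|)) ->
  S x0 u j ^+ 2 <= K * exp_bound (k / d%:R) (rho t *: s`_j) (d%:R * x0) u * F j.
Proof.
move=> K0 rK.
have mr : measurable_fun setT (fun x => remainder h x - remainder h x0).
  by apply: measurable_funB => //; exact: measurable_remainder.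
apply: integral_mul_L2_le => //.
- exact: (measurable_noised_kernel (rho t *: s`_j) u mr).
- exact: (integral_kernel_sqr_le (rho t *: s`_j) u K0 rK).
- by rewrite fibre_normE.
Qed.

Variables (C M k : R).
Hypotheses (C1 : 1 <= C) (M1 : 1 <= M) (k_ge : 4 + 2 * Ch <= k) (k_sqr : k ^+ 2 <= d%:R).
Hypothesis d_ge : 32 * C <= d%:R.
Hypothesis s_norm : forall j : 'I_n, dotp (s`_j) (s`_j) <= M * d%:R.

(** The rate $2k$ of the remainder bounds, divided by the $d$ in the argument of the kernel; [k_sqr]
    gives $\lambda^2d\le4$. *)
Let lam := 2 * k / d%:R.
Let K := remainder_const Ch M.

Let K_ge0 : 0 <= K. Proof. exact: remainder_const_ge0. Qed.

Let k_gt0 : 0 < k.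
Proof. by have C1' := Ch1; have := k_ge; lra. Qed.

Let lam_ge0 : 0 <= lam.
Proof. by rewrite divr_ge0// ?ltW// mulr_gt0. Qed.

Let lam_sqr : lam ^+ 2 <= 4 / d%:R.
Proof.
rewrite /lam expr_div_n exprMn ler_pdivrMr ?exprn_gt0// expr2 -natrM.
rewrite (_ : 4 / d%:R * d%:R ^+ 2 = 4 * d%:R); last by field; rewrite gt_eqF.
by rewrite ler_wpM2l.
Qed.

Let lam_C : lam ^+ 2 <= (8 * C)^-1.
Proof.
have C1' := C1; have C0 : 0 < 8 * C by lra.
apply: (le_trans lam_sqr); rewrite ler_pdivrMr// ler_pdivlMl//.
by have := d_ge; lra.
Qed.

Let lam_M : lam ^+ 2 * M * d%:R <= 4 * M.
Proof.
have M0 : 0 <= M by exact: le_trans M1.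
rewrite -mulrA; apply: le_trans (ler_wpM2r _ lam_sqr) _; first by rewrite mulr_ge0// ltW.
by rewrite (_ : 4 / d%:R * (M * d%:R) = 4 * M)//; field; rewrite gt_eqF.
Qed.

Let lam_s (j : 'I_n) : lam ^+ 2 * dotp (rho t *: s`_j) (rho t *: s`_j) <= 4 * M.
Proof.
apply: le_trans lam_M; rewrite -mulrA; apply: ler_wpM2l; first exact: sqr_ge0.
apply: le_trans (s_norm j); rewrite dotpZl dotpZr mulrA ler_piMl ?dotp_ge0//.
by have /andP[r0 r1] := rho_itv; rewrite mulr_ile1.
Qed.

Let off (u : V) (j : 'I_n) := K * k ^- 6 * exp_bound lam (rho t *: s`_j) 0 u.

Let off_ge0 u j : 0 <= off u j.
Proof. by rewrite mulr_ge0 ?exp_bound_ge0// mulr_ge0// invr_ge0 exprn_ge0// ltW. Qed.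

Let S0_le (u : V) (j : 'I_n) : S 0 u j ^+ 2 <= off u j * F j.
Proof.
have H (x : R) : (remainder h x - remainder h 0) ^+ 2 <= K * k ^- 6 * expR (2 * k * `|x - 0|).
  rewrite subr0 [remainder h 0]/remainder h_at0 subrr subr0; apply: remE.
    by rewrite (le_trans _ M1).
  by have := k_ge; lra.
have K6 : 0 <= K * k ^- 6 by rewrite mulr_ge0// invr_ge0 exprn_ge0// ltW.
by have := S_le u j K6 H; rewrite mulr0.
Qed.

Let S0E (u : V) (j : 'I_n) : S 0 u j = \int[gamma]_z
    (remainder h (dotp u (rho t *: s`_j + sigma t *: z) / d%:R) * f (s`_j, z)).
Proof.
by apply: eq_Rintegral => z _; rewrite [remainder h 0]/remainder h_at0 subrr subr0.
Qed.

(** Cauchy-Schwarz over the fibres: the fibre norms sum to at most $n$, which cancels one of the two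
    factors $1/n$. *)
Let sum_S0_le (Q : pred 'I_n) (u : V) :
  (n%:R^-1 * \sum_(j < n | Q j) S 0 u j) ^+ 2 <= n%:R^-1 * \sum_(j < n | Q j) off u j.
Proof.
rewrite exprMn expr2 -mulrA ler_pM2l ?invr_gt0// ler_pdivrMl//.
apply: le_trans (sqr_sum_le _ _ (off_ge0 u) fibre_norm_ge0 (S0_le u)) _.
rewrite mulrC; apply: ler_pM; rewrite ?sumr_ge0//.
- by move=> j _; exact: fibre_norm_ge0.
- apply: le_trans sum_fibre_norm.
  by rewrite [leRHS](bigID Q)/= lerDl sumr_ge0// => j _; exact: fibre_norm_ge0.
Qed.

(** With $Q=4M$ a fresh point gives the exponent $8CQ=32CM$; a training point gives $2+20CM$, which
    is smaller as $CM\ge1$. *)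
Let Kt := 2 * expR (32 * C * M).

Let Kt_ge (x : R) : x <= 32 * C * M -> 2 * expR x <= Kt.
Proof. by move=> xC; rewrite ler_wpM2l// ler_expR. Qed.

Let integral_off (disp : measure_display) (T : measurableType disp)
    (m : {measure set T -> \bar R}) (u : T -> V) (Q : pred 'I_n) : measurable_fun setT u ->
  (forall j : 'I_n, Q j -> (\int[m]_w (exp_bound lam (rho t *: s`_j) 0 (u w))%:E <= Kt%:E)%E) ->
  (\int[m]_w (n%:R^-1 * \sum_(j < n | Q j) off (u w) j)%:E <= (K * k ^- 6 * Kt)%:E)%E.
Proof.
move=> mu H.
have K6 : 0 <= K * k ^- 6 by rewrite mulr_ge0// invr_ge0 exprn_ge0// ltW.
have moff j : measurable_fun setT (fun w => (off (u w) j)%:E).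
  by apply/measurable_EFinP; apply: measurable_funM => //; exact: measurable_exp_bound.
under eq_integral do rewrite EFinM -sumEFin big_mkcond/=.
rewrite ge0_integralZl//; last 2 first.
- by apply: emeasurable_sum => j; case: (Q j).
- by move=> w _; rewrite sume_ge0// => j _; case: ifP => // _; rewrite lee_fin.
rewrite ge0_integral_sum//; last 2 first.
- by move=> j; case: (Q j).
- by move=> j w _; case: ifP => // _; rewrite lee_fin.
apply: (@le_trans _ _ ((n%:R^-1)%:E * \sum_(j < n) (K * k ^- 6 * Kt)%:E)%E).
  apply: lee_wpmul2l; first by rewrite lee_fin invr_ge0.
  apply: lee_sum => j _; have [Qj|Qj] := boolP (Q j); last first.
    by rewrite integral0 lee_fin mulr_ge0// mulr_ge0// expR_ge0.
  under eq_integral do rewrite EFinM.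
  rewrite ge0_integralZl//; last 2 first.
  - by apply/measurable_EFinP; exact: measurable_exp_bound.
  - by move=> w _; rewrite lee_fin exp_bound_ge0.
  rewrite [leRHS]EFinM; apply: lee_wpmul2l; first by rewrite lee_fin.
  exact: (H j Qj).
rewrite sumEFin -EFinM lee_fin sumr_const card_ord.
by rewrite -[X in _ * X]mulr_natl mulKf// gt_eqF.
Qed.

(** A test point is drawn afresh, so every training point acts as an off-diagonal one, and only the
    norms of the training points enter. *)
Lemma test_diff_le (mu : probability V R) : light_tailed mu C M ->
  (\int[noisy mu]_p ((Kop h t s f p - Kop_eff t s f p) ^+ 2)%:E
   <= (K * k ^- 6 * Kt)%:E)%E.
Proof.
move=> lt_mu.
apply: (@le_trans _ _ (\int[noisy mu]_p (n%:R^-1 * \sum_(j < n) off (noised t p) j)%:E)%E).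
  apply: le_integral_nonmeas => p; first by rewrite lee_fin sqr_ge0.
  rewrite lee_fin kernel_op_diff.
  by under eq_bigr do rewrite -S0E; exact: sum_S0_le.
apply: (@integral_off _ _ _ _ xpredT) => [|j _]; first exact: measurable_noised.
apply: (le_trans (integral_exp_bound_noisy C1 M1 lt_mu rho_itv sigma_itv lam_C (lam_s j) lam_M)).
by rewrite lee_fin; apply: Kt_ge; rewrite le_eqVlt; apply/orP; left; apply/eqP; ring.
Qed.

Variable Sigma : 'M[R]_d.
Hypotheses (tr_ge0 : 0 <= \tr Sigma) (tr_le : \tr Sigma <= M * d%:R).
Hypothesis s_diag : forall i : 'I_n, `|dotp (s`_i) (s`_i) - \tr Sigma| <= d%:R / k.
Hypothesis s_off : forall i j : 'I_n, i != j -> `|dotp (s`_i) (s`_j)| <= d%:R / k.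

Let x0 := rho t ^+ 2 * (\tr Sigma / d%:R).

Let x0_le : `|x0| <= M.
Proof.
have /andP[r0 r1] := rho_itv.
have x00 : 0 <= x0.
  by apply: mulr_ge0; [exact: sqr_ge0|apply: divr_ge0 => //; exact: ltW].
rewrite (ger0_norm x00).
apply: (@le_trans _ _ (1 * (\tr Sigma / d%:R))).
  by rewrite ler_wpM2r ?exprn_ile1// mulr_ge0// invr_ge0 ltW.
by rewrite mul1r ler_pdivrMr.
Qed.

Let diag (u : V) (j : 'I_n) := K * k ^- 2 * exp_bound lam (rho t *: s`_j) (d%:R * x0) u.

Let diag_ge0 u j : 0 <= diag u j.
Proof. by rewrite mulr_ge0 ?exp_bound_ge0// mulr_ge0// invr_ge0 exprn_ge0// ltW. Qed.

Let Sd_le (u : V) (j : 'I_n) : S x0 u j ^+ 2 <= diag u j * F j.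
Proof.
have H (x : R) : (remainder h x - remainder h x0) ^+ 2 <= K * k ^- 2 * expR (2 * k * `|x - x0|).
  exact: remdE.
have K2 : 0 <= K * k ^- 2 by rewrite mulr_ge0// invr_ge0 exprn_ge0// ltW.
exact: S_le u j K2 H.
Qed.

(** [delta] is the remainder at [x0] divided by $n$, so it recentres exactly the diagonal term; the
    other terms keep the centre 0. *)
Let train_diffE (i : 'I_n) (z : V) (u := noised t (s`_i, z)) :
  Khat h t s f (s`_i, z) - Khat_eff h t Sigma s f (s`_i, z) =
  n%:R^-1 * \sum_(j < n | j != i) S 0 u j + n%:R^-1 * S x0 u i.
Proof.
have E : Khat h t s f (s`_i, z) - kernel_op t (@linear_kernel R d) s f (s`_i, z) =
    n%:R^-1 * \sum_(j < n) S 0 u j.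
  apply: (etrans (kernel_op_diff (s`_i, z))); congr (_ * _).
  by apply: eq_bigr => j _; rewrite S0E.
have dE : delta h t Sigma n = n%:R^-1 * remainder h x0 by rewrite mulrC.
rewrite /Khat_eff opprD addrA E dE (bigD1 i)//= (S_sub x0) -S0E; ring.
Qed.

(** Cauchy-Schwarz across fibres would lose a factor on the diagonal: as a single fibre, it keeps
    its full weight $n^{-2}$ and its own fibre norm. *)
Let train_pointwise (i : 'I_n) (z : V) (u := noised t (s`_i, z)) :
  (Khat h t s f (s`_i, z) - Khat_eff h t Sigma s f (s`_i, z)) ^+ 2 <=
  2 * (n%:R^-1 * \sum_(j < n | j != i) off u j) + 2 * (n%:R^-1 ^+ 2 * F i) * diag u i.
Proof.
rewrite train_diffE -/u.
set a := n%:R^-1 * \sum_(j < n | j != i) S 0 u j; set b := n%:R^-1 * S x0 u i.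
have ha : a ^+ 2 <= n%:R^-1 * \sum_(j < n | j != i) off u j by exact: sum_S0_le.
have hb : b ^+ 2 <= n%:R^-1 ^+ 2 * F i * diag u i.
  by rewrite exprMn -mulrA ler_wpM2l ?sqr_ge0// mulrC; exact: Sd_le.
have := sqr_ge0 (a - b); rewrite -[2 * (_ * F i) * _]mulrA; lra.
Qed.

(** The bound for the row [i] contains the uncontrolled number $F_i$, but linearly, and averaging
    over [i] replaces it by at most 1. *)
Lemma train_diff_le :
  (\int[nu]_p ((Khat h t s f p - Khat_eff h t Sigma s f p) ^+ 2)%:E
   <= (2 * K * Kt * (k ^- 6 + n%:R ^- 2 * k ^- 2))%:E)%E.
Proof.
have /andP[r0 r1] := rho_itv; have /andP[sg0 sg1] := sigma_itv.
have C1' := C1; have M1' := M1.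
have CM1 : 1 <= C * M by rewrite -[leLHS]mulr1 ler_pM.
apply: (le_trans (integral_noisy_empirical_le _ _)).
  by move=> p; rewrite lee_fin sqr_ge0.
have mu i : measurable_fun setT (fun z : V => noised t (s`_i, z)).
  by apply: (measurableT_comp (measurable_noised t)); exact: measurable_pair_cst.
have arith : 2 + 5 * C * (4 * M) <= 32 * C * M.
  rewrite (_ : 5 * C * (4 * M) = 20 * (C * M)); last by ring.
  by rewrite -(mulrA 32); lra.
have close (i j : 'I_n) c : `|dotp (rho t *: s`_i) (rho t *: s`_j) - c| <= d%:R / k ->
    (\int[gamma]_z (exp_bound lam (rho t *: s`_j) c (noised t (s`_i, z)))%:E <= Kt%:E)%E.
  move=> hc.
  (* The deviation $d/k$ is matched to the rate: $\lambda d/k=2$. *)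
  have hl : lam * `|dotp (rho t *: s`_i) (rho t *: s`_j) - c| <= 2.
    apply: le_trans (ler_wpM2l lam_ge0 hc) _.
    by rewrite /lam le_eqVlt; apply/orP; left; apply/eqP; field; rewrite !gt_eqF.
  apply: (le_trans (integral_exp_bound_std C1 M1 sigma_itv lam_ge0 lam_C (lam_s i) (lam_s j) lam_M hl)).
  by rewrite lee_fin; exact: Kt_ge.
have row (i : 'I_n) :
    (\int[gamma]_z ((Khat h t s f (s`_i, z) - Khat_eff h t Sigma s f (s`_i, z)) ^+ 2)%:E <=
     (2 * K * Kt * k ^- 6 + 2 * K * Kt * (n%:R ^- 2 * k ^- 2) * F i)%:E)%E.
  have mo (c : R) : measurable_fun setT (fun z : V =>
      (exp_bound lam (rho t *: s`_i) c (noised t (s`_i, z)))%:E).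
    by apply/measurable_EFinP; apply: measurable_exp_bound.
  apply: (@le_trans _ _ (\int[gamma]_z (2%:E *
      (n%:R^-1 * \sum_(j < n | j != i) off (noised t (s`_i, z)) j)%:E +
      (2 * (n%:R^-1 ^+ 2 * F i) * (K * k ^- 2))%:E *
      (exp_bound lam (rho t *: s`_i) (d%:R * x0) (noised t (s`_i, z)))%:E))%E).
    apply: le_integral_nonmeas => z; first by rewrite lee_fin sqr_ge0.
    rewrite -!EFinM -EFinD lee_fin; apply: le_trans (train_pointwise i z) _.
    by rewrite lerD2l le_eqVlt /diag; apply/orP; left; apply/eqP; ring.
  have c2 : 0 <= 2 * (n%:R^-1 ^+ 2 * F i) * (K * k ^- 2).
    apply: mulr_ge0.
      by apply: mulr_ge0 => //; apply: mulr_ge0; [exact: sqr_ge0|exact: fibre_norm_ge0].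
    by apply: mulr_ge0 => //; rewrite invr_ge0 exprn_ge0// ltW.
  have so z : 0 <= n%:R^-1 * \sum_(j < n | j != i) off (noised t (s`_i, z)) j.
    by rewrite mulr_ge0 ?invr_ge0// sumr_ge0.
  have mso : measurable_fun setT (fun z : V =>
      (n%:R^-1 * \sum_(j < n | j != i) off (noised t (s`_i, z)) j)%:E).
    apply/measurable_EFinP; apply: measurable_funM => //.
    under eq_fun do rewrite big_mkcond/=.
    apply: measurable_sum => j; case: (j != i) => //; apply: measurable_funM => //.
    exact: measurable_exp_bound.
  rewrite ge0_integralD//; last 4 first.
  - by move=> z _; rewrite -EFinM lee_fin mulr_ge0.
  - exact: measurable_funeM.
  - by move=> z _; rewrite -EFinM lee_fin mulr_ge0// exp_bound_ge0.
  - exact: measurable_funeM.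
  rewrite ge0_integralZl//; last by move=> z _; rewrite lee_fin.
  rewrite ge0_integralZl//; last by move=> z _; rewrite lee_fin exp_bound_ge0.
  have i2 : (\int[gamma]_z (exp_bound lam (rho t *: s`_i) (d%:R * x0) (noised t (s`_i, z)))%:E <= Kt%:E)%E.
    apply: close; rewrite dotpZl dotpZr /x0.
    rewrite (_ : _ - _ = rho t ^+ 2 * (dotp (s`_i) (s`_i) - \tr Sigma)); last first.
      by field; rewrite gt_eqF.
    rewrite normrM; apply: le_trans (s_diag i); rewrite ler_piMl// ger0_norm ?sqr_ge0//.
    exact: exprn_ile1.
  rewrite [leRHS]EFinD; apply: leeD.
    have -> : 2 * K * Kt * k ^- 6 = 2 * (K * k ^- 6 * Kt) by ring.
    rewrite [leRHS]EFinM; apply: lee_wpmul2l; first by rewrite lee_fin.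
    apply: (@integral_off _ _ gamma _ (fun j => j != i) (mu i)) => j ji.
    apply: close; rewrite dotpZl dotpZr subr0 mulrA normrM.
    apply: le_trans (s_off _ : _ <= d%:R / k); last by rewrite eq_sym; exact: ji.
    by rewrite ler_piMl// ger0_norm ?mulr_ge0// mulr_ile1.
  have -> : 2 * K * Kt * (n%:R ^- 2 * k ^- 2) * F i =
      2 * (n%:R^-1 ^+ 2 * F i) * (K * k ^- 2) * Kt by rewrite exprVn; ring.
  by rewrite [leRHS]EFinM; apply: lee_wpmul2l; rewrite ?lee_fin.
apply: (@le_trans _ _ ((n%:R^-1)%:E * \sum_(j < n)
    (2 * K * Kt * k ^- 6 + 2 * K * Kt * (n%:R ^- 2 * k ^- 2) * F j)%:E)%E).
  by apply: lee_wpmul2l; rewrite ?lee_fin ?invr_ge0//; apply: lee_sum => i _; exact: row.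
rewrite sumEFin -EFinM lee_fin big_split/= -mulr_sumr sumr_const card_ord.
have sumF : n%:R^-1 * \sum_(j < n) F j <= 1.
  by rewrite ler_pdivrMl// mulr1 sum_fibre_norm.
have nE (x : R) : n%:R^-1 * (x *+ n) = x by rewrite -[x *+ n]mulr_natl mulKf// gt_eqF.
set A := 2 * K * Kt; set B := n%:R ^- 2 * k ^- 2.
suff : n%:R^-1 * (A * (k ^- 6 *+ n) + \sum_(j < n) A * B * F j) <= A * (k ^- 6 + B) by [].
rewrite -mulr_sumr mulrDr [X in X + _]mulrCA nE [leRHS]mulrDr lerD2l mulrCA -[leRHS]mulr1.
apply: ler_wpM2l sumF; apply: mulr_ge0.
  by apply: mulr_ge0; [exact: mulr_ge0|rewrite mulr_ge0// expR_ge0].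
by apply: mulr_ge0; rewrite invr_ge0 exprn_ge0// ltW.
Qed.

End fixed_function.

End operator_bounds.

(** * From integral bounds to operator norms *)

Section operator_norms.
Context {R : realType}.

Lemma opnorm_le d1 (T1 : measurableType d1) d2 (T2 : measurableType d2)
    (mu : {measure set T1 -> \bar R}) (nu : {measure set T2 -> \bar R})
    (T : (T1 -> R) -> T2 -> R) (c : R) : 0 <= c ->
  (forall f, f \in Lfun mu 2%:E -> ('N[mu]_2%:E [EFin \o f] <= 1)%E ->
     (\int[nu]_x (T f x ^+ 2)%:E <= (c ^+ 2)%:E)%E) ->
  (opnorm mu nu T <= c%:E)%E.
Proof.
move=> c0 H; apply: ub_ereal_sup => _ [f [fL fN] <-].
by rewrite Lnorm2_le//; exact: H.
Qed.

Lemma light_tailed_mono d (mu : probability 'rV[R]_d R) (C M M' : R) : M <= M' ->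
  light_tailed mu C M -> light_tailed mu C M'.
Proof.
move=> MM' [lin sqr]; split => // k k01; apply: (le_trans (sqr k k01)).
by rewrite lee_fin ler_expR ler_wpM2r// ler_wpM2l// mulr_ge0//; case/andP: k01.
Qed.

Variables (h : R -> R) (Ch : R).
Hypothesis h_C3 : forall k : nat, (k < 3)%N -> forall x : R, derivable (derive1n k h) x 1.
Hypotheses (h_at0 : h 0 = 0) (h1_at0 : derive1n 1 h 0 = 1) (h2_at0 : derive1n 2 h 0 = 0).
Hypothesis Ch1 : 1 <= Ch.
Hypothesis h3_bound : forall x : R, `|derive1n 3 h x| <= Ch * expR (Ch * `|x|).
Variable t : R.
Hypothesis t_gt0 : 0 < t.

Definition error_const (C M : R) : R := 2 * remainder_const Ch M * (2 * expR (32 * C * M)).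

Lemma error_const_ge0 C M : 0 <= error_const C M.
Proof.
apply: mulr_ge0; last by rewrite mulr_ge0// expR_ge0.
by apply: mulr_ge0 => //; exact: remainder_const_ge0.
Qed.

(** A deterministic statement: the sample enters through the three hypotheses on [X i w], which hold
    off the exceptional event. *)
Lemma sample_error_le d n Omega (X : 'I_n -> Omega -> 'rV[R]_d) (w : Omega)
    (mu : probability 'rV[R]_d R) (Sigma : 'M[R]_d) (C M k c : R) :
  (0 < d)%N -> (0 < n)%N -> 1 <= C -> 1 <= M -> 4 + 2 * Ch <= k ->
  k ^+ 2 <= d%:R -> 32 * C <= d%:R -> light_tailed mu C M ->
  0 <= \tr Sigma -> \tr Sigma <= M * d%:R ->
  (forall i, dotp (X i w) (X i w) <= M * d%:R) ->
  (forall i, `|dotp (X i w) (X i w) - \tr Sigma| <= d%:R / k) ->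
  (forall i j, i != j -> `|dotp (X i w) (X j w)| <= d%:R / k) ->
  0 <= c -> error_const C M * (k ^- 6 + n%:R ^- 2 * k ^- 2) <= c ^+ 2 ->
  (maxe (train_error h t Sigma (sample X w)) (test_error h t mu (sample X w)) <= c%:E)%E.
Proof.
move=> d0 n0 C1 M1 kC kd dC lt_mu tr0 trM XM Xd Xo c0 Ac.
have sz : size (sample X w) = n by rewrite size_map size_enum_ord.
have nthE (j : 'I_(size (sample X w))) :
    (sample X w)`_j = X (cast_ord sz j) w.
  have jn : (j < n)%N by rewrite -[X in (_ < X)%N]sz.
  rewrite (nth_map (cast_ord sz j)) ?size_enum_ord//.
  by congr (X _ w); apply: val_inj; rewrite /= nth_enum_ord.
have s0 : (0 < size (sample X w))%N by rewrite sz.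
have sM (j : 'I_(size (sample X w))) :
    dotp ((sample X w)`_j) ((sample X w)`_j) <= M * d%:R by rewrite nthE.
have Ch1' := Ch1; have k0 : 0 < k by lra.
have k6 : 0 <= k ^- 6 by rewrite invr_ge0 exprn_ge0// ltW.
have k2 : 0 <= n%:R ^- 2 * k ^- 2.
  by apply: mulr_ge0; rewrite invr_ge0 exprn_ge0// ltW.
rewrite ge_max; apply/andP; split; apply: opnorm_le => // f fL fN.
- apply: (le_trans (train_diff_le h_C3 h_at0 h1_at0 h2_at0 Ch1 h3_bound t_gt0 d0 s0 fL fN
    C1 M1 kC kd dC sM tr0 trM _ _)).
  + by move=> i; rewrite nthE.
  + by move=> i j ij; rewrite !nthE; apply: Xo; apply: contra ij => /eqP/cast_ord_inj ->.
  + by rewrite sz lee_fin.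
- apply: (le_trans (test_diff_le h_C3 h_at0 h1_at0 h2_at0 Ch1 h3_bound t_gt0 d0 s0 fL fN
    C1 M1 kC kd dC sM lt_mu)).
  rewrite lee_fin; apply: le_trans Ac.
  have := error_const_ge0 C M; rewrite /error_const.
  set K := remainder_const _ _; set E := 2 * expR _ => KE0.
  rewrite (_ : K * k ^- 6 * E = 2^-1 * (2 * K * E * k ^- 6)); last by field; rewrite gt_eqF.
  rewrite mulrDr; apply: (@le_trans _ _ (2 * K * E * k ^- 6)).
    by rewrite ler_piMl ?mulr_ge0//; lra.
  by rewrite lerDl mulr_ge0.
Qed.

End operator_norms.

(** * Comparison of powers and exponentials for large $d$ *)

Section asymptotics.
Context {R : realType}.

Lemma powR_ge_near (a B : R) : 0 < a -> \forall d \near \oo, B <= d%:R `^ a.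
Proof.
move=> a0; pose B' := Num.max B 0.
have B'0 : 0 <= B' by rewrite le_max lexx orbT.
near=> d.
apply: (@le_trans _ _ B'); first by rewrite le_max lexx.
have -> : B' = (B' `^ a^-1) `^ a by rewrite -powRrM mulVf ?gt_eqF// powRr1.
have := @ge0_ler_powR R a (ltW a0) (B' `^ a^-1) d%:R.
rewrite !nnegrE powR_ge0 ler0n; apply => //.
near: d; exact: nbhs_infty_ger.
Unshelve. all: by end_near. Qed.

(** Put $y=d^c$ and take $m\ge2/c$. Then $d^2\le y^m\le m^me^y$, and $Am^m\le y\le e^y$ for large
    $d$, so the left side is at most $e^{2y-y^2}$; this is below $e^{-y}$ as soon as $y\ge3$. *)
Lemma poly_exp_near (c A : R) : 0 < c -> 0 <= A ->
  \forall d \near \oo, A * d%:R ^+ 2 * expR (- (d%:R `^ (2 * c))) <= expR (- (d%:R `^ c)).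
Proof.
move=> c0 A0.
pose m := (Num.truncn (2 / c)).+1.
have cm : 2 <= c * m%:R.
  by rewrite mulrC -ler_pdivrMr// ltW// truncnS_gt.
near=> d.
have d1 : 1 <= d%:R :> R by near: d; exact: nbhs_infty_ger.
have d0 : 0 <= d%:R :> R by [].
set y := d%:R `^ c.
have y3 : 3 <= y by rewrite /y; near: d; exact: powR_ge_near.
have yA : A * m%:R ^+ m <= y by rewrite /y; near: d; exact: powR_ge_near.
have y0 : 0 <= y by lra.
have -> : d%:R `^ (2 * c) = y ^+ 2 by rewrite mulrC powRrM powR_mulrn.
have dm : d%:R ^+ 2 <= y ^+ m.
  by rewrite -!powR_mulrn// -powRrM; apply: ler_powR.
have ym : y ^+ m <= m%:R ^+ m * expR y.
  have := expr_le_expR m (@ltr01 R) y0.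
  by rewrite expr1n invr1 mulr1 mul1r.
apply: (@le_trans _ _ (expR y * expR y * expR (- y ^+ 2))).
  apply: ler_wpM2r; first exact: expR_ge0.
  apply: (@le_trans _ _ (A * (m%:R ^+ m * expR y))).
    by apply: ler_wpM2l => //; exact: le_trans dm ym.
  rewrite mulrA; apply: ler_wpM2r; first exact: expR_ge0.
  apply: (le_trans yA); apply: le_trans (expR_ge1Dx y); lra.
rewrite -!expRD ler_expR; nra.
Unshelve. all: by end_near. Qed.

End asymptotics.

(** * Choice of the scales and conclusion *)

Theorem proposition1 (R : realType)
  (h : R -> R) (t : R) (t_gt0 : 0 < t)
  (n : nat -> nat)
  (pi0 : forall d : nat, probability 'rV[R]_d R)
  (Sigma : forall d : nat, 'M[R]_d)
  (disp : measure_display) (Omega : measurableType disp)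
  (P : probability Omega R)
  (X : forall d : nat, 'I_(n d) -> Omega -> 'rV[R]_d)
  (X_iid : forall d : nat, (0 < d)%N -> iid_sample P (pi0 d) (X d))
  (diag_pi0 : \forall d \near \oo, diag_integrable h t (noisy (pi0 d)))
  (diag_emp : \forall d \near \oo, \forall w \ae P,
     diag_integrable h t (noisy_empirical (sample (X d) w)))
  (r : R) (r_gt0 : 0 < r)
  (n_over_d : (fun d : nat => (n d)%:R / d%:R : R) @ \oo --> r)
  (pi0_mean : forall d : nat, (0 < d)%N -> centered (pi0 d))
  (pi0_cov : forall d : nat, (0 < d)%N -> has_covariance (pi0 d) (Sigma d))
  (c0 : R) (c0_gt0 : 0 < c0)
  (trace_liminf :
     (c0%:E <= limn_einf (fun d : nat => (\tr (Sigma d) / d%:R)%:E))%E)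
  (C_LSI : R) (C_LSI_ge1 : 1 <= C_LSI)
  (pi0_LSI : forall d : nat, (0 < d)%N -> log_sobolev (pi0 d) C_LSI)
  (K_pd : forall d : nat, (0 < d)%N -> pd_kernel (@inner_kernel R h d))
  (h_C3 : (forall k : nat, (k < 3)%N -> forall x : R, derivable (derive1n k h) x 1)
          /\ continuous (derive1n 3 h))
  (h_at0 : h 0 = 0) (h1_at0 : derive1n 1 h 0 = 1) (h2_at0 : derive1n 2 h 0 = 0)
  (C : R) (C_ge1 : 1 <= C)
  (h3_bound : forall x : R, `|derive1n 3 h x| <= C * expR (C * `|x|)) :
  prec P
    (fun d w => maxe (train_error h t (Sigma d) (sample (X d) w))
                     (test_error h t (pi0 d) (sample (X d) w)))
    (fun d _ => (d%:R `^ (- (3 / 2)))%:E).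
Proof.
have {}h_C3 := h_C3.1.
move=> eps eps0.
(* The part $\eta\le\epsilon/8$ makes the loss $d^{6\eta}$ at most $d^{\epsilon}$; the part
   $\eta\le1/8$ keeps the exponent $1/2-\eta$ of [k] positive. *)
pose eta := Num.min eps 1 / 8.
have [eta0 eta_eps eta1] : [/\ 0 < eta, 8 * eta <= eps & 8 * eta <= 1].
  have e8 : 8 * eta = Num.min eps 1 by rewrite mulrC divfK.
  rewrite !e8 !ge_min !lexx orbT; split => //.
  by rewrite divr_gt0// lt_min eps0 ltr01.
(* The added 1 gives $M\ge1$ and leaves room for the deviation: $\mathrm{Tr}(\Sigma)+d/k\le Md$. *)
pose M := variance_bound C_LSI + 1.
(* The factor $4/r^2$ comes from $n\ge rd/2$. *)
pose A := error_const C C_LSI M * (1 + 4 / r ^+ 2).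
(* There are at most $n+n^2\le2n^2$ tails, each with prefactor 2, and $n\le(r+1)d$; the exponential
   bounds the quadratic parts of their exponents. *)
pose B := 4 * (r + 1) ^+ 2 * expR (4 * C_LSI * M).
have B0 : 0 <= B by rewrite mulr_ge0 ?expR_ge0// mulr_ge0// sqr_ge0.
have eta2 : 0 < eta / 2 by rewrite divr_gt0.
have nr : \forall d \near \oo, r / 2 <= (n d)%:R / d%:R <= r + 1.
  have r20 : 0 < Num.min (r / 2) 1 by rewrite lt_min divr_gt0//= ltr01.
  have /cvgrPdist_le /(_ _ r20) := n_over_d.
  apply: filterS => d; rewrite le_min ler_norml => /andP[/andP[h1 h2]].
  by rewrite ler_norml => /andP[h3 h4]; apply/andP; split; lra.
(* The failure bound is $Bd^2e^{-d^\eta}$; halving the exponent absorbs the polynomial factor. *)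
exists (eta / 2).
have : \forall d \near \oo,
  (mu_ext P [set w | ((d%:R `^ eps)%:E * (d%:R `^ (- (3 / 2)))%:E <
     maxe (train_error h t (Sigma d) (sample (X d) w))
          (test_error h t (pi0 d) (sample (X d) w)))%E]
   <= (expR (- (d%:R `^ (eta / 2))))%:E)%E; last first.
  by move=> [N _ HN]; exists N; split => // d Nd; exact: HN.
near=> d.
have d0 : (0 < d)%N by near: d; exact: nbhs_infty_gt.
set x : R := d%:R.
have x1 : 1 <= x by rewrite /x ler1n.
have x0 : 0 < x by exact: (lt_le_trans ltr01 x1).
have xn0 : x != 0 by rewrite gt_eqF.
have xD a b : x `^ (a + b) = x `^ a * x `^ b by rewrite powRD// xn0 implybT.
have xN a : x `^ (- a) = (x `^ a)^-1 by exact: powRN.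
have x_n a (m : nat) : (x `^ a) ^+ m = x `^ (a * m%:R) by rewrite powRrM powR_mulrn// powR_ge0.
pose k := x `^ (2^-1 - eta).
have k0 : 0 < k by exact: powR_gt0.
have [n1 n2] : r / 2 * x <= (n d)%:R /\ (n d)%:R <= (r + 1) * x.
  have : r / 2 <= (n d)%:R / d%:R <= r + 1 by near: d.
  by rewrite -/x ler_pdivlMr// ler_pdivrMr// => /andP[].
have n0 : (0 < n d)%N.
  by rewrite -(ltr0n R); apply: lt_le_trans n1; rewrite mulr_gt0// divr_gt0.
have kC : 4 + 2 * C <= k by rewrite /k /x; near: d; apply: powR_ge_near; lra.
have k2x : k ^+ 2 <= x.
  by rewrite x_n -[leRHS](powRr1 (ltW x0)); apply: ler_powR => //; clear - eta0; lra.
have C0 : 0 < C_LSI by exact: (lt_le_trans ltr01 C_LSI_ge1).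
have xC : 32 * C_LSI <= x by rewrite /x; near: d; exact: nbhs_infty_ger.
have lsi := pi0_LSI d d0; have mean0 := pi0_mean d d0; have cov := pi0_cov d d0.
have tr0 := trace_ge0 mean0 cov.
have trle := trace_le C_LSI_ge1 lsi mean0 cov.
have V0 : 0 <= variance_bound C_LSI by rewrite mulr_ge0// expR_ge0.
have M1 : 1 <= M by rewrite /M lerDr.
have VM : variance_bound C_LSI <= M by rewrite /M lerDl.
have trM : \tr (Sigma d) <= M * x.
  by apply: (le_trans trle); rewrite ler_wpM2r// ltW.
have lt_mu : light_tailed (pi0 d) C_LSI M.
  exact: light_tailed_mono VM (lsi_light_tailed C_LSI_ge1 lsi mean0 cov).
(* As $s^2d=1$, the quadratic parts of the tail exponents stay bounded, while the gain $s\,d/k$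
   equals $d^\eta$. *)
pose s := x `^ (- 2^-1).
have s_gt0 : 0 < s by exact: powR_gt0.
have s2 : s ^+ 2 * x = 1.
  rewrite x_n -[X in _ * X](powRr1 (ltW x0)) -xD (_ : _ + _ = 0) ?powRr0//; clear; lra.
have sC : 0 < s <= (4 * C_LSI)^-1.
  rewrite s_gt0 /s xN lef_pV2 ?posrE ?powR_gt0 ?mulr_gt0//.
  by rewrite /x; near: d; apply: powR_ge_near.
have kx : x / k <= x.
  by rewrite ler_pdivrMr// ler_peMr ?(ltW x0)//; clear - kC C_ge1; lra.
have TQ : \tr (Sigma d) + x / k <= M * x by rewrite /M mulrDl mul1r lerD.
have [Bad [mBad PBad good]] := bad_event C_LSI_ge1 lsi mean0 cov (X_iid d d0) sC TQ.
(* The event of a large error is not known to be measurable, so its outer probability is bounded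
   through the measurable set [Bad]. *)
have sub : [set w | ((d%:R `^ eps)%:E * (d%:R `^ (- (3 / 2)))%:E <
     maxe (train_error h t (Sigma d) (sample (X d) w))
          (test_error h t (pi0 d) (sample (X d) w)))%E] `<=` Bad.
  move=> w /=; rewrite ltNge => /negP Hw; apply: contrapT => /good[Xd Xo]; apply: Hw.
  rewrite -EFinM; apply: (sample_error_le h_C3 h_at0 h1_at0 h2_at0 C_ge1 h3_bound t_gt0
    d0 n0 C_LSI_ge1 M1 kC k2x xC lt_mu tr0 trM _ Xd Xo).
  - move=> i; have := Xd i; rewrite ler_norml => /andP[_ hi].
    by apply: le_trans TQ; rewrite -lerBlDl.
  - by rewrite mulr_ge0// powR_ge0.
  - have E0 := error_const_ge0 C_ge1 C_LSI M.
    have k6E : k ^- 6 = x `^ (6 * eta - 3).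
      by rewrite x_n -xN; congr (_ `^ _); clear; lra.
    have k2E : k ^- 2 = x `^ (2 * eta - 1).
      by rewrite x_n -xN; congr (_ `^ _); clear; lra.
    have nV : (n d)%:R ^- 2 <= 4 / r ^+ 2 * x `^ (- 2%:R) :> R.
      rewrite powR_invn ?(ltW x0)//.
      have -> : 4 / r ^+ 2 * x ^- 2 = (r / 2 * x) ^- 2 by field; rewrite xn0 gt_eqF.
      have rx : 0 < r / 2 * x by rewrite mulr_gt0// divr_gt0.
      have np : 0 < (n d)%:R :> R by rewrite ltr0n.
      rewrite lef_pV2 ?posrE ?exprn_gt0//.
      by apply: lerXn2r => //; rewrite nnegrE; exact: ltW.
    have q0 : 0 <= 4 / r ^+ 2 by rewrite divr_ge0// sqr_ge0.
    have sum_le : k ^- 6 + (n d)%:R ^- 2 * k ^- 2 <= (1 + 4 / r ^+ 2) * x `^ (6 * eta - 3).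
      rewrite k6E k2E [leRHS]mulrDl [X in _ <= X + _]mul1r; apply: lerD => //.
      apply: (@le_trans _ _ (4 / r ^+ 2 * x `^ (- 2%:R) * x `^ (2 * eta - 1))).
        by rewrite ler_wpM2r// powR_ge0.
      rewrite -mulrA -xD; apply: ler_wpM2l => //; apply: ler_powR => //.
      by clear - eta0; lra.
    apply: le_trans (ler_wpM2l E0 sum_le) _; rewrite mulrA -/A.
    (* Squaring makes $d^{2\epsilon}$ available: one factor $d^\epsilon$ absorbs the constant, the
       other the loss $d^{6\eta}$. *)
    have hA : A <= x `^ eps by rewrite /x; near: d; exact: powR_ge_near.
    apply: (@le_trans _ _ (x `^ eps * x `^ (6 * eta - 3))).
      by rewrite ler_wpM2r// powR_ge0.
    rewrite -!xD x_n; apply: ler_powR => //; clear - eta0 eta_eps; lra.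
apply: (le_trans (le_mu_ext P sub)).
rewrite measurable_mu_extE//; apply: (le_trans PBad); rewrite lee_fin.
have sxk : s * (x / k) = x `^ eta.
  rewrite -xN -[X in X * x `^ _](powRr1 (ltW x0)) -!xD; congr (_ `^ _); clear; lra.
have hB : B * x ^+ 2 * expR (- (x `^ (2 * (eta / 2)))) <= expR (- (x `^ (eta / 2))).
  by rewrite /x; near: d; exact: (poly_exp_near eta2 B0).
apply: le_trans hB.
have -> : 2 * (eta / 2) = eta by field.
have CM0 : 0 <= C_LSI * M by rewrite mulr_ge0 ?(ltW C0) ?(le_trans _ M1).
have e1 : 4 * C_LSI * s ^+ 2 * \tr (Sigma d) <= 4 * C_LSI * M.
  rewrite -[leRHS]mulr1 -[X in _ <= _ * X]s2 (_ : 4 * C_LSI * M * (s ^+ 2 * x) =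
    4 * C_LSI * s ^+ 2 * (M * x)); last by ring.
  by apply: ler_wpM2l => //; rewrite !mulr_ge0 ?sqr_ge0// ltW.
have e2 : C_LSI * s ^+ 2 * (M * x) / 2 <= 4 * C_LSI * M.
  rewrite (_ : C_LSI * s ^+ 2 * (M * x) = C_LSI * M * (s ^+ 2 * x)); last by ring.
  rewrite s2 mulr1 -(mulrA 4); clear - CM0; lra.
rewrite sxk; set E := expR (4 * C_LSI * M) * expR (- x `^ eta).
have E1 : expR (- x `^ eta + 4 * C_LSI * s ^+ 2 * \tr (Sigma d)) <= E.
  by rewrite /E -expRD ler_expR addrC lerD2r.
have E2 : expR (- x `^ eta + C_LSI * s ^+ 2 * (M * x) / 2) <= E.
  by rewrite /E -expRD ler_expR addrC lerD2r.
have E0 : 0 <= E by rewrite mulr_ge0 ?expR_ge0.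
have N1 : 1 <= (n d)%:R :> R by rewrite ler1n.
apply: (@le_trans _ _ ((n d)%:R * (n d)%:R * (2 * E) + (n d)%:R * (n d)%:R * (2 * E))).
  apply: lerD.
    apply: ler_pM; rewrite ?mulr_ge0 ?expR_ge0// ?ler_peMl// ler_wpM2l//.
  by apply: ler_wpM2l; rewrite ?mulr_ge0// ler_wpM2l.
rewrite (_ : _ + _ = 4 * (n d)%:R ^+ 2 * E); last by ring.
rewrite (_ : B * x ^+ 2 * expR (- x `^ eta) = 4 * ((r + 1) * x) ^+ 2 * E); last first.
  by rewrite /B /E; ring.
apply: ler_wpM2r => //; apply: ler_wpM2l => //.
have r1 : 0 <= r + 1 by rewrite addr_ge0// ltW.
by apply: lerXn2r => //; rewrite nnegrE ?ler0n// mulr_ge0// ltW.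
Unshelve. all: by end_near. Qed.
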